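(* All ergodic cone hyperbolic contact flows on a compact manifold are Reeb flows. That is: let $M$ be a compact smooth manifold of dimension $d=2k+1$ with a $C^2$ contact form $\alpha$, and let $T_t$ be a piecewise $C^2$ cone hyperbolic flow on a closed subset $X_0$ of $M$ which preserves $\alpha$ (contact flow) and is ergodic for the volume $\alpha\wedge(d\alpha)^k$ on $X_0$. Then there exists a contact form $\beta$ on $M$ such that $T_t$ is the Reeb flow of $\beta$.
   Context: Contact and Reeb flows. Let $V$ be the vector field generating $T_t$ (defined almost everywhere on $X_0$). $T_t$ is a contact flow if $T_t^*\alpha=\alpha$, i.e. $\frac{d}{dt}\alpha(DT_tv)=0$ for each tangent vector $v$ (almost everywhere where $T_t$ is differentiable). $T_t$ is the Reeb flow of a contact form $\beta$ if $V\in\mathrm{Ker}(d\beta)$ and $\beta(V)=1$ (almost everywhere on $X_0$). Cones. A $k$-dimensional cone in $\mathbb{R}^d$ ($1\le k\le d-1$) is a closed subset $\mathcal{C}$ for which there are a linear coordinate system $\mathbb{R}^{d-k}\times\mathbb{R}^k$ and a maximal rank linear map $\mathcal{A}:\mathbb{R}^k\to\mathbb{R}^d$ with $\mathcal{C}=\{(x,y): |x|\le|\mathcal{A}y|\}$. A family of cones is continuous if the coordinate system and $\mathcal{A}$ can be chosen continuously. Piecewise $C^2$ cone hyperbolic flow. Let $M$ be a compact smooth manifold of dimension $d=d_u+d_s+1$, $d_u,d_s\ge1$ and $X_0\subset M$ closed. A measurable flow $T_t:X_0\to X_0$ is piecewise $C^2$ (cone) hyperbolic if there are finitely many codimension-one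 $C^2$ open hypersurfaces $O_i$, $i\in I$, of $M$, uniformly transversal to the flow direction, and subsets $J_i\subset I$ such that: (0) For $i\in I$, $j\in J_i$ there are open subsets $O_{i,j}\subset O_i$ (in the sense of hypersurfaces), disjoint for different $j$, with $O_i=\cup_{j\in J_i}O_{i,j}$ modulo a zero Lebesgue measure set, each boundary $\partial O_{i,j}$ being a finite union of codimension-two $C^1$ hypersurfaces; and there are $C^2$ strictly positive functions $\tau_{i,j}$ on a neighbourhood $\widetilde O_{i,j}$ of $\overline{O_{i,j}}$ (as hypersurfaces) so that for $w\in O_{i,j}$ one has $T_t(w)\in X_0$ for $t\in[0,\tau_{i,j}(w))$ and $T_{\tau_{i,j}(w)}(w)\in O_j$. The flow boxes $B_{i,j}=\cup_{z\in O_{i,j}}\cup_{t\in[0,\tau_{i,j}(z))}T_t(z)$ are pairwise disjoint and their union is $X_0$ modulo a zero Lebesgue measure set. For $w\in B_{i,j}$ let $z(w)\in O_{i,j}$ and $t(w)\in[0,\tau_{i,j}(z(w)))$ be such that $w=T_{t(w)}(z(w))$. (1) For each $i$, $j\in J_i$ there are a neighbourhood $\widetilde B_{i,j}$ of $\overline{B_{i,j}}$ and a $C^2$ flow $T_{i,j,t}$ on $\widetilde B_{i,j}$ with $T_t(w)=T_{i,j,t}(w)$ whenever $w,T_t(w)\in B_{i,j}$. Also $w\mapsto T_{\tau_{i,j}(w)}(w)$ from $O_{i,j}$ to $O_j$ extends to a $C^2$ map, defined on a neighbourhood in $M$ of the closure of $\widetilde O_{i,j}$, which is a diffeomorphism onto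 its image. (2) For each $i$, $j\in J_i$ there are continuous families of cones $\mathcal{C}^{(u)}_{i,j}(w),\mathcal{C}^{(s)}_{i,j}(w)\subset T_wM$, $w\in\overline{B_{i,j}}$, of dimensions $d_u$ and $d_s$, such that $\mathcal{C}^{(u)}_{i,j}(w)$, $\mathcal{C}^{(s)}_{i,j}(w)$ and the flow direction at $w$ pairwise intersect only at $0$. Moreover, for any $t_{00}>0$ there are a smooth norm on $TM$ and continuous functions $\lambda_{i,j,u}:\overline{B_{i,j}}\to(1,\infty)$, $\lambda_{i,j,s}:\overline{B_{i,j}}\to(0,1)$ such that for each $w\in\overline{B_{i,j}}$ and $t\in(t_{00},\tau_{i,j}(z(w))-t(w)]$, if $T_{i,j,t}(w)\in B_{k,\ell}$, then $DT_{i,j,t}(w)\,\mathcal{C}^{(u)}_{i,j}(w)\subset\mathcal{C}^{(u)}_{k,\ell}(T_{i,j,t}(w))$ and $|DT_{i,j,t}(w)v|\ge\lambda_{i,j,u}(w)^t|v|$ for $v\in\mathcal{C}^{(u)}_{i,j}(w)$, and $DT_{i,j,t}^{-1}(T_{i,j,t}(w))\,\mathcal{C}^{(s)}_{k,\ell}(T_{i,j,t}(w))\subset\mathcal{C}^{(s)}_{i,j}(w)$ and $|DT_{i,j,t}^{-1}(T_{i,j,t}(w))v|\ge\lambda_{i,j,s}(w)^{-t}|v|$ for $v\in\mathcal{C}^{(s)}_{k,\ell}(T_{i,j,t}(w))$. *)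

(* Defs.v *)
From HB Require Import structures.
From mathcomp Require Import all_boot all_order all_algebra all_fingroup.
From mathcomp Require Import all_classical all_reals all_analysis.

Set Implicit Arguments.
Unset Strict Implicit.
Unset Printing Implicit Defensive.

Import Order.TTheory GRing.Theory Num.Theory.
Import numFieldNormedType.Exports.

Local Open Scope classical_set_scope.
Local Open Scope ring_scope.

(* Lebesgue measure on R^n, built by iterated products on n-tuples. *)
Section cons_measure.
Context (R : realType) (n : nat)
  (m : {sigma_finite_measure set (n.-tuple (measurableTypeR R)) -> \bar R}).

Definition cons_pair (p : measurableTypeR R * n.-tuple (measurableTypeR R)) :
  n.+1.-tuple (measurableTypeR R) := [the n.+1.-tuple _ of p.1 :: p.2].

Let measurable_cons_pair : measurable_fun [set: _] cons_pair.
Proof. exact: (measurable_cons measurable_fst measurable_snd). Qed.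

Definition cons_measure : set (n.+1.-tuple (measurableTypeR R)) -> \bar R :=
  pushforward (@lebesgue_measure R \x m)%E cons_pair.

Let cons_measure0 : cons_measure set0 = 0%E.
Proof. by rewrite /cons_measure /pushforward preimage_set0 measure0. Qed.

Let cons_measure_ge0 A : (0 <= cons_measure A)%E.
Proof. exact: measure_ge0. Qed.

Let cons_measure_sigma_additive : semi_sigma_additive cons_measure.
Proof.
move=> F mF tF mUF; rewrite /cons_measure /pushforward preimage_bigcup.
apply: measure_semi_sigma_additive.
- by move=> k; rewrite -[X in measurable X]setTI; exact: measurable_cons_pair.
- apply/trivIsetP => /= i j _ _ ij; rewrite -preimage_setI.
  by move/trivIsetP : tF => /(_ _ _ _ _ ij) ->//; rewrite preimage_set0.
- by rewrite -preimage_bigcup -[X in measurable X]setTI;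
    exact: measurable_cons_pair.
Qed.

HB.instance Definition _ := isMeasure.Build _ _ _ cons_measure
  cons_measure0 cons_measure_ge0 cons_measure_sigma_additive.

Let cons_measure_sigma_finite : sigma_finite setT cons_measure.
Proof.
have [F FT Foo] : sigma_finite setT (@lebesgue_measure R \x m)%E.
  have /sigma_finiteP[F [TF ndF Foo]] := sigma_finiteT (@lebesgue_measure R).
  have /sigma_finiteP[G [TG ndG Goo]] := sigma_finiteT m.
  exists (fun k => F k `*` G k).
    rewrite -setXTT TF TG predeqE => -[x y]; split.
      move=> [/= [i _ Fix] [j _ Gjy]]; exists (maxn i j) => //; split.
      - by move: x Fix; exact/subsetPset/ndF/leq_maxl.
      - by move: y Gjy; exact/subsetPset/ndG/leq_maxr.
    by move=> [i _ []/= ? ?]; split; exists i.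
  move=> k; have [? ?] := Foo k; have [? ?] := Goo k.
  split; first exact: measurableX.
  by rewrite product_measure1E// lte_mul_pinfty// ge0_fin_numE.
pose split_tuple (t : n.+1.-tuple (measurableTypeR R)) :
    measurableTypeR R * n.-tuple (measurableTypeR R) :=
  (thead t, [tuple of behead t]).
have mspl : measurable_fun [set: _] split_tuple.
  by apply: measurable_fun_pair; [exact: measurable_tnth|exact: measurable_behead].
exists (fun k => split_tuple @^-1` F k) => [|k].
  by rewrite -preimage_bigcup -FT preimage_setT.
have [mF oF] := Foo k; split; first by rewrite -[X in measurable X]setTI; exact: mspl.
rewrite /cons_measure /pushforward -comp_preimage.
suff -> : split_tuple \o cons_pair = id by [].
apply/funext => -[x t] /=; rewrite /split_tuple /cons_pair /=; congr pair.
exact: val_inj.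
Qed.

HB.instance Definition _ := Measure_isSigmaFinite.Build _ _ _ cons_measure
  cons_measure_sigma_finite.

End cons_measure.

Section tuple0_measure.
Context (R : realType).

Definition tuple0_measure : set (0.-tuple (measurableTypeR R)) -> \bar R :=
  dirac [tuple].

HB.instance Definition _ := Measure.on tuple0_measure.

Let tuple0_measure_sigma_finite : sigma_finite setT tuple0_measure.
Proof.
apply: fin_num_fun_sigma_finite; first by rewrite measure0.
by move=> A _; rewrite /tuple0_measure diracE.
Qed.

HB.instance Definition _ := Measure_isSigmaFinite.Build _ _ _ tuple0_measure
  tuple0_measure_sigma_finite.

End tuple0_measure.

Fixpoint lebesgue_tuple (R : realType) (n : nat) :
    {sigma_finite_measure set (n.-tuple (measurableTypeR R)) -> \bar R} :=
  match n with
  | 0 => @tuple0_measure R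
  | n'.+1 => cons_measure (lebesgue_tuple R n')
  end.

Section euclidean_space.
Context (R : realType).

Definition rV_of_tuple (n : nat) (t : n.-tuple (measurableTypeR R)) : 'rV[R]_n :=
  \row_i tnth t i.

Definition lebesgue_null (n : nat) (A : set 'rV[R]_n) : Prop :=
  (lebesgue_tuple R n).-negligible (@rV_of_tuple n @^-1` A).

(* the library norm on row vectors is the sup norm *)
Definition euclid (n : nat) (v : 'rV[R]_n) : R :=
  Num.sqrt (\sum_(i < n) v ord0 i ^+ 2).

(* f is of class C^k on U, meant for U open and V, W of finite dimension *)
Fixpoint Ck_on (k : nat) (V W : normedModType R) (U : set V) (f : V -> W) : Prop :=
  match k with
  | 0 => forall x, U x -> {for x, continuous f}
  | k'.+1 => (forall x, U x -> differentiable f x) /\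
             (forall v, Ck_on k' U (fun x => 'd f x v))
  end.

Definition smooth_on (V W : normedModType R) (U : set V) (f : V -> W) : Prop :=
  forall k, Ck_on k U f.

End euclidean_space.

Section exterior_algebra.
Context (R : realType) (V : Type).

Definition mform (p : nat) := ('I_p -> V) -> R.

Definition wedge (p q : nat) (a : mform p) (b : mform q) : mform (p + q) :=
  fun v => ((p`! * q`!)%N%:R)^-1 *
    \sum_(s : 'S_(p + q)) (-1) ^+ s *
      a (fun i => v (s (lshift q i))) * b (fun j => v (s (rshift p j))).

Fixpoint wedge_pow (k : nat) (w : mform 2) : mform (k * 2) :=
  match k with
  | 0 => fun=> 1
  | k'.+1 => wedge w (@wedge_pow k' w)
  end.

End exterior_algebra.
Arguments wedge_pow {R V} k w _.

Record chart (R : realType) (d : nat) (M : topologicalType) := Chart {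
  chart_dom : set M ;
  chart_cod : set 'rV[R]_d ;
  fwd : M -> 'rV[R]_d ;
  bwd : 'rV[R]_d -> M ;
  chart_open_dom : open chart_dom ;
  chart_open_cod : open chart_cod ;
  fwd_cod : forall p, chart_dom p -> chart_cod (fwd p) ;
  bwd_dom : forall x, chart_cod x -> chart_dom (bwd x) ;
  fwdK : forall p, chart_dom p -> bwd (fwd p) = p ;
  bwdK : forall x, chart_cod x -> fwd (bwd x) = x ;
  fwd_continuous : forall p, chart_dom p -> {for p, continuous fwd} ;
  bwd_continuous : forall x, chart_cod x -> {for x, continuous bwd} }.

(* A nonempty smooth manifold without boundary.  The field [chart_at] is an
   arbitrary choice of one chart around each point: the tangent space at p is
   'rV[R]_d, a vector being represented by its components in [chart_at p]. *)
Record manifold (R : realType) (d : nat) := Manifold {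
  msort :> ptopologicalType ;
  manifold_hausdorff : hausdorff_space msort ;
  manifold_second_countable : @second_countable msort ;
  atlas : set (chart R d msort) ;
  chart_at : msort -> chart R d msort ;
  chart_at_atlas : forall p, atlas (chart_at p) ;
  chart_at_dom : forall p, chart_dom (chart_at p) p ;
  atlas_smooth : forall c c', atlas c -> atlas c' ->
    smooth_on [set x | chart_cod c x /\ chart_dom c' (bwd c x)]
              (fwd c' \o bwd c) }.

Section calculus.
Context (R : realType) (d : nat) (M : manifold R d).

Definition tangent := 'rV[R]_d.

(* the vector of T_p M whose components in the chart c are u *)
Definition coord_vec (c : chart R d M) (p : M) (u : 'rV[R]_d) : tangent :=
  'd (fwd (chart_at p) \o bwd c) (fwd c p) u.

Definition local_rep (F : M -> M) (p : M) : 'rV[R]_d -> 'rV[R]_d :=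
  fwd (chart_at (F p)) \o F \o bwd (chart_at p).

Definition mdifferentiable (F : M -> M) (p : M) : Prop :=
  {for p, continuous F} /\
  differentiable (local_rep F p) (fwd (chart_at p) p).

Definition mdiff (F : M -> M) (p : M) (v : tangent) : tangent :=
  'd (local_rep F p) (fwd (chart_at p) p) v.

(* v is the velocity at time 0 of the curve g, as a vector of T_(g 0) M *)
Definition velocity (g : R -> M) (v : tangent) : Prop :=
  (\forall t \near (0 : R), chart_dom (chart_at (g 0)) (g t)) /\
  is_derive (0 : R) (1 : R) (fun t => fwd (chart_at (g 0)) (g t)) v.

Definition Ck_to (k : nat) (V : normedModType R) (U : set V) (F : V -> M) : Prop :=
  (forall x, U x -> {for x, continuous F}) /\
  (forall c, atlas c -> Ck_on k (U `&` F @^-1` chart_dom c) (fwd c \o F)).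

Definition Ck_map (k : nat) (U : set M) (F : M -> M) : Prop :=
  forall c, atlas c -> Ck_to k (chart_cod c `&` bwd c @^-1` U) (F \o bwd c).

Definition Ck_fun (k : nat) (W : normedModType R) (U : set M) (f : M -> W) : Prop :=
  forall c, atlas c -> Ck_on k (chart_cod c `&` bwd c @^-1` U) (f \o bwd c).

Definition mnull (A : set M) : Prop :=
  forall c, atlas c -> lebesgue_null (chart_cod c `&` bwd c @^-1` A).

Definition borelM := g_sigma_algebraType (@open M).

(* embedded submanifold of class C^k and codimension m, without boundary and
   not necessarily closed *)
Definition submanifold (k m : nat) (S : set M) : Prop :=
  forall p, S p -> exists (U : set M) (g : M -> 'rV[R]_m),
    [/\ open U, U p, Ck_fun k U g,
        (forall q, U q -> (S q <-> g q = 0)) &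
        (forall q, U q -> S q -> forall y : 'rV[R]_m, exists u : tangent,
           'd (g \o bwd (chart_at q)) (fwd (chart_at q) q) u = y)].

(* a C^k submanifold of codimension m possibly with (nonsmooth) boundary: the
   closure, relative to a boundaryless submanifold, of a relatively open part *)
Definition submanifold_piece (k m : nat) (K : set M) : Prop :=
  exists S W : set M, [/\ submanifold k m S, open W & K = S `&` closure (S `&` W)].

Definition rel_open (S A : set M) : Prop := exists2 W, open W & A = S `&` W.

Definition tangent_to (S : set M) (p : M) (v : tangent) : Prop :=
  exists g : R -> M,
    [/\ g 0 = p, (\forall t \near (0 : R), S (g t)) & velocity g v].

Definition Ck_fun_sub (k : nat) (S : set M) (f : M -> R) : Prop :=
  forall p, S p -> exists (U : set M) (g : M -> R),
    [/\ open U, U p, Ck_fun k U g & forall q, U q -> S q -> f q = g q].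

(* A has zero n-dimensional Lebesgue measure in the n-dimensional C^1
   submanifold S *)
Definition null_in (n : nat) (S A : set M) : Prop :=
  forall (U : set 'rV[R]_n) (psi : 'rV[R]_n -> M),
    open U -> Ck_to 1 U psi -> (forall x, U x -> S (psi x)) ->
    (forall x, U x -> injective ('d (fwd (chart_at (psi x)) \o psi) x)) ->
    lebesgue_null (U `&` psi @^-1` A).

Definition smooth_norm (N : M -> tangent -> R) : Prop :=
  [/\ (forall p v, N p v = 0 -> v = 0),
      (forall p v w, N p (v + w) <= N p v + N p w),
      (forall p a v, N p (a *: v) = `|a| * N p v) &
      (forall c, atlas c ->
         smooth_on [set z : 'rV[R]_d * 'rV[R]_d | chart_cod c z.1 /\ z.2 != 0]
           (fun z => N (bwd c z.1) (coord_vec c (bwd c z.1) z.2)))].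

End calculus.

Section contact_forms.
Context (R : realType) (d : nat) (M : manifold R d).

(* a one-form is given at p by its components in [chart_at p] *)
Definition oneform := M -> 'cV[R]_d.

Definition eval (a : 'cV[R]_d) (v : tangent R d) : R := (v *m a) ord0 ord0.

(* x |-> a(u), where u is a constant vector in the chart c *)
Definition eval_in (a : oneform) (c : chart R d M) (u x : 'rV[R]_d) : R :=
  eval (a (bwd c x)) (coord_vec c (bwd c x) u).

Definition Ck_oneform (k : nat) (a : oneform) : Prop :=
  forall c, atlas c -> forall u, Ck_on k (chart_cod c) (eval_in a c u).

Definition ext_deriv (a : oneform) (p : M) (v w : tangent R d) : R :=
  'D_v (eval_in a (chart_at p) w) (fwd (chart_at p) p)
  - 'D_w (eval_in a (chart_at p) v) (fwd (chart_at p) p).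

(* alpha /\ (d alpha)^k at p *)
Definition contact_volume (k : nat) (a : oneform) (p : M) :
    mform R (tangent R d) (1 + k * 2) :=
  wedge (fun v : 'I_1 -> tangent R d => eval (a p) (v ord0))
        (wedge_pow k (fun v : 'I_2 -> tangent R d =>
                        ext_deriv a p (v ord0) (v ord_max))).

End contact_forms.
Arguments contact_volume {R d M} k a p _.

Section contact_manifolds.
Context (R : realType) (k : nat) (M : manifold R (k * 2).+1).
Local Notation d := (k * 2).+1.

(* a C^2 contact form on a manifold of dimension 2k+1 *)
Definition contact_form (a : oneform M) : Prop :=
  Ck_oneform 2 a /\ forall p, exists v, contact_volume k a p v != 0.

(* density of alpha /\ (d alpha)^k with respect to dx_1 ... dx_d in chart c *)
Definition volume_density (a : oneform M) (c : chart R d M) (x : 'rV[R]_d) : R :=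
  contact_volume k a (bwd c x)
    (fun i => coord_vec c (bwd c x) (delta_mx ord0 i)).

(* mu is the measure |alpha /\ (d alpha)^k| *)
Definition is_volume (a : oneform M) (mu : {measure set (borelM M) -> \bar R}) : Prop :=
  forall (c : chart R d M) (A : set (borelM M)), atlas c -> measurable A ->
    A `<=` chart_dom c ->
    mu A = (\int[lebesgue_tuple R d]_(t in
              [set t | chart_cod c (rV_of_tuple t) /\ A (bwd c (rV_of_tuple t))])
              `|volume_density a c (rV_of_tuple t)|%:E)%E.

End contact_manifolds.

Section flows.
Context (R : realType) (d : nat) (M : manifold R d).

(* The values of T outside X0 are irrelevant. *)
Definition measurable_flow (X0 : set M) (T : R -> M -> M) : Prop :=
  [/\ (forall t w, X0 w -> X0 (T t w)),
      (forall w, X0 w -> T 0 w = w),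
      (forall s t w, X0 w -> T (s + t) w = T s (T t w)) &
      measurable_fun ([set: measurableTypeR R] `*` (X0 : set (borelM M)))
        (fun p : measurableTypeR R * borelM M => (T p.1 p.2 : borelM M))].

(* T_t^* alpha = alpha almost everywhere where T_t is differentiable *)
Definition contact_flow (X0 : set M) (T : R -> M -> M) (a : oneform M) : Prop :=
  forall t, mnull [set w | [/\ interior X0 w, mdifferentiable (T t) w &
    ~ (forall v, eval (a (T t w)) (mdiff (T t) w v) = eval (a w) v)]].

(* the generating vector field V of T satisfies V \in Ker (d beta) and
   beta(V) = 1 almost everywhere on X0 *)
Definition reeb_flow (X0 : set M) (T : R -> M -> M) (b : oneform M) : Prop :=
  mnull (X0 `\` [set w | exists V : tangent R d,
    [/\ velocity (T ^~ w) V, (forall u, ext_deriv b w V u = 0) &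
        eval (b w) V = 1]]).

(* invariance of a set is understood modulo mu *)
Definition ergodic (mu : {measure set (borelM M) -> \bar R}) (X0 : set M) (T : R -> M -> M) : Prop :=
  forall A : set (borelM M), measurable A -> A `<=` X0 ->
    (forall t, let TA := X0 `&` T t @^-1` A in
       mu ((TA `\` A) `|` (A `\` TA)) = 0%E) ->
    mu A = 0%E \/ mu (X0 `\` A) = 0%E.

(* C^2 local flow on the open set B, defined on the set D of pairs (t, w) *)
Definition local_flow (B : set M) (D : set (R * M))
    (T : R -> M -> M) : Prop :=
  [/\ open B, open D,
      [/\ (forall w, B w -> D (0, w) /\ T 0 w = w),
          (forall t w, D (t, w) -> B w /\ B (T t w)) &
          (forall t w r, D (t, w) -> 0 <= r <= 1 -> D (r * t, w))],
      [/\ (forall t w, D (t, w) -> D (- t, T t w)) &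
          (forall s t w, D (t, w) -> D (s, T t w) ->
             D (s + t, w) /\ T (s + t) w = T s (T t w))] &
      (forall c, atlas c ->
         Ck_to 2 [set z : R * 'rV[R]_d | chart_cod c z.2 /\ D (z.1, bwd c z.2)]
           (fun z => T z.1 (bwd c z.2)))].

(* P is a C^2 diffeomorphism from the open set N onto an open image *)
Definition C2_diffeo_on (N : set M) (P : M -> M) : Prop :=
  open N /\ open (P @` N) /\ Ck_map 2 N P /\
  exists Q : M -> M, Ck_map 2 (P @` N) Q /\ forall w, N w -> Q (P w) = w.

(* {(x, y) : |x| <= |A y|} in the linear coordinates x = v P, y = v Q *)
Definition cone (n : nat) (P : 'M[R]_(d, d - n)) (Q : 'M[R]_(d, n))
    (A : 'M[R]_(n, d)) : set (tangent R d) :=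
  [set v | euclid (v *m P) <= euclid (v *m Q *m A)].

(* a continuous family, indexed by w in D, of n-dimensional cones C w in T_w M *)
Definition continuous_cones (n : nat) (D : set M) (C : M -> set (tangent R d)) : Prop :=
  (0 < n < d)%N /\
  exists (P : M -> 'M[R]_(d, d - n)) (Q : M -> 'M[R]_(d, n)) (A : M -> 'M[R]_(n, d)),
    [/\ (forall w, D w ->
           [/\ \rank (row_mx (P w) (Q w)) = d, \rank (A w) = n &
               C w = cone (P w) (Q w) (A w)]),
        (forall c, atlas c -> forall u : 'rV[R]_d,
           {within D `&` chart_dom c, continuous (fun w => coord_vec c w u *m P w)}),
        (forall c, atlas c -> forall u : 'rV[R]_d,
           {within D `&` chart_dom c, continuous (fun w => coord_vec c w u *m Q w)}) &
        {within D, continuous A}].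

(* The objects of the definition of a piecewise C^2 cone hyperbolic flow; the
   doubly indexed ones are only meaningful for j \in J i. *)
Record flow_boxes := FlowBoxes {
  fb_I : finType ;
  fb_J : fb_I -> {set fb_I} ;
  fb_O : fb_I -> set M ;
  fb_Oij : fb_I -> fb_I -> set M ;
  fb_Ot : fb_I -> fb_I -> set M ;           (* neighbourhood of closure O_ij *)
  fb_tau : fb_I -> fb_I -> M -> R ;
  fb_z : fb_I -> fb_I -> M -> M ;           (* z(w), for w in closure B_ij *)
  fb_t : fb_I -> fb_I -> M -> R ;           (* t(w), for w in closure B_ij *)
  fb_Bt : fb_I -> fb_I -> set M ;           (* neighbourhood of closure B_ij *)
  fb_D : fb_I -> fb_I -> set (R * M) ;      (* domain of the local flow *)
  fb_T : fb_I -> fb_I -> R -> M -> M ;      (* the local flow T_ij *)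
  fb_N : fb_I -> fb_I -> set M ;            (* domain of the extended *)
  fb_P : fb_I -> fb_I -> M -> M ;           (*   first hitting map *)
  fb_Cu : fb_I -> fb_I -> M -> set (tangent R d) ;
  fb_Cs : fb_I -> fb_I -> M -> set (tangent R d) }.

Section hyperbolicity.
Context (du ds : nat) (X0 : set M) (T : R -> M -> M) (F : flow_boxes).
Local Notation I := (fb_I F).
Local Notation J := (fb_J (f := F)).
Local Notation O := (fb_O (f := F)).
Local Notation Oij := (fb_Oij (f := F)).
Local Notation Ot := (fb_Ot (f := F)).
Local Notation tau := (fb_tau (f := F)).
Local Notation zof := (fb_z (f := F)).
Local Notation tof := (fb_t (f := F)).
Local Notation Bt := (fb_Bt (f := F)).
Local Notation D := (fb_D (f := F)).
Local Notation Tij := (fb_T (f := F)).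
Local Notation N := (fb_N (f := F)).
Local Notation P := (fb_P (f := F)).
Local Notation Cu := (fb_Cu (f := F)).
Local Notation Cs := (fb_Cs (f := F)).

Definition box (i j : I) : set M :=
  [set w | exists z t, [/\ Oij i j z, 0 <= t < tau i j z & w = T t z]].

(* the O_i are C^2 hypersurfaces, uniformly transversal to the flow direction *)
Definition sections_transversal : Prop :=
  (forall i, submanifold 2 1 (O i)) /\
  exists (nrm : M -> tangent R d -> R) (e : R), [/\ smooth_norm nrm, 0 < e &
    forall i j z V, j \in J i -> Oij i j z -> velocity (Tij i j ^~ z) V ->
      V != 0 /\ forall u, tangent_to (O i) z u -> e * nrm z V <= nrm z (V - u)].

Definition sections_decomposition : Prop :=
  [/\ (forall i j, j \in J i -> rel_open (O i) (Oij i j)),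
      (forall i j j', j \in J i -> j' \in J i -> j != j' ->
         Oij i j `&` Oij i j' = set0),
      (forall i, null_in d.-1 (O i) (O i `\` \bigcup_(j in [set` J i]) Oij i j)) &
      (forall i j, j \in J i -> exists (m : nat) (K : 'I_m -> set M),
         (forall a, submanifold_piece 1 2 (K a)) /\
         closure (Oij i j) `\` Oij i j = \bigcup_(a in [set: 'I_m]) K a)].

Definition return_times : Prop :=
  forall i j, j \in J i ->
    [/\ submanifold 2 1 (Ot i j), closure (Oij i j) `<=` Ot i j,
        rel_open (Ot i j) (Oij i j), Ck_fun_sub 2 (Ot i j) (tau i j) &
        (forall z, Ot i j z -> 0 < tau i j z) /\
        (forall w, Oij i j w ->
           [/\ X0 w, (forall t, 0 <= t < tau i j w -> X0 (T t w)) &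
               O j (T (tau i j w) w)])].

Definition boxes_decomposition : Prop :=
  [/\ (forall i j i' j', j \in J i -> j' \in J i' -> (i, j) != (i', j') ->
         box i j `&` box i' j' = set0),
      mnull (X0 `\` [set w | exists i j, j \in J i /\ box i j w]),
      (forall i j w, j \in J i -> box i j w ->
         [/\ Oij i j (zof i j w), 0 <= tof i j w < tau i j (zof i j w) &
             w = T (tof i j w) (zof i j w)]) &
      (* extension of z(w) and t(w) to the closure of the box *)
      (forall i j w, j \in J i -> closure (box i j) w ->
         [/\ closure (Oij i j) (zof i j w),
             0 <= tof i j w <= tau i j (zof i j w),
             D i j (tof i j w, zof i j w) &
             w = Tij i j (tof i j w) (zof i j w)])].

Definition local_extensions : Prop :=
  forall i j, j \in J i ->
    [/\ closure (box i j) `<=` Bt i j, local_flow (Bt i j) (D i j) (Tij i j),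
        (* the two flows agree as long as the orbit stays in the box *)
        (forall t w, (forall r, 0 <= r <= 1 -> box i j (T (r * t) w)) -> box i j w ->
           D i j (t, w) /\ T t w = Tij i j t w),
        (closure (Ot i j) `<=` N i j) /\ C2_diffeo_on (N i j) (P i j) &
        (forall w, Oij i j w -> P i j w = T (tau i j w) w)].

Definition cone_fields : Prop :=
  forall i j, j \in J i ->
    [/\ continuous_cones du (closure (box i j)) (Cu i j),
        continuous_cones ds (closure (box i j)) (Cs i j) &
        forall w, closure (box i j) w ->
          (Cu i j w `&` Cs i j w `<=` [set 0]) /\
          forall V, velocity (Tij i j ^~ w) V -> forall a : R,
            (Cu i j w (a *: V) -> a *: V = 0) /\ (Cs i j w (a *: V) -> a *: V = 0)].

Definition cones_hyperbolic : Prop :=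
  forall t00 : R, 0 < t00 ->
  exists (nrm : M -> tangent R d -> R) (lu ls : I -> I -> M -> R),
    [/\ smooth_norm nrm,
        (forall i j, j \in J i ->
           [/\ {within closure (box i j), continuous (lu i j)},
               {within closure (box i j), continuous (ls i j)} &
               forall w, closure (box i j) w -> 1 < lu i j w /\ 0 < ls i j w < 1]) &
        forall i j w t k l, j \in J i -> l \in J k -> closure (box i j) w ->
          t00 < t <= tau i j (zof i j w) - tof i j w ->
          D i j (t, w) -> box k l (Tij i j t w) ->
          (forall v, Cu i j w v ->
             Cu k l (Tij i j t w) (mdiff (Tij i j t) w v) /\
             lu i j w `^ t * nrm w v <= nrm (Tij i j t w) (mdiff (Tij i j t) w v)) /\
          (forall v, Cs k l (Tij i j t w) v ->
             Cs i j w (mdiff (Tij i j (- t)) (Tij i j t w) v) /\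
             ls i j w `^ (- t) * nrm (Tij i j t w) v
               <= nrm w (mdiff (Tij i j (- t)) (Tij i j t w) v))].

End hyperbolicity.

Definition piecewise_cone_hyperbolic (du ds : nat)
    (X0 : set M) (T : R -> M -> M) : Prop :=
  measurable_flow X0 T /\
  exists F : flow_boxes,
    [/\ sections_transversal F, sections_decomposition F,
        return_times X0 T F, boxes_decomposition X0 T F &
        [/\ local_extensions T F, cone_fields du ds T F & cones_hyperbolic T F]].

End flows.

(* Main.v *)
Require Import Defs.
From HB Require Import structures.
From mathcomp Require Import all_boot all_order all_algebra all_fingroup.
From mathcomp Require Import all_classical all_reals all_analysis.
From mathcomp Require Import measurable_realfun.
From mathcomp Require Import ring lra.
Import Order.TTheory GRing.Theory Num.Theory.
Import numFieldNormedType.Exports.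
Local Open Scope classical_set_scope.
Local Open Scope ring_scope.

(** Let V be the velocity of the flow and f = alpha(V).  If f is a nonzero
    constant C and the contraction of d alpha with V vanishes, then V is the Reeb
    field of beta = alpha / C.  Everything is proved on the union of the open
    boxes, the boxes deprived of their sections.  This set is open, the flow is
    smooth and f continuous there, and its complement in X0 is null because the
    sections are hypersurfaces ([regular_ae], [section_null]).

    Flow coordinates.  The sections are transversal to the flow, so that their
    defining functions have nonzero derivative along V ([transversal_section]).
    The implicit function theorem, proved here for one real unknown
    ([implicit_function]), then expresses the flow time and the foot point on
    the section as C^1 functions of a point of the open box ([box_coordP]).

    Constancy of f.  The map T_s preserves alpha almost everywhere, hence
    f o T_s = f wherever T_s is smooth, by continuity ([pairing_invariant]).
    This covers the motion inside a box and the crossing of a section at a point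
    that belongs to the interior of a piece of the next one ([pairing_box],
    [pairing_crossing]).  The foot points whose itinerary through the pieces is
    interrupted after finitely many crossings are null in every immersed piece of
    a section ([bad_null_section]), and by Fubini almost every orbit crosses the
    sections for ever ([nice_ae]).  The return times have a positive lower bound
    ([tau_lower_bound]), so such an orbit is defined by its crossings for all
    positive times, and f takes one value along it ([nice_orbit]).  For an open
    superlevel set of f the points whose orbit eventually avoids it form an
    invariant Borel set; ergodicity makes it null or conull, whence f is constant
    ([pairing_constant]).  The passage between the volume and Lebesgue measure in
    charts uses that the density of alpha /\ (d alpha)^k is continuous without
    zeros ([volume_null]); for this the exterior derivative, defined in one
    preferred chart, has to be shown independent of coordinates
    ([ext_in_change]).

    The direction of V.  Since the Lie derivative of alpha along V vanishes and f
    is constant, Cartan's formula kills the contraction of d alpha with V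
    ([cartan_formula], [vel_in_kernel]).  Finally V does not vanish, and a vector
    in the kernels of both alpha and d alpha is zero because alpha is contact
    ([contact_kernel]); therefore C is not zero. *)

Set Implicit Arguments.
Unset Strict Implicit.
Unset Printing Implicit Defensive.

(** * Continuous differentiability at a point *)

Section differentiability.
Context {R : realType}.
Implicit Types V W Z : normedModType R.

Lemma diff_eps V W (f : V -> W) x : differentiable f x ->
  forall e, 0 < e -> \forall y \near x, `|f y - f x - 'd f x (y - x)| <= e * `|y - x|.
Proof.
move=> /diff_locallyP[_ /eqaddoP fE] e e0.
have : \forall h \near 0, `|f (h + x) - f x - 'd f x h| <= e * `|h|.
  by apply: filterS (fE _ e0) => h /=; rewrite !fctE/= opprD addrA.
rewrite (near_shift x); apply: filterS => y /=.
by rewrite sub0r subrK.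
Qed.

Lemma eps_diff V W (f : V -> W) x (L : {linear V -> W}) : continuous L ->
  (forall e, 0 < e -> \forall y \near x, `|f y - f x - L (y - x)| <= e * `|y - x|) ->
  differentiable f x /\ 'd f x = L :> (V -> W).
Proof.
move=> cL fE.
have H e : 0 < e -> \forall h \near (0 : V), `|f (h + x) - f x - L h| <= e * `|h|.
  move=> e0; rewrite (near_shift x); apply: filterS (fE _ e0) => y /=.
  by rewrite sub0r subrK.
have dE : 'd f x = L :> (V -> W).
  apply: diff_unique => //; apply/eqaddoP => _/posnumP[e].
  by apply: filterS (H _ (gt0 e)) => y /=; rewrite !fctE/= opprD addrA.
split=> //; apply/diff_locallyP; rewrite dE; split=> //.
apply/eqaddoP => _/posnumP[e].
by apply: filterS (H _ (gt0 e)) => y /=; rewrite !fctE/= opprD addrA.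
Qed.

Lemma near_eq_diff V W (f g : V -> W) x : (\forall y \near x, f y = g y) ->
  differentiable f x -> differentiable g x /\ 'd g x = 'd f x :> (V -> W).
Proof.
move=> fg df; apply: eps_diff; first exact: diff_continuous.
move=> e e0; have fgx := nbhs_singleton fg; near=> y.
rewrite -fgx (_ : g y = f y); last by apply/esym; near: y.
by near: y; exact: diff_eps.
Unshelve. all: by end_near. Qed.

Lemma diff_idE V (x v : V) : 'd (id : V -> V) x v = v.
Proof. exact: (congr1 (fun h => h v) (@diff_val _ _ _ _ _ _ _ (is_diff_id x))). Qed.

Lemma diff_cstE V W (a : W) (x v : V) : 'd (cst a : V -> W) x v = 0.
Proof. exact: (congr1 (fun h => h v) (diff_cst a x)). Qed.

(** Being of class C^1 as a pointwise condition, so that it can be transported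
    along local equalities without tracking domains. *)
Variant C1at V W (f : V -> W) x : Prop := C1atI of
  (\forall y \near x, differentiable f y) &
  (forall v, {for x, continuous (fun y => 'd f y v)}).

Lemma C1at_near V W (f : V -> W) x : C1at f x ->
  \forall y \near x, differentiable f y.
Proof. by case. Qed.

Lemma C1at_dcont V W (f : V -> W) x : C1at f x ->
  forall v, {for x, continuous (fun y => 'd f y v)}.
Proof. by case. Qed.

Lemma C1at_diff V W (f : V -> W) x : C1at f x -> differentiable f x.
Proof. by case=> /nbhs_singleton. Qed.

Lemma C1at_cont V W (f : V -> W) x : C1at f x -> {for x, continuous f}.
Proof. by move/C1at_diff/differentiable_continuous. Qed.

Lemma near_eq_C1at V W (f g : V -> W) x : (\forall y \near x, f y = g y) ->
  C1at f x -> C1at g x.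
Proof.
move=> fg [df cf].
have H : \forall y \near x, differentiable g y /\ 'd g y = 'd f y :> (V -> W).
  have := near_join fg; apply: filterS2 df => y fy.
  by move=> /near_eq_diff/(_ fy).
split; first by apply: filterS H => y [].
move=> v; rewrite /prop_for /continuous_at.
have [_ ->] := nbhs_singleton H.
apply: cvg_trans (cf v); apply: near_eq_cvg.
by apply: filterS H => y [_ ->].
Qed.

Lemma C1at_Ck V W (f : V -> W) (U : set V) : open U ->
  Ck_on 1 U f <-> forall x, U x -> C1at f x.
Proof.
move=> oU; split=> [[df cf] x Ux|H].
  split; last by move=> v; apply: cf.
  by have := open_nbhs_nbhs (conj oU Ux); apply: filterS.
split=> [x Ux|v x Ux]; first exact/C1at_diff/H.
exact: C1at_dcont (H x Ux) v.
Qed.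

Lemma Ck_onS V W k (f : V -> W) (U : set V) : Ck_on k.+1 U f -> Ck_on k U f.
Proof.
elim: k f => [|k IH] f [df cf].
  by move=> x Ux; apply/differentiable_continuous/df.
by split=> // v; apply: IH.
Qed.

Lemma Ck_on_ext V W k (f g : V -> W) (U : set V) : open U ->
  (forall x, U x -> f x = g x) -> Ck_on k U f -> Ck_on k U g.
Proof.
move=> oU; elim: k f g => [|k IH] f g fg.
  move=> cf x Ux; rewrite /prop_for /continuous_at -(fg x Ux).
  apply: cvg_trans (cf x Ux); apply: near_eq_cvg.
  by have := open_nbhs_nbhs (conj oU Ux); apply: filterS => y /fg.
move=> [df cf].
have H x : U x -> differentiable g x /\ 'd g x = 'd f x :> (V -> W).
  move=> Ux; apply: near_eq_diff (df _ Ux).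
  by have := open_nbhs_nbhs (conj oU Ux); apply: filterS => y /fg.
split=> [x /H[]//|v]; apply: IH (cf v) => x /H[_ ->]//.
Qed.

(** Finite dimension, expressed by a basis with continuous coordinates; it
    makes continuity of a derivative jointly available in the base point and
    in the direction. *)
Definition fdim V := exists (n : nat) (e : 'I_n -> V) (l : 'I_n -> V -> R),
  (forall i, continuous (l i)) /\ forall v, v = \sum_i l i v *: e i.

Lemma fdim_rV n : fdim 'rV[R]_n.
Proof.
exists n, (fun i => delta_mx ord0 i), (fun i (v : 'rV[R]_n) => v ord0 i); split.
  by move=> i; exact: coord_continuous.
by move=> v; rewrite [LHS]matrix_sum_delta big_ord1.
Qed.

Lemma fdim_R : fdim R.
Proof.
exists 1%N, (fun=> 1), (fun _ v => v); split; first by move=> _ x.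
by move=> v; rewrite big_ord1 /GRing.scale/= mulr1.
Qed.

Lemma fdim_prod V W : fdim V -> fdim W -> fdim (V * W)%type.
Proof.
move=> [n [e [l [cl lE]]]] [m [e' [l' [cl' lE']]]].
exists (n + m)%N, (fun i => match fintype.split i with inl i => (e i, 0) | inr i => (0, e' i) end),
  (fun i p => match fintype.split i with inl i => l i p.1 | inr i => l' i p.2 end).
split=> [i x|[v w]].
  case: (fintype.split i) => j.
    by apply: (@continuous_comp _ _ _ fst (l j)); [exact: cvg_fst|exact: cl].
  by apply: (@continuous_comp _ _ _ snd (l' j)); [exact: cvg_snd|exact: cl'].
rewrite big_split_ord/=.
have sc a (v1 : V) (w1 : W) : a *: (v1, w1) = (a *: v1, a *: w1) by [].
have -> : \sum_(i < n) (match fintype.split (lshift m i) with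
      inl i => l i v | inr i => l' i w end) *:
   (match fintype.split (lshift m i) with inl i => (e i, 0) | inr i => (0, e' i) end)
   = \sum_(i < n) (l i v *: e i, 0 : W).
  apply: eq_bigr => i _; case: (split_ordP (lshift m i)) => j.
    by move/lshift_inj => ->; rewrite sc scaler0.
  by move/eqP; rewrite eq_lrshift.
have -> : \sum_(i < m) (match fintype.split (rshift n i) with
      inl i => l i v | inr i => l' i w end) *:
   (match fintype.split (rshift n i) with inl i => (e i, 0) | inr i => (0, e' i) end)
   = \sum_(i < m) (0 : V, l' i w *: e' i).
  apply: eq_bigr => i _; case: (split_ordP (rshift n i)) => j.
    by move/eqP; rewrite eq_rlshift.
  by move/rshift_inj => ->; rewrite sc scaler0.
have H1 k (F : 'I_k -> V) : \sum_(i < k) (F i, 0 : W) = (\sum_(i < k) F i, 0).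
  elim: k F => [|k IH] F; first by rewrite !big_ord0.
  by rewrite !big_ord_recr/= IH; congr pair; rewrite /= addr0.
have H2 k (F : 'I_k -> W) : \sum_(i < k) (0 : V, F i) = (0, \sum_(i < k) F i).
  elim: k F => [|k IH] F; first by rewrite !big_ord0.
  by rewrite !big_ord_recr/= IH; congr pair; rewrite /= addr0.
by rewrite H1 H2 -lE -lE'; congr pair; rewrite /= ?addr0 ?add0r.
Qed.

Lemma continuous_sum V (T : topologicalType) n (F : 'I_n -> T -> V) (x : T) :
  (forall i, {for x, continuous (F i)}) ->
  {for x, continuous (fun y => \sum_i F i y)}.
Proof.
elim: n F => [|n IH] F cF; rewrite /prop_for /continuous_at.
  rewrite big_ord0 (_ : (fun y => _) = cst 0); first exact: cvg_cst.
  by apply/funext => y; rewrite big_ord0.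
rewrite big_ord_recr/= (_ : (fun y => _) =
  (fun y => \sum_(i < n) F (widen_ord (leqnSn n) i) y) \+ F ord_max).
  by apply: cvgD; [exact: IH|exact: cF].
by apply/funext => y; rewrite big_ord_recr.
Qed.

Lemma C1at_cvg2 V W (T : topologicalType) (f : V -> W) (x : T) (p q : T -> V) :
  fdim V -> C1at f (p x) -> {for x, continuous p} -> {for x, continuous q} ->
  {for x, continuous (fun y => 'd f (p y) (q y))}.
Proof.
move=> [n [e [l [cl lE]]]] [_ cf] cp cq.
have -> : (fun y => 'd f (p y) (q y)) =
    (fun y => \sum_i l i (q y) *: 'd f (p y) (e i)).
  apply/funext => y; rewrite {1}(lE (q y)) linear_sum/=.
  by apply: eq_bigr => i _; rewrite linearZ.
apply: continuous_sum => i; rewrite /prop_for /continuous_at; apply: cvgZ.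
  by apply: (cvg_comp _ _ cq); exact: cl.
by apply: (cvg_comp _ _ cp (cf (e i))).
Qed.

Lemma C1at_comp V W Z (f : V -> W) (g : W -> Z) x : fdim W ->
  C1at f x -> C1at g (f x) -> C1at (g \o f) x.
Proof.
move=> fW Cf Cg.
have H : \forall y \near x, differentiable f y /\ differentiable g (f y).
  have Cg' : \forall y \near x, differentiable g (f y).
    exact: (C1at_cont Cf) _ (C1at_near Cg).
  by apply: filterS2 (C1at_near Cf) Cg' => y ? ?.
split.
  by apply: filterS H => y [? ?]; apply: differentiable_comp.
move=> v.
have cfg : {for x, continuous (fun y => 'd g (f y) ('d f y v))}.
  by apply: C1at_cvg2 => //; [exact: C1at_cont|case: Cf].
have E y : differentiable f y /\ differentiable g (f y) ->
    'd g (f y) ('d f y v) = 'd (g \o f) y v.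
  by case=> dfy dgy; rewrite (diff_comp dfy dgy).
rewrite /prop_for /continuous_at -(E _ (nbhs_singleton H)).
apply: cvg_trans cfg; apply: near_eq_cvg.
by apply: filterS H => y /E.
Qed.

Lemma C1at_lin V W (f : {linear V -> W}) x : continuous f -> C1at f x.
Proof.
move=> cf; split; first by apply: nearW => y; exact: linear_differentiable.
move=> v; rewrite (_ : (fun y => _) = cst (f v)); first exact: cst_continuous.
by apply/funext => y; rewrite diff_lin.
Qed.

Lemma C1at_id V (x : V) : C1at id x.
Proof.
split; first by apply: nearW.
move=> v; rewrite (_ : (fun y => _) = cst v); first exact: cst_continuous.
by apply/funext => y; rewrite diff_val.
Qed.

Lemma C1at_cst V W (a : W) (x : V) : C1at (cst a) x.
Proof.
split; first by apply: nearW.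
move=> v; rewrite (_ : (fun y => _) = cst 0); first exact: cst_continuous.
by apply/funext => y; rewrite diff_cst.
Qed.

Lemma C1at_pair V W Z (f : V -> W) (g : V -> Z) x :
  C1at f x -> C1at g x -> C1at (fun y => (f y, g y)) x.
Proof.
move=> [df cf] [dg cg].
have H : \forall y \near x, differentiable f y /\ differentiable g y.
  exact: filterI df dg.
split.
  by apply: filterS H => y [? ?]; exact: differentiable_pair.
move=> v.
rewrite /prop_for /continuous_at diff_pair/=; try by have [] := nbhs_singleton H.
have cfg : (fun y => ('d f y v, 'd g y v)) @ x --> ('d f x v, 'd g x v).
  by apply: cvg_pair; [exact: cf|exact: cg].
apply: cvg_trans cfg; apply: near_eq_cvg.
by apply: filterS H => y [? ?] /=; rewrite diff_pair.
Qed.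

Lemma C1at_linear V W (f : V -> W) x : linear f -> continuous f ->
  C1at f x /\ 'd f x = f :> (V -> W).
Proof.
move=> lf cf; pose F : {linear V -> W} := HB.pack f (GRing.isLinear.Build _ _ _ _ _ lf).
have cF : continuous F by [].
by split; [exact: (C1at_lin x cF)|exact: (@diff_lin _ _ _ F)].
Qed.

Lemma C1at_fst V W (x : V * W) : C1at (fst : V * W -> V) x.
Proof. by have [] := @C1at_linear _ _ (fst : V * W -> V) x (fun _ _ _ => erefl) (fun y => cvg_fst). Qed.

Lemma C1at_snd V W (x : V * W) : C1at (snd : V * W -> W) x.
Proof. by have [] := @C1at_linear _ _ (snd : V * W -> W) x (fun _ _ _ => erefl) (fun y => cvg_snd). Qed.

Lemma C1atD V W (f g : V -> W) x : C1at f x -> C1at g x -> C1at (f \+ g) x.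
Proof.
move=> [df cf] [dg cg].
have H : \forall y \near x, differentiable f y /\ differentiable g y.
  exact: filterI df dg.
split.
  by apply: filterS H => y [? ?]; exact: differentiableD.
move=> v; rewrite /prop_for /continuous_at diffD/=; try by have [] := nbhs_singleton H.
apply: cvg_trans (cvgD (cf v) (cg v)); apply: near_eq_cvg.
by apply: filterS H => y [? ?] /=; rewrite diffD.
Qed.

Lemma C1atN V W (f : V -> W) x : C1at f x -> C1at (\- f) x.
Proof.
move=> [df cf]; split.
  by apply: filterS df => y ?; exact: differentiableN.
move=> v; rewrite /prop_for /continuous_at diffN/=; try exact: nbhs_singleton df.
apply: cvg_trans (cvgN (cf v)); apply: near_eq_cvg.
by apply: filterS df => y ? /=; rewrite diffN.
Qed.

End differentiability.
Arguments C1at_dcont {R V W f x} _ v.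

(** * The implicit function theorem with one real unknown *)

Section implicit_function.
Context {R : realType}.
Implicit Types V W : normedModType R.

Lemma is_derive_slice V W (G : R * V -> W) (t : R) (x : V) :
  differentiable G (t, x) -> is_derive t 1 (fun s => G (s, x)) ('d G (t, x) (1, 0)).
Proof.
move=> dG.
have dp : differentiable (fun s : R => (s, x)) t.
  by apply: differentiable_pair.
have dGp : differentiable (G \o (fun s : R => (s, x))) t.
  exact: differentiable_comp.
have -> : 'd G (t, x) (1, 0) = 'D_1 (G \o (fun s : R => (s, x))) t.
  rewrite deriveE// (diff_comp dp dG)/=.
  by rewrite (@diff_pair _ _ _ _ id (cst x))//= diff_val (diff_cst x).
by apply/derivableP/diff_derivable.
Qed.

Lemma diff_slice V W (G : R * V -> W) (t : R) (x : V) :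
  differentiable G (t, x) -> differentiable (fun y => G (t, y)) x /\
  'd (fun y => G (t, y)) x = (fun u => 'd G (t, x) (0, u)) :> (V -> W).
Proof.
move=> dG.
have dp : differentiable (fun y : V => (t, y)) x by apply: differentiable_pair.
split; first exact: (differentiable_comp dp dG).
rewrite (diff_comp dp dG); apply/funext => u /=.
by rewrite (@diff_pair _ _ _ _ (cst t) id)//= (diff_cst t) diff_val.
Qed.

Lemma prod_ballP V (t0 : R) (x0 : V) (P : set (R * V)) : nbhs (t0, x0) P ->
  exists2 e : R, 0 < e & forall t x, `|t - t0| < e -> `|x - x0| < e -> P (t, x).
Proof.
move=> [[A B] /= [/nbhs_ballP[e1 /= e10 A1] /nbhs_ballP[e2 /= e20 B2]] AB].
exists (Num.min e1 e2); first by rewrite lt_min e10 e20.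
move=> t x; rewrite !lt_min => /andP[t1 _] /andP[_ x2].
apply: AB; split=> /=; [apply: A1|apply: B2];
  by rewrite -ball_normE /= distrC.
Qed.

Lemma norm_ballP V (x0 : V) (P : set V) : nbhs x0 P ->
  exists2 e : R, 0 < e & forall x, `|x - x0| < e -> P x.
Proof.
move=> /nbhs_ballP[e /= e0 eP]; exists e => // x xe.
by apply: eP; rewrite -ball_normE /= distrC.
Qed.

Lemma ball_near V (x0 : V) (e : R) : 0 < e -> \forall x \near x0, `|x - x0| < e.
Proof.
move=> e0; apply/nbhs_ballP; exists e => //= x.
by rewrite -ball_normE /= distrC.
Qed.

Lemma continuous_pair (T U1 U2 : topologicalType) (f : T -> U1) (g : T -> U2) x :
  {for x, continuous f} -> {for x, continuous g} ->
  {for x, continuous (fun y => (f y, g y))}.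
Proof. by move=> cf cg; apply: cvg_pair. Qed.

Lemma near_continuous2 (T U1 U2 : topologicalType) (f : T -> U1) (g : T -> U2) x
    (P : U1 * U2 -> Prop) :
  {for x, continuous f} -> {for x, continuous g} ->
  (\forall p \near (f x, g x), P p) -> \forall y \near x, P (f y, g y).
Proof. by move=> cf cg; exact: (continuous_pair cf cg). Qed.

Lemma near_ball_sub V (x x0 : V) (r : R) : `|x - x0| < r ->
  \forall y \near x, `|y - x0| < r.
Proof.
move=> xr; have := @ball_near _ x (r - `|x - x0|); rewrite subr_gt0 => /(_ xr).
apply: filterS => y yx; have := ler_distD x y x0; lra.
Qed.

Let slice_mono V (G : R * V -> R) (x : V) (t0 e : R) :
  (forall t, `|t - t0| < e -> differentiable G (t, x) /\ 0 < 'd G (t, x) (1, 0)) ->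
  forall s t, `|s - t0| < e -> `|t - t0| < e -> s < t -> G (s, x) < G (t, x).
Proof.
move=> He s t; rewrite !ltr_distl => /andP[s1 s2] /andP[t1 t2] st.
have ye y : y \in `[s, t] -> `|y - t0| < e.
  by rewrite in_itv/= ltr_distl => /andP[? ?]; apply/andP; split; lra.
have Hd y : y \in `[s, t] -> is_derive y 1 (fun s => G (s, x)) ('d G (y, x) (1, 0)).
  by move=> /ye /He[dG _]; apply: is_derive_slice.
have [c cst] := @MVT R (fun s => G (s, x)) (fun y => 'd G (y, x) (1, 0)) _ _ st
   (fun y (yst : y \in `]s, t[) => Hd y (subset_itv_oo_cc yst))
   (derivable_within_continuous (fun y yst => @ex_derive _ _ _ _ _ _ _ (Hd y yst))).
move=> E; rewrite -subr_gt0 E; apply: mulr_gt0; last by rewrite subr_gt0.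
by apply: (He _ (ye _ (subset_itv_oo_cc cst))).2.
Qed.

Let slice_cont V (G : R * V -> R) (x : V) t : differentiable G (t, x) ->
  {for x, continuous (fun y => G (t, y))}.
Proof. by move=> dG; apply: differentiable_continuous; exact: (diff_slice dG).1. Qed.

Let slice_root V (G : R * V -> R) (x : V) (t0 h : R) : 0 < h ->
  (forall t, `|t - t0| <= h -> differentiable G (t, x)) ->
  G (t0 - h, x) < 0 -> 0 < G (t0 + h, x) ->
  exists t, `|t - t0| < h /\ G (t, x) = 0.
Proof.
move=> h0 dG Gxm Gxp.
have [|||t tI Gt] := @IVT R (fun t => G (t, x)) (t0 - h) (t0 + h) 0.
- by lra.
- apply: derivable_within_continuous => y.
  rewrite in_itv/= -ler_distl => yh.
  exact: (@ex_derive _ _ _ _ _ _ _ (is_derive_slice (dG _ yh))).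
- by rewrite ge_min le_max (ltW Gxm) (ltW Gxp) orbT.
exists t; split=> //; rewrite ltr_distl.
move: tI; rewrite in_itv/= => /andP[]; rewrite !le_eqVlt => /orP[/eqP tE|->].
  by move: Gxm; rewrite tE Gt ltxx.
case/orP=> [/eqP tE|t2]; last by rewrite t2.
by exfalso; move: Gxp; rewrite -tE Gt ltxx.
Qed.

(** The absorption step of the next lemma, as an inequality between the sizes of
    the increments. *)
Let implicit_estimate (a C ep ep1 dt dx dd mx B : R) : 0 < a -> 0 <= dx ->
  0 <= dt -> 0 <= mx ->
  mx <= dt + dx -> dt <= C * dx + dd -> a * dd <= ep1 * mx ->
  ep1 <= a / 2 -> B = 2 * C + 2 -> 0 < ep1 -> ep1 * B <= ep * a -> dd <= ep * dx.
Proof.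
move=> a0 dx0 dt0 mx0 mxle dtle E1 e1a BE e10 e1B.
have E2 : a * dd <= a / 2 * (dt + dx).
  apply: (le_trans E1); apply: ler_pM => //; exact: ltW.
have E3 : dd <= (dt + dx) / 2 by rewrite -(ler_pM2l a0); move: E2; lra.
have mxB : mx <= B * dx by rewrite BE; lra.
rewrite -(ler_pM2l a0); apply: (le_trans E1).
apply: (@le_trans _ _ (ep1 * (B * dx))); first by rewrite ler_pM2l.
by rewrite mulrA mulrA [a * ep]mulrC; apply: ler_wpM2r.
Qed.

(** Along the graph of [th] the differentiability of [G] gives an error of order
    |dt| + |dx|.  The partial derivative in [t] being positive, the |dt| part can
    be absorbed in the left-hand side. *)
Let implicit_diff V (G : R * V -> R) (th : V -> R) (x : V) :
  {for x, continuous th} -> (\forall y \near x, G (th y, y) = 0) ->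
  differentiable G (th x, x) -> 0 < 'd G (th x, x) (1, 0) ->
  differentiable th x /\
  forall u, 'd th x u = - 'd G (th x, x) (0, u) / 'd G (th x, x) (1, 0).
Proof.
move=> cth Gth dG a0.
set a := 'd G (th x, x) (1, 0) in a0 *.
pose D u := - 'd G (th x, x) (0, u) / a.
have cD : continuous D.
  move=> u; rewrite /continuous_at /D.
  apply: cvgMr_tmp; apply: cvgN.
  have : {for u, continuous ('d G (th x, x) \o (fun u => (0, u)))}.
    apply: continuous_comp; last exact: diff_continuous.
    by apply: continuous_pair; [exact: cst_continuous|exact: cvg_id].
  by [].
have lD : linear D.
  move=> c u v; rewrite /D.
  have -> : (0, c *: u + v) = c *: (0, u) + (0, v) :> R * V.
    by congr pair; rewrite /= ?scaler0 ?addr0.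
  by rewrite linearP opprD mulrDl -scalerN -scalerAl.
pose DL : {linear V -> R} := HB.pack D (GRing.isLinear.Build _ _ _ _ _ lD).
have [C /= C0 HC] := linear_lipschitz (f := DL) cD.
suff : differentiable th x /\ 'd th x = DL :> (V -> R).
  by case=> ? dE; split=> // u; rewrite dE.
apply: eps_diff => // ep ep0.
pose B := 2 * C + 2; have B0 : 0 < B by rewrite /B; lra.
(* a / 2 allows the absorption, and ep * a / B gives the final precision ep *)
pose ep1 := Num.min (a / 2) (ep * a / B).
have ep10 : 0 < ep1 by rewrite lt_min !divr_gt0// mulr_gt0.
have ep1a : ep1 <= a / 2 by rewrite ge_min lexx.
have ep1b : ep1 * B <= ep * a by rewrite -ler_pdivlMr// ge_min lexx orbT.
have Gx := nbhs_singleton Gth.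
have cp : {for x, continuous (fun y => (th y, y))}.
  by apply: continuous_pair => //; exact: cvg_id.
have N1 : \forall y \near x, `|G (th y, y) - G (th x, x) -
    'd G (th x, x) ((th y, y) - (th x, x))| <= ep1 * `|(th y, y) - (th x, x)|.
  exact: cp _ (diff_eps dG ep10).
apply: filterS2 N1 Gth => y + Gy.
rewrite Gy Gx subrr sub0r normrN.
set dt := th y - th x; set dx := y - x.
have -> : ((th y, y) - (th x, x)) = (dt, dx) by [].
have E : (dt, dx) = dt *: (1, 0) + (0, dx) :> R * V.
  by congr pair; rewrite /= ?scaler0 ?add0r ?addr0// /GRing.scale/= mulr1.
rewrite {1}E linearP -/a.
have -> : dt *: a + 'd G (th x, x) (0, dx) = a * (dt - D dx).
  by rewrite /D mulrBr [a * dt]mulrC mulNr mulrN opprK [a * (_ / _)]mulrC mulfVK// gt_eqF.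
rewrite normrM (gtr0_norm a0) => Hy.
have Cdx : `|D dx| <= C * `|dx| by apply: HC.
apply: (@implicit_estimate a C ep ep1 `|dt| `|dx| _ `|(dt, dx)| B) => //.
- by rewrite [X in X <= _]prod_normE/= ge_max lerDl lerDr !normr_ge0.
- apply: (@le_trans _ _ (`|D dx| + `|dt - D dx|)); last by rewrite lerD2r.
  by have := ler_normD (D dx) (dt - D dx); rewrite addrC subrK.
Qed.

Let implicit_function_pos V (G : R * V -> R) (t0 : R) (x0 : V) :
  (\forall p \near (t0, x0), C1at G p) -> G (t0, x0) = 0 ->
  0 < 'd G (t0, x0) (1, 0) ->
  exists th : V -> R, th x0 = t0 /\ \forall x \near x0,
    [/\ G (th x, x) = 0, C1at th x &
        forall u, 'd th x u = - 'd G (th x, x) (0, u) / 'd G (th x, x) (1, 0)].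
Proof.
move=> CG G0 dG0.
have : \forall p \near (t0, x0), C1at G p /\ 0 < 'd G p (1, 0).
  near=> p; split; first by near: p.
  near: p; have [_ /(_ (1, 0)) cdG] := nbhs_singleton CG.
  by apply: (cdG [set y | 0 < y]); exact: lt_nbhsr.
case/prod_ballP => e e0 He.
have He' t x : `|t - t0| < e -> `|x - x0| < e ->
    differentiable G (t, x) /\ 0 < 'd G (t, x) (1, 0).
  by move=> te xe; have [/C1at_diff] := He _ _ te xe.
have [h h0 he] : exists2 h, 0 < h & h < e.
  by exists (e / 2); [rewrite divr_gt0|rewrite gtr_pMr// invf_lt1// ltr1n].
have mono x s t : `|x - x0| < e -> `|s - t0| <= h -> `|t - t0| <= h -> s < t ->
    G (s, x) < G (t, x).
  move=> xe sh th; apply: (@slice_mono _ G x t0 e) => [z ze||].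
  - exact: He'.
  - exact: le_lt_trans sh he.
  - exact: le_lt_trans th he.
have contx t x : `|t - t0| <= h -> `|x - x0| < e ->
    {for x, continuous (fun y => G (t, y))}.
  by move=> th xe; apply: slice_cont; have [] := He' t x (le_lt_trans th he) xe.
have x0e : `|x0 - x0| < e by rewrite subrr normr0.
have tm : `|t0 - h - t0| <= h by rewrite addrAC subrr sub0r normrN gtr0_norm.
have tp : `|t0 + h - t0| <= h by rewrite addrAC subrr add0r gtr0_norm.
have tz : `|t0 - t0| <= h by rewrite subrr normr0 ltW.
have Gm : G (t0 - h, x0) < 0 by rewrite -G0; apply: mono => //; rewrite ltrBlDr ltrDl.
have Gp : 0 < G (t0 + h, x0) by rewrite -G0; apply: mono => //; rewrite ltrDl.
have : \forall x \near x0, [/\ `|x - x0| < e, G (t0 - h, x) < 0 & 0 < G (t0 + h, x)].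
  have N1 : \forall x \near x0, G (t0 - h, x) < 0.
    exact: contx _ _ tm x0e [set y | y < 0] (lt_nbhsl Gm).
  have N2 : \forall x \near x0, 0 < G (t0 + h, x).
    exact: contx _ _ tp x0e [set y | 0 < y] (lt_nbhsr Gp).
  by apply: filterS3 (ball_near x0 e0) N1 N2 => x; split.
case/norm_ballP => r r0 Hr.
have ex x : exists t, `|x - x0| < r -> `|t - t0| < h /\ G (t, x) = 0.
  have [xr|] := ltP `|x - x0| r; last by exists t0.
  have [xe Gxm Gxp] := Hr _ xr.
  have [t Ht] : exists t, `|t - t0| < h /\ G (t, x) = 0.
    apply: slice_root => // t th.
    by have [] := He' t x (le_lt_trans th he) xe.
  by exists t.
have [th Hth] := choice ex.
have thx0 : th x0 = t0.
  have [|a b] := Hth x0; first by rewrite subrr normr0.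
  case: (ltgtP (th x0) t0) => // L.
    by have := mono _ _ _ x0e (ltW a) tz L; rewrite b G0 ltxx.
  by have := mono _ _ _ x0e tz (ltW a) L; rewrite b G0 ltxx.
have Gth x : `|x - x0| < r -> \forall y \near x, G (th y, y) = 0.
  by move=> /near_ball_sub; apply: filterS => y /Hth[].
have cth x : `|x - x0| < r -> {for x, continuous th}.
  move=> xr; have [thh Gthx] := Hth _ xr; have [xe _ _] := Hr _ xr.
  apply/cvgrPdist_lt => ep ep0.
  have [d [d0 dep dh]] : exists d, [/\ 0 < d, d <= ep & `|th x - t0| + d <= h].
    exists (Num.min ep (h - `|th x - t0|)); split.
    - by rewrite lt_min ep0 subr_gt0.
    - by rewrite ge_min lexx.
    - by rewrite -lerBrDl ge_min lexx orbT.
  have t1h : `|th x - d - t0| <= h.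
    by rewrite addrAC (le_trans (ler_normB _ _))// (gtr0_norm d0).
  have t2h : `|th x + d - t0| <= h.
    by rewrite addrAC (le_trans (ler_normD _ _))// (gtr0_norm d0).
  have G1 : G (th x - d, x) < 0.
    by rewrite -Gthx; apply: mono => //; [exact: ltW|rewrite ltrBlDr ltrDl].
  have G2 : 0 < G (th x + d, x).
    by rewrite -Gthx; apply: mono => //; [exact: ltW|rewrite ltrDl].
  have N1 : \forall y \near x, G (th x - d, y) < 0.
    exact: (contx _ _ t1h xe [set y | y < 0] (lt_nbhsl G1)).
  have N2 : \forall y \near x, 0 < G (th x + d, y).
    exact: (contx _ _ t2h xe [set y | 0 < y] (lt_nbhsr G2)).
  apply: filterS3 N1 N2 (near_ball_sub xr) => y /= G1y G2y yr.
  have [thy Gy] := Hth _ yr; have [ye _ _] := Hr _ yr.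
  rewrite distrC; apply: lt_le_trans dep; rewrite ltr_distl; apply/andP; split.
    rewrite ltNge; apply/negP; rewrite le_eqVlt => /orP[/eqP E|L].
      by move: G1y; rewrite -E Gy ltxx.
    have := mono _ _ _ ye (ltW thy) t1h L.
    by rewrite Gy => /(lt_trans G1y); rewrite ltxx.
  rewrite ltNge; apply/negP; rewrite le_eqVlt => /orP[/eqP E|L].
    by move: G2y; rewrite E Gy ltxx.
  have := mono _ _ _ ye t2h (ltW thy) L.
  by rewrite Gy => /lt_trans/(_ G2y); rewrite ltxx.
have Hx x : `|x - x0| < r -> C1at G (th x, x) /\ 0 < 'd G (th x, x) (1, 0).
  move=> xr; have [thh _] := Hth _ xr; have [xe _ _] := Hr _ xr.
  exact: He (lt_trans thh he) xe.
have dth x (xr : `|x - x0| < r) :=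
  implicit_diff (cth x xr) (Gth x xr) (C1at_diff (Hx x xr).1) (Hx x xr).2.
exists th; split; first exact: thx0.
apply: filterS (ball_near x0 r0) => x xr.
split; [exact: (Hth _ xr).2| |exact: (dth _ xr).2].
split; first by apply: filterS (near_ball_sub xr) => y /dth[].
move=> u; have [[_ cG] a0] := Hx _ xr.
have cp : {for x, continuous (fun y => (th y, y))}.
  by apply: continuous_pair; [exact: cth|exact: cvg_id].
rewrite /prop_for /continuous_at (dth _ xr).2.
have : (fun y => - 'd G (th y, y) (0, u) / 'd G (th y, y) (1, 0)) @ x -->
    - 'd G (th x, x) (0, u) / 'd G (th x, x) (1, 0).
  apply: cvgM; first by apply: cvgN; exact: (cvg_comp _ _ cp (cG (0, u))).
  apply: cvgV; first by rewrite gt_eqF.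
  exact: (cvg_comp _ _ cp (cG (1, 0))).
apply: cvg_trans; apply: near_eq_cvg.
by apply: filterS (near_ball_sub xr) => y /dth[_ ->].
Unshelve. all: by end_near. Qed.

(** The implicit equation is solved for one real unknown: monotonicity and
    the intermediate value theorem then replace the contraction argument. *)
Lemma implicit_function V (G : R * V -> R) (t0 : R) (x0 : V) :
  (\forall p \near (t0, x0), C1at G p) -> G (t0, x0) = 0 ->
  'd G (t0, x0) (1, 0) != 0 ->
  exists th : V -> R, th x0 = t0 /\ \forall x \near x0,
    [/\ G (th x, x) = 0, C1at th x &
        forall u, 'd th x u = - 'd G (th x, x) (0, u) / 'd G (th x, x) (1, 0)].
Proof.
move=> CG G0; rewrite neq_lt => /orP[n0|]; last exact: implicit_function_pos.
have dGN p : C1at G p -> 'd (\- G) p = \- 'd G p :> (R * V -> R).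
  by move=> /C1at_diff dG; rewrite (diffN dG).
have CG0 := nbhs_singleton CG.
have [||| th [th0 Hth]] := @implicit_function_pos _ (\- G) t0 x0.
- by apply: filterS CG => p; exact: C1atN.
- by rewrite /= G0 oppr0.
- by rewrite dGN//= oppr_gt0.
exists th; split; first exact: th0.
have CGth : \forall x \near x0, C1at G (th x, x).
  subst t0; have [_ /C1at_cont cth _] := nbhs_singleton Hth.
  apply: (near_continuous2 (P := fun p => C1at G p) cth _ CG); exact: cvg_id.
apply: filterS2 CGth Hth => x CGx [Gx Cx dx]; split.
- by apply/eqP; rewrite -oppr_eq0; apply/eqP.
- exact: Cx.
- by move=> u; rewrite dx (dGN _ CGx)/= invrN mulrNN.
Qed.

End implicit_function.

(** * Symmetry of second derivatives *)

Section schwarz.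
Context {R : realType}.
Implicit Types V W : normedModType R.

Lemma is_derive_line V W (f : V -> W) (y u : V) (s : R) :
  differentiable f (y + s *: u) ->
  is_derive s 1 (fun t => f (y + t *: u)) ('d f (y + s *: u) u).
Proof.
move=> df.
have dl : is_diff s (fun t : R => y + t *: u) (fun t => 0 + t *: u).
  by apply: is_diffD.
have dfl := differentiable_comp (@ex_diff _ _ _ _ _ _ _ dl) df.
have -> : 'd f (y + s *: u) u = 'D_1 (f \o (fun t : R => y + t *: u)) s.
  rewrite deriveE// (diff_comp (@ex_diff _ _ _ _ _ _ _ dl) df)/=.
  by rewrite (@diff_val _ _ _ _ _ _ _ dl) add0r scale1r.
by apply/derivableP/diff_derivable.
Qed.

(** The second difference of [f] over the parallelogram with sides h u and h v
    is the increment, along h u, of the function with derivative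
    A (. + h v) - A, where A is the derivative of [f] in the direction u.  The
    mean value theorem reduces it to the differentiability of A at [x]. *)
Let second_difference V (f : V -> R) (x u v : V) (e : R) : 0 < e ->
  (\forall y \near x, differentiable f y) ->
  differentiable (fun y => 'd f y u) x ->
  exists2 r, 0 < r & forall h, 0 < h -> h < r ->
   `|f (x + h *: u + h *: v) - f (x + h *: u) - (f (x + h *: v) - f x) -
     h ^+ 2 * 'd (fun y => 'd f y u) x v| <= e * h ^+ 2.
Proof.
move=> e0 df dA; set A := fun y => 'd f y u in dA *.
pose K := `|u| + `|v| + 1.
have K0 : 0 < K by rewrite /K; have := normr_ge0 u; have := normr_ge0 v; lra.
have uK : `|u| <= K by rewrite /K; have := normr_ge0 v; lra.
have uvK : `|u| + `|v| <= K by rewrite /K; lra.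
pose ep := e / (2 * K); have ep0 : 0 < ep by rewrite divr_gt0// mulr_gt0.
have [r0 r00 Hr0] := norm_ballP (filterI df (diff_eps dA ep0)).
exists (r0 / K); first by rewrite divr_gt0.
move=> h h0; rewrite ltr_pdivlMr// => hr.
have Hc c : 0 <= c -> c <= h -> `|c *: u| <= h * K /\ `|c *: u + h *: v| <= h * K.
  move=> c0 ch; have H1 : `|c *: u| <= h * `|u|.
    by rewrite normrZ ger0_norm// ler_wpM2r.
  have H2 : `|h *: v| = h * `|v| by rewrite normrZ gtr0_norm.
  split; first by apply: (le_trans H1); rewrite ler_pM2l.
  apply: (le_trans (ler_normD _ _)); rewrite H2.
  by apply: (le_trans (lerD H1 (lexx _))); rewrite -mulrDr ler_pM2l.
have near_c c : 0 <= c -> c <= h ->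
   [/\ differentiable f (x + c *: u), differentiable f (x + h *: v + c *: u),
     `|A (x + c *: u) - A x - 'd A x (c *: u)| <= ep * (h * K) &
     `|A (x + h *: v + c *: u) - A x - 'd A x (c *: u + h *: v)| <= ep * (h * K)].
  move=> c0 ch; have [N1 N2] := Hc _ c0 ch.
  have [D1 E1] : (differentiable f (x + c *: u) /\
      `|A (x + c *: u) - A x - 'd A x (x + c *: u - x)| <= ep * `|x + c *: u - x|).
    by apply: Hr0; rewrite addrC addKr (le_lt_trans N1).
  have A2 : x + h *: v + c *: u - x = c *: u + h *: v.
    by rewrite -[x + _ + _]addrA [x + _]addrC addrK addrC.
  have [D2 E2] : (differentiable f (x + h *: v + c *: u) /\
      `|A (x + h *: v + c *: u) - A x - 'd A x (x + h *: v + c *: u - x)|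
       <= ep * `|x + h *: v + c *: u - x|).
    by apply: Hr0; rewrite A2 (le_lt_trans N2).
  split; [exact: D1|exact: D2| |].
    move: E1; rewrite [x + _ - x]addrC addKr => /le_trans; apply.
    by rewrite ler_pM2l.
  move: E2; rewrite A2 => /le_trans; apply.
  by rewrite ler_pM2l.
pose phi (s : R) := f (x + h *: v + s *: u) - f (x + s *: u).
have dphi s : 0 <= s -> s <= h ->
    is_derive s 1 phi (A (x + h *: v + s *: u) - A (x + s *: u)).
  move=> s0 sh; have [D1 D2 _ _] := near_c _ s0 sh.
  by apply: is_deriveB; apply: is_derive_line.
have Hd s : s \in `[0, h] -> is_derive s 1 phi (A (x + h *: v + s *: u) - A (x + s *: u)).
  by rewrite in_itv/= => /andP[s0 sh]; exact: dphi.
have [c] := @MVT R phi (fun s => A (x + h *: v + s *: u) - A (x + s *: u)) _ _ h0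
   (fun y (yst : y \in `]0, h[) => Hd y (subset_itv_oo_cc yst))
   (derivable_within_continuous (fun y yst => @ex_derive _ _ _ _ _ _ _ (Hd y yst))).
rewrite in_itv/= => /andP[/ltW c0 /ltW ch]; rewrite subr0 => E.
have -> : f (x + h *: u + h *: v) - f (x + h *: u) - (f (x + h *: v) - f x) =
    phi h - phi 0.
  by rewrite /phi !scale0r !addr0 [x + h *: u + _]addrAC; ring.
rewrite E; have [_ _ E1 E2] := near_c _ c0 ch.
set a := A (x + h *: v + c *: u) in E2 *; set b := A (x + c *: u) in E1 *.
move: E1 E2; rewrite linearD.
have -> : 'd A x (h *: v) = h * 'd A x v by rewrite linearZ.
set p := 'd A x (c *: u); set q := 'd A x v => E1 E2.
have -> : (a - b) * h - h ^+ 2 * q = h * ((a - A x - (p + h * q)) - (b - A x - p)) by ring.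
rewrite normrM gtr0_norm// expr2 mulrCA ler_pM2l//.
apply: (le_trans (ler_normB _ _)).
apply: (le_trans (lerD E2 E1)).
rewrite /ep -mulrDl.
have -> : (e / (2 * K) + e / (2 * K)) * (h * K) = e * h.
  by field; rewrite gt_eqF.
exact: lexx.
Qed.

(** The second difference is symmetric in the two directions, and both mixed
    derivatives are its limit after division by h^2. *)
Lemma schwarz_real V (f : V -> R) (x u v : V) :
  (\forall y \near x, differentiable f y) ->
  differentiable (fun y => 'd f y u) x -> differentiable (fun y => 'd f y v) x ->
  'd (fun y => 'd f y u) x v = 'd (fun y => 'd f y v) x u.
Proof.
move=> df du dv.
set a := 'd _ x v; set b := 'd _ x u.
apply/eqP; rewrite -subr_eq0 -normr_le0; apply/ler_addgt0Pl => e e0; rewrite addr0.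
have e20 : 0 < e / 2 by rewrite divr_gt0.
have [r1 r10 H1] := second_difference v e20 df du.
have [r2 r20 H2] := second_difference u e20 df dv.
pose h := Num.min r1 r2 / 2.
have m0 : 0 < Num.min r1 r2 by rewrite lt_min r10.
have h0 : 0 < h by rewrite divr_gt0.
have hm : h < Num.min r1 r2 by rewrite /h; lra.
move: (hm); rewrite lt_min => /andP[hr1 hr2].
have {H1} := H1 _ h0 hr1; have {H2} := H2 _ h0 hr2; rewrite -/a -/b.
rewrite [x + h *: v + _]addrAC.
set X := f _ - f (x + h *: u) - _; set Y := f _ - _ - _.
have -> : Y = X by rewrite /X /Y; ring.
move=> E2 E1.
have h20 : 0 < h ^+ 2 by rewrite exprn_gt0.
rewrite -(ler_pM2l h20).
have -> : h ^+ 2 * `|a - b| = `|(X - h ^+ 2 * b) - (X - h ^+ 2 * a)|.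
  by rewrite -[h ^+ 2 in LHS]gtr0_norm// -normrM; congr `|_|; ring.
apply: (le_trans (ler_normB _ _)); apply: (le_trans (lerD E2 E1)).
by rewrite -mulrDl -splitr mulrC.
Qed.

Lemma diff_coord V n (f : V -> 'rV[R]_n) (x : V) (j : 'I_n) : differentiable f x ->
  differentiable (fun y => f y ord0 j) x /\
  forall v, 'd (fun y => f y ord0 j) x v = 'd f x v ord0 j.
Proof.
move=> df.
have lc : linear (fun M : 'rV[R]_n => M ord0 j) by move=> a M N; rewrite !mxE.
have cc : continuous (fun M : 'rV[R]_n => M ord0 j) by exact: coord_continuous.
have [C dE] := C1at_linear (f x) lc cc.
have dc := C1at_diff C.
split; first exact: (differentiable_comp df dc).
by move=> v; rewrite (diff_comp df dc) /= dE.
Qed.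

Lemma schwarz_rV V n (f : V -> 'rV[R]_n) (x u v : V) :
  (\forall y \near x, differentiable f y) ->
  differentiable (fun y => 'd f y u) x -> differentiable (fun y => 'd f y v) x ->
  'd (fun y => 'd f y u) x v = 'd (fun y => 'd f y v) x u.
Proof.
move=> df du dv; apply/rowP => j.
have dfj : \forall y \near x, differentiable (fun y => f y ord0 j) y.
  by apply: filterS df => y dy; have [] := diff_coord j dy.
have key w : differentiable (fun y => 'd f y w) x ->
    differentiable (fun y => 'd (fun y => f y ord0 j) y w) x /\
    forall z, 'd (fun y => 'd (fun y => f y ord0 j) y w) x z =
              'd (fun y => 'd f y w) x z ord0 j.
  move=> dw; have [D1 D2] := diff_coord j dw.
  have [] := @near_eq_diff _ _ _ (fun y => 'd f y w ord0 j)
      (fun y => 'd (fun y => f y ord0 j) y w) x _ D1.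
    by apply: filterS df => y dy; have [_ ->] := diff_coord j dy.
  by move=> E1 E2; split=> [|z]; [exact: E1|rewrite E2 D2].
have [Du Eu] := key _ du; have [Dv Ev] := key _ dv.
by rewrite -Eu -Ev; exact: schwarz_real.
Qed.

End schwarz.

(** * Null sets of Euclidean space *)

Section lebesgue_tuples.
Context {R : realType}.
Local Notation tup n := (n.-tuple (measurableTypeR R)).
Local Notation mu := (lebesgue_tuple R).

Definition ins_tuple n (i : 'I_n.+1) (a : R) (t : tup n) : tup n.+1 :=
  [tuple (if unlift i j is Some j' then tnth t j' else a) | j < n.+1].

Definition ins_row n (i : 'I_n.+1) (a : R) (y : 'rV[R]_n) : 'rV[R]_n.+1 :=
  \row_j (if unlift i j is Some j' then y ord0 j' else a).

Lemma rV_of_ins n (i : 'I_n.+1) a (t : tup n) :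
  rV_of_tuple (ins_tuple i a t) = ins_row i a (rV_of_tuple t).
Proof.
apply/rowP => j; rewrite !mxE tnth_mktuple.
by case: unlift => // j'; rewrite mxE.
Qed.

Lemma measurable_ins n (i : 'I_n.+1) :
  measurable_fun [set: measurableTypeR R * tup n] (fun p => ins_tuple i p.1 p.2).
Proof.
apply/measurable_fun_tnthP => j.
case: (unliftP i j) => [j' ->|->].
  rewrite (_ : _ \o _ = (fun x => tnth x j') \o snd).
    by apply: measurableT_comp => //; exact: measurable_tnth.
  by apply/funext => p /=; rewrite tnth_mktuple liftK.
rewrite (_ : _ \o _ = fst) //.
by apply/funext => p /=; rewrite tnth_mktuple unlift_none.
Qed.

Lemma ins_tuple0 n a (t : tup n) : ins_tuple ord0 a t = cons_pair (a, t).
Proof.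
apply: eq_from_tnth => j; rewrite tnth_mktuple.
by case: (unliftP ord0 j) => [j' ->|->] //; rewrite tnthS.
Qed.

Lemma ins_tupleS n (i : 'I_n.+1) a b (t : tup n) :
  ins_tuple (lift ord0 i) a (cons_pair (b, t)) =
  cons_pair (b, ins_tuple i a t).
Proof.
apply: eq_from_tnth => j; rewrite tnth_mktuple.
case: (unliftP ord0 j) => [j' ->|->].
  rewrite tnthS tnth_mktuple.
  case: (unliftP i j') => [j'' ->|->].
    have -> : lift ord0 (lift i j'') = lift (lift ord0 i) (lift ord0 j'').
      by apply/val_inj => /=; rewrite /bump/= !add1n ltnS addnS.
    by rewrite liftK tnthS.
  by rewrite !unlift_none.
have -> : ord0 = lift (lift ord0 i) ord0 :> 'I_n.+2 by apply/val_inj.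
by rewrite liftK.
Qed.

(** The measure is defined by slicing along the first coordinate; exchanging
    neighbouring integrations gives the others. *)
Lemma lebesgue_slices n (i : 'I_n.+1) (B : set (tup n.+1)) : measurable B ->
  mu n.+1 B = (\int[lebesgue_measure]_a mu n [set t | B (ins_tuple i a t)])%E.
Proof.
elim: n i B => [|n IH] i B mB.
  rewrite (ord1 i); apply: eq_integral => a _ /=; congr (mu 0%N _).
  apply/seteqP; split=> t; rewrite /xsection/= inE/=;
    rewrite (_ : ins_tuple _ _ _ = cons_pair (a, t)) //; exact: ins_tuple0.
have E0 : mu n.+2 B = (\int[lebesgue_measure]_b
    mu n.+1 [set t | B (cons_pair (b, t))])%E.
  apply: eq_integral => a _ /=; congr (mu n.+1 _).
  by apply/seteqP; split=> t; rewrite /xsection/= inE/=.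
case: (unliftP ord0 i) => [i' ->|->]; last first.
  rewrite E0; apply: eq_integral => a _; congr (mu n.+1 _).
  by apply/seteqP; split=> t /=; rewrite ins_tuple0.
rewrite E0.
pose C : set (measurableTypeR R * measurableTypeR R * tup n) :=
  [set p | B (cons_pair (p.1.1, ins_tuple i' p.1.2 p.2))].
have mC : measurable C.
  have mf : measurable_fun [set: measurableTypeR R * measurableTypeR R * tup n]
     (fun p => cons_pair (p.1.1, ins_tuple i' p.1.2 p.2)).
    pose A := (measurableTypeR R * measurableTypeR R * tup n)%type.
    have m1 : measurable_fun [set: A] (fun p : A => p.1).
      exact: measurable_fst.
    have m11 : measurable_fun [set: A] (fun p : A => p.1.1).
      exact: (measurableT_comp measurable_fst m1).
    have m12 : measurable_fun [set: A] (fun p : A => p.1.2).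
      exact: (measurableT_comp measurable_snd m1).
    have m2 : measurable_fun [set: A] (fun p : A => (p.1.2, p.2)).
      by apply: measurable_fun_pair => //; exact: measurable_snd.
    exact: (measurable_cons m11 (measurableT_comp (measurable_ins i') m2)).
  by rewrite -[C]setTI; exact: mf.
have mCx := measurable_fun_xsection (mu n) mC.
transitivity (\int[lebesgue_measure]_b \int[lebesgue_measure]_a
    (mu n \o xsection C) (b, a))%E.
  apply: eq_integral => b _; rewrite (IH i').
    apply: eq_integral => a _ /=; congr (mu n _).
    by apply/seteqP; split=> t; rewrite /xsection/= inE/=.
  have mf : measurable_fun [set: tup n.+1] (fun t => cons_pair (b, t)).
    by apply: (@measurable_cons _ _ _ _ (cst b) _ id); [exact: measurable_cst|exact: measurable_id].
  by rewrite -[X in measurable X]setTI; exact: mf.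
apply: (etrans (@fubini_tonelli _ _ _ _ _ (@lebesgue_measure R)
  (@lebesgue_measure R) (mu n \o xsection C) mCx (fun x => measure_ge0 _ _))).
apply: eq_integral => a _.
rewrite [RHS](_ : _ = \int[lebesgue_measure]_b
    mu n [set t | B (ins_tuple (lift ord0 i') a (cons_pair (b, t)))])%E.
  apply: eq_integral => b _ /=; congr (mu n _).
  by apply/seteqP; split=> t; rewrite /xsection/= ?inE/= ins_tupleS.
apply: eq_integral => b _ /=; congr (mu n _).
by apply/seteqP; split=> t; rewrite /xsection/= inE/=.
Qed.

Lemma null_slices n (i : 'I_n.+1) (B : set 'rV[R]_n.+1) :
  measurable (@rV_of_tuple R n.+1 @^-1` B) ->
  (forall a, lebesgue_null [set y | B (ins_row i a y)]) -> lebesgue_null B.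
Proof.
move=> mB nB; apply/negligibleP => //; apply: (etrans (lebesgue_slices i mB)).
apply: integral0_eq => a _.
have := nB a; rewrite /lebesgue_null.
have -> : rV_of_tuple (n:=n) @^-1` [set y | B (ins_row i a y)] =
    [set t | (rV_of_tuple (n:=n.+1) @^-1` B) (ins_tuple i a t)].
  by apply/seteqP; split=> t; rewrite /= rV_of_ins.
apply: measure_negligible.
have mf : measurable_fun [set: tup n] (fun t => ins_tuple i a t).
  apply: (measurableT_comp (measurable_ins i) (g := fun t => (a, t))).
  by apply: measurable_fun_pair => //; exact: measurable_cst.
by rewrite -[X in measurable X]setTI; exact: mf.
Qed.

Let tcube n (x : 'rV[R]_n) (e : R) : set (tup n) :=
  [set t | forall i, `|tnth t i - x ord0 i| < e].

Let measurable_tcube n (x : 'rV[R]_n) (e : R) : measurable (tcube x e).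
Proof.
rewrite (_ : tcube x e = \bigcap_(i in [set: 'I_n])
   ((fun t : tup n => tnth t i) @^-1` (ball (x ord0 i : R) e))).
  apply: fin_bigcap_measurable => // i _.
  rewrite -[X in measurable X]setTI; apply: measurable_tnth => //.
  by rewrite ball_itv; exact: measurable_itv.
apply/seteqP; split=> t.
  by move=> H i _; have := H i; rewrite -ball_normE/= distrC.
by move=> H i; have := H i Logic.I; rewrite -ball_normE/= distrC.
Qed.

(** A countable basis of the topology. *)
Definition qcube n (q : 'rV[rat]_n * rat) : set 'rV[R]_n :=
  [set y | forall i, `|y ord0 i - ratr (q.1 ord0 i)| < ratr q.2].

Lemma measurable_qcube n (q : 'rV[rat]_n * rat) :
  measurable (@rV_of_tuple R n @^-1` qcube q).
Proof.
rewrite (_ : _ @^-1` _ = tcube (\row_i ratr (q.1 ord0 i)) (ratr q.2)) //.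
by apply/seteqP; split=> t H i; have := H i; rewrite !mxE.
Qed.

Lemma qcube_basis n (x : 'rV[R]_n) (U : set 'rV[R]_n) : nbhs x U ->
  exists q, qcube q x /\ qcube q `<=` U.
Proof.
move=> /nbhs_ballP[e /= e0 eU].
have [r] : exists r : rat, ratr r \in `]0, (e / 2)[ :> bool.
  by apply: rat_in_itvoo; rewrite divr_gt0.
rewrite in_itv/= => /andP[r0 re].
have ex i : exists s : rat, `|x ord0 i - ratr s| < ratr r.
  have [|s] := @rat_in_itvoo R (x ord0 i - ratr r) (x ord0 i + ratr r); first by lra.
  by rewrite in_itv/= => Hs; exists s; rewrite ltr_distlC.
have [s Hs] := choice ex.
exists (\row_i s i, r); split=> [i|y Hy]; first by rewrite mxE.
apply: eU; split=> // i0 i; rewrite (ord1 i0) -ball_normE/=.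
have := Hy i; have := Hs i; rewrite !mxE /= => H1; rewrite distrC => H2.
by have := ler_distD (ratr (s i)) (x ord0 i) (y ord0 i); lra.
Qed.

Lemma open_measurable_tuple n (U : set 'rV[R]_n) : open U ->
  measurable (@rV_of_tuple R n @^-1` U).
Proof.
move=> oU.
pose F (q : 'rV[rat]_n * rat) : set (tup n) :=
  if `[< qcube q `<=` U >] then @rV_of_tuple R n @^-1` qcube q else set0.
rewrite (_ : _ @^-1` _ = \bigcup_q F q).
  apply: countable_bigcupT_measurable; first exact: countableP.
  by move=> q; rewrite /F; case: asboolP => _; [exact: measurable_qcube|exact: measurable0].
apply/seteqP; split=> t.
  move=> /= Ut; have [q [qt qU]] := qcube_basis (open_nbhs_nbhs (conj oU Ut)).
  by exists q => //; rewrite /F; case: asboolP.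
by case=> q _; rewrite /F; case: asboolP => // qU /qU.
Qed.

Lemma measurable_tuple_openD n (U U' : set 'rV[R]_n) : open U -> open U' ->
  measurable (@rV_of_tuple R n @^-1` (U `\` U')).
Proof. by move=> oU oU'; apply: measurableD; exact: open_measurable_tuple. Qed.

Lemma lebesgue_null_sub n (A B : set 'rV[R]_n) : A `<=` B ->
  lebesgue_null B -> lebesgue_null A.
Proof. by move=> AB; apply: negligibleS => t /=; exact: AB. Qed.

Lemma lebesgue_null_bigcup n (I : countType) (A : I -> set 'rV[R]_n) :
  (forall i, lebesgue_null (A i)) -> lebesgue_null (\bigcup_i A i).
Proof.
move=> nA.
pose F k := if unpickle k is Some i then A i else set0.
apply: (@lebesgue_null_sub _ _ (\bigcup_k F k)).
  by move=> x [i _ Ax]; exists (pickle i) => //; rewrite /F pickleK.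
rewrite /lebesgue_null preimage_bigcup; apply: negligible_bigcup => k.
rewrite /F; case: unpickle => [i|]; first exact: nA.
by rewrite preimage_set0; exact: negligible_set0.
Qed.

Lemma lebesgue_nullU n (A B : set 'rV[R]_n) :
  lebesgue_null A -> lebesgue_null B -> lebesgue_null (A `|` B).
Proof. by rewrite /lebesgue_null preimage_setU; exact: negligibleU. Qed.

(** A Lindelof argument on the basis of rational cubes. *)
Lemma lebesgue_null_local n (N : set 'rV[R]_n) :
  (forall x, N x -> exists2 U, nbhs x U & lebesgue_null (N `&` U)) ->
  lebesgue_null N.
Proof.
move=> HN.
pose F (q : 'rV[rat]_n * rat) : set 'rV[R]_n :=
  if `[< lebesgue_null (N `&` qcube q) >] then N `&` qcube q else set0.
apply: (@lebesgue_null_sub _ _ (\bigcup_q F q)).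
  move=> x Nx; have [U Ux nU] := HN _ Nx; have [q [qx qU]] := qcube_basis Ux.
  exists q => //; rewrite /F; case: asboolP => // -[].
  by apply: lebesgue_null_sub nU => y [Ny /qU].
apply: lebesgue_null_bigcup => q; rewrite /F; case: asboolP => //= _.
by rewrite /lebesgue_null preimage_set0; exact: negligible_set0.
Qed.

Let tcube_pos n (x : 'rV[R]_n) (e : R) : 0 < e -> (0 < mu n (tcube x e))%E.
Proof.
move=> e0; elim: n x => [|n IH] x.
  rewrite (_ : tcube x e = setT); last by apply/seteqP; split=> // t _ [].
  by rewrite /= /tuple0_measure diracT lte01.
pose y : 'rV[R]_n := \row_i x ord0 (lift ord0 i).
have -> : mu n.+1 (tcube x e) =
    (@lebesgue_measure R \x mu n)%E (ball (x ord0 ord0 : R) e `*` tcube y e).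
  congr ((_ \x _)%E _); apply/seteqP; split=> -[a t] /=.
    move=> H; split; first by have := H ord0; rewrite -ball_normE/= distrC.
    by move=> i; have := H (lift ord0 i); rewrite tnthS mxE.
  move=> [H1 H2] i; case: (unliftP ord0 i) => [j ->|->].
    by have := H2 j; rewrite mxE tnthS.
  by move: H1; rewrite -ball_normE/= distrC.
rewrite product_measure1E; first last.
- exact: measurable_tcube.
- by rewrite ball_itv; exact: measurable_itv.
apply: mule_gt0; last exact: IH.
suff : (0 < (@lebesgue_measure R) (ball (x ord0 ord0 : R) e))%E by [].
by rewrite lebesgue_measure_ball ?ltW// lte_fin mulrn_wgt0.
Qed.

Lemma open_not_null n (U : set 'rV[R]_n) (x : 'rV[R]_n) : nbhs x U ->
  ~ lebesgue_null U.
Proof.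
move=> /nbhs_ballP[e /= e0 eU] nU.
have := tcube_pos x e0; rewrite (_ : mu n _ = 0%E) ?ltxx//.
apply: (measure_negligible (measurable_tcube x e)); apply: negligibleS nU => t Ht.
apply: eU; split=> // i0 i.
by rewrite (ord1 i0) -ball_normE/= distrC mxE; exact: Ht.
Qed.

(** Integrating first along the coordinate [i]: each line meets [B] in at most one
    point. *)
Lemma null_lines n (i : 'I_n.+1) (B : set 'rV[R]_n.+1) :
  measurable (@rV_of_tuple R n.+1 @^-1` B) ->
  (forall y a b, B (ins_row i a y) -> B (ins_row i b y) -> a = b) ->
  lebesgue_null B.
Proof.
move=> mB B1; apply/negligibleP => //; apply: (etrans (lebesgue_slices i mB)).
pose C : set (measurableTypeR R * tup n) :=
  [set p | (@rV_of_tuple R n.+1 @^-1` B) (ins_tuple i p.1 p.2)].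
have mC : measurable C.
  by rewrite -[C]setTI; exact: (measurable_ins i).
transitivity ((@lebesgue_measure R \x mu n)%E C).
  apply: eq_integral => a _ /=; congr (mu n _).
  by apply/seteqP; split=> t; rewrite /xsection/= inE/=.
rewrite (product_measure_unique (m' := (@lebesgue_measure R \x^ mu n)%E)) //; last first.
  by move=> A1 A2 mA1 mA2; rewrite /= product_measure2E.
apply: integral0_eq => t _ /=.
have yE a : ysection C t a -> B (ins_row i a (rV_of_tuple t)).
  by rewrite -rV_of_ins => /set_mem.
have H a b : ysection C t a -> ysection C t b -> a = b.
  by move=> /yE Ba /yE; exact: B1.
have [->|/set0P[a Ca]] := eqVneq (ysection C t) set0; first by rewrite measure0.
rewrite (_ : ysection C t = [set a]) ?lebesgue_measure_set1//.
by apply/seteqP; split=> b /=; [move=> Cb; exact: H|move=> ->].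
Qed.

Lemma ins_row_line n (i : 'I_n.+1) a (y : 'rV[R]_n) :
  ins_row i a y = ins_row i 0 y + a *: delta_mx ord0 i.
Proof.
apply/rowP => j; rewrite !mxE eqxx/=.
case: (unliftP i j) => [j' ->|->]; last by rewrite eqxx add0r mulr1.
by rewrite eq_sym (negbTE (neq_lift _ _)) mulr0 addr0.
Qed.

Lemma near_neq0 (T : topologicalType) (f : T -> R) (x : T) :
  {for x, continuous f} -> f x != 0 -> \forall y \near x, f y != 0.
Proof. by move=> cf; exact: (cvgr_neq0 (F := nbhs x)). Qed.

(** On a small cube [g] is strictly monotone along a coordinate in which its
    derivative does not vanish, so its level set meets each line once. *)
Lemma null_level n (g : 'rV[R]_n.+1 -> R) (x u : 'rV[R]_n.+1) :
  C1at g x -> 'd g x u != 0 ->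
  exists2 U, nbhs x U & lebesgue_null ([set y | g y = 0] `&` U).
Proof.
move=> Cg du.
have [i di] : exists i, 'd g x (delta_mx ord0 i) != 0.
  apply: contrapT => H; move/negP: du; apply.
  rewrite (matrix_sum_delta u) big_ord1 linear_sum/= big1// => i _.
  rewrite linearZ/=; have -> : 'd g x (delta_mx ord0 i) = 0.
    by apply/eqP/negPn/negP => Hi; apply: H; exists i.
  by rewrite scaler0.
have : \forall y \near x, differentiable g y /\ 'd g y (delta_mx ord0 i) != 0.
  have N := near_neq0 (C1at_dcont Cg (delta_mx ord0 i)) di.
  by apply: filterS2 (C1at_near Cg) N => y.
case/nbhs_ballP => e /= e0 eH.
exists (interior (ball x e)); first by apply: nbhs_interior; exact: nbhsx_ballx.
set B := _ `&` _.
have gB y : interior (ball x e) y -> differentiable g y by move=> /interior_subset /eH [].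
apply: (null_lines (i := i)).
  have -> : B = interior (ball x e) `\` (interior (ball x e) `&` g @^-1` [set z | z != 0]).
    apply/seteqP; split=> y.
      by move=> [/= gy By]; split=> // -[_ /=]; rewrite gy eqxx.
    move=> [By H]; split=> //=; apply: contrapT => gy; apply: H; split=> //=.
    exact/eqP.
  apply: measurable_tuple_openD; first exact: open_interior.
  rewrite openE => y [By /= gy].
  apply: filterI; first by apply: open_nbhs_nbhs; split=> //; exact: open_interior.
  have cg := differentiable_continuous (gB y By).
  exact: (near_neq0 cg gy).
have key y a b : B (ins_row i a y) -> B (ins_row i b y) -> a < b -> False.
  move=> [/= ga /interior_subset Ba] [/= gb /interior_subset Bb] ab.
  pose y0 := ins_row i 0 y; pose v : 'rV[R]_n.+1 := delta_mx ord0 i.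
  have Bc c : a <= c -> c <= b -> ball x e (y0 + c *: v).
    move=> ac cb; rewrite -ins_row_line; move: Ba Bb => [_ Ba] [_ Bb].
    split=> // i0 j; have := Ba i0 j; have := Bb i0 j.
    rewrite (ord1 i0) !mxE; case: unliftP => // _.
    rewrite -!ball_normE/= !ltr_distl => /andP[? ?] /andP[? ?].
    by apply/andP; split; lra.
  have Hd c : c \in `[a, b] -> is_derive c 1 (fun t => g (y0 + t *: v)) ('d g (y0 + c *: v) v).
    rewrite in_itv/= => /andP[ac cb]; apply: is_derive_line.
    by have [] := eH _ (Bc _ ac cb).
  have [c] := @MVT R (fun t => g (y0 + t *: v)) (fun c => 'd g (y0 + c *: v) v) _ _ ab
   (fun y (yst : y \in `]a, b[) => Hd y (subset_itv_oo_cc yst))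
   (derivable_within_continuous (fun y yst => @ex_derive _ _ _ _ _ _ _ (Hd y yst))).
  rewrite in_itv/= => /andP[/ltW ac /ltW cb].
  rewrite -!ins_row_line ga gb subrr => /esym/eqP; rewrite mulf_eq0.
  case/orP => [/eqP E|]; last by rewrite subr_eq0 gt_eqF.
  by have [_] := eH _ (Bc _ ac cb); rewrite -ins_row_line E eqxx.
move=> y a b Ba Bb; case: (ltgtP a b) => // ab; exfalso.
  exact: key Ba Bb ab.
exact: key Bb Ba ab.
Qed.

End lebesgue_tuples.

(** * Differential calculus on the manifold *)

(** Differential of a map into the manifold, valued in the tangent vectors as
    they are represented in the preferred chart of the image point. *)
HB.lock Definition dM (R : realType) (d : nat) (M : manifold R d)
    (V : normedModType R) (psi : V -> M) (x : V) : V -> tangent R d :=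
  'd (fwd (chart_at (psi x)) \o psi) x.

Variant C1M (R : realType) (d : nat) (M : manifold R d)
    (V : normedModType R) (psi : V -> M) (x : V) : Prop :=
  C1MI of {for x, continuous psi} & C1at (fwd (chart_at (psi x)) \o psi) x.

Section manifold_calculus.
Context {R : realType} {d : nat} {M : manifold R d}.
Implicit Types V W : normedModType R.

Lemma near_open (T : topologicalType) (U : set T) x : open U -> U x -> nbhs x U.
Proof. by move=> oU Ux; exact: open_nbhs_nbhs. Qed.

Lemma near_continuous (T U : topologicalType) (f : T -> U) x (A : set U) :
  {for x, continuous f} -> nbhs (f x) A -> \forall y \near x, A (f y).
Proof. by move=> cf; exact: cf. Qed.

Lemma open_preimage_within (T U : topologicalType) (f : T -> U) (A : set T) (B : set U) :
  open A -> (forall x, A x -> {for x, continuous f}) -> open B ->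
  open (A `&` f @^-1` B).
Proof.
move=> oA cf oB; rewrite openE => x [Ax Bx].
apply: filterI; first exact: near_open.
exact: near_continuous (cf _ Ax) (near_open oB Bx).
Qed.

Lemma near_dom (T : topologicalType) (psi : T -> M) x (c : chart R d M) :
  {for x, continuous psi} -> chart_dom c (psi x) ->
  \forall y \near x, chart_dom c (psi y).
Proof.
by move=> cp cx; apply: (near_continuous cp (near_open (@chart_open_dom _ _ _ (c)) cx)).
Qed.

Lemma open_overlap (c c' : chart R d M) :
  open [set x | chart_cod c x /\ chart_dom c' (bwd c x)].
Proof.
apply: (open_preimage_within (f := bwd c) (B := chart_dom c')).
- exact: chart_open_cod.
- by move=> x; exact: bwd_continuous.
- exact: chart_open_dom.
Qed.

Lemma C1at_transition (c c' : chart R d M) x : atlas c -> atlas c' ->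
  chart_cod c x -> chart_dom c' (bwd c x) -> C1at (fwd c' \o bwd c) x.
Proof.
move=> ac ac' cx c'x; have /(_ 1%N) H := atlas_smooth ac ac'.
exact: ((C1at_Ck (fwd c' \o bwd c) (@open_overlap c c')).1 H x (conj cx c'x)).
Qed.

Lemma transition_diff V (psi : V -> M) x (c c' : chart R d M) :
  atlas c -> atlas c' -> {for x, continuous psi} ->
  chart_dom c (psi x) -> chart_dom c' (psi x) -> C1at (fwd c \o psi) x ->
  C1at (fwd c' \o psi) x /\ forall v, 'd (fwd c' \o psi) x v =
    'd (fwd c' \o bwd c) (fwd c (psi x)) ('d (fwd c \o psi) x v).
Proof.
move=> ac ac' cp cx c'x C.
have Ct : C1at (fwd c' \o bwd c) (fwd c (psi x)).
  by apply: C1at_transition; rewrite ?fwdK //; exact: fwd_cod.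
have E : \forall y \near x,
    ((fwd c' \o bwd c) \o (fwd c \o psi)) y = (fwd c' \o psi) y.
  by apply: filterS (near_dom cp cx) => y cy /=; rewrite fwdK.
have C' := C1at_comp (@fdim_rV R d) C Ct.
split; first exact: near_eq_C1at E C'.
move=> v; have [_ dE] := near_eq_diff E (C1at_diff C').
apply: (etrans (congr1 (fun h => h v) dE)).
exact: (congr1 (fun h => h v) (diff_comp (C1at_diff C) (C1at_diff Ct))).
Qed.

Lemma C1M_chart V (psi : V -> M) x (c : chart R d M) : atlas c ->
  chart_dom c (psi x) -> C1M psi x ->
  C1at (fwd c \o psi) x /\
  forall v, dM psi x v = coord_vec c (psi x) ('d (fwd c \o psi) x v).
Proof.
move=> ac cx [cp C].
have [H _] := transition_diff (chart_at_atlas _) ac cp (chart_at_dom _) cx C.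
split=> // v.
have [_ dE] := transition_diff ac (chart_at_atlas _) cp cx (chart_at_dom _) H.
by rewrite dM.unlock; exact: dE.
Qed.

Lemma C1M_of_chart V (psi : V -> M) x (c : chart R d M) : atlas c ->
  {for x, continuous psi} -> chart_dom c (psi x) -> C1at (fwd c \o psi) x ->
  C1M psi x.
Proof.
move=> ac cp cx C; split; first exact: cp.
by have [] := transition_diff ac (chart_at_atlas _) cp cx (chart_at_dom (psi x)) C.
Qed.

Lemma C1M_C1at V (psi : V -> M) x : C1M psi x ->
  C1at (fwd (chart_at (psi x)) \o psi) x.
Proof. by case. Qed.

Lemma C1M_cont V (psi : V -> M) x : C1M psi x -> {for x, continuous psi}.
Proof. by case. Qed.

Lemma near_eq_C1M V (psi phi : V -> M) x : (\forall y \near x, psi y = phi y) ->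
  C1M psi x -> C1M phi x /\ dM phi x = dM psi x.
Proof.
move=> E [cp C]; have Ex := nbhs_singleton E.
have E' : \forall y \near x,
    (fwd (chart_at (psi x)) \o psi) y = (fwd (chart_at (psi x)) \o phi) y.
  by apply: filterS E => y /= ->.
split; last first.
  rewrite dM.unlock -Ex; have [_ H] := near_eq_diff E' (C1at_diff C).
  exact: H.
split; last by rewrite -Ex; exact: near_eq_C1at E' C.
rewrite /prop_for /continuous_at -Ex; apply: cvg_trans cp.
by apply: near_eq_cvg; apply: filterS E => y ->.
Qed.

Lemma C1M_comp V W (a : V -> W) (psi : W -> M) x : fdim W ->
  C1at a x -> C1M psi (a x) ->
  C1M (psi \o a) x /\ forall v, dM (psi \o a) x v = dM psi (a x) ('d a x v).
Proof.
move=> fW Ca [cp C]; split; last first.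
  move=> v; rewrite dM.unlock.
  exact: (congr1 (fun h => h v) (diff_comp (C1at_diff Ca) (C1at_diff C))).
split; last exact: C1at_comp fW Ca C.
by apply: continuous_comp; [exact: C1at_cont Ca|exact: cp].
Qed.

Lemma Ck_to_C1M V k (U : set V) (F : V -> M) x : open U -> Ck_to k.+1 U F -> U x ->
  C1M F x.
Proof.
move=> oU [cF CF] Ux; split; first exact: cF.
have := CF _ (chart_at_atlas (F x)).
have oU' : open (U `&` F @^-1` chart_dom (chart_at (F x))).
  by apply: open_preimage_within => //; exact: chart_open_dom.
have : (U `&` F @^-1` chart_dom (chart_at (F x))) x.
  by split=> //; exact: chart_at_dom.
move=> Ux' H; have {}H : Ck_on 1 (U `&` F @^-1` chart_dom (chart_at (F x)))
    (fwd (chart_at (F x)) \o F).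
  by elim: k H {CF} => // k IH /Ck_onS.
exact: (C1at_Ck _ oU').1 H _ Ux'.
Qed.

Lemma C1M_Ck_to V (U : set V) (F : V -> M) : open U ->
  (forall x, U x -> C1M F x) -> Ck_to 1 U F.
Proof.
move=> oU CF; split; first by move=> x /CF[].
move=> c ac; have oU' : open (U `&` F @^-1` chart_dom c).
  by apply: open_preimage_within => //; [by move=> x /CF[]|exact: chart_open_dom].
apply/(C1at_Ck _ oU') => x [Ux cx].
by have [] := C1M_chart ac cx (CF _ Ux).
Qed.

(** Read in the preferred chart of the source; by [C1map_chart] any other chart will
    do. *)
Definition C1map (F : M -> M) (p : M) :=
  C1M (F \o bwd (chart_at p)) (fwd (chart_at p) p).

Lemma bwd_fwd_at (p : M) : bwd (chart_at p) (fwd (chart_at p) p) = p.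
Proof. by rewrite fwdK//; exact: chart_at_dom. Qed.

Lemma mdiffE (F : M -> M) p : mdiff F p = dM (F \o bwd (chart_at p)) (fwd (chart_at p) p).
Proof. by rewrite /mdiff dM.unlock /local_rep /= bwd_fwd_at. Qed.

Lemma near_fwd_bwd (p : M) (c : chart R d M) : chart_dom c p ->
  \forall q \near p, bwd c (fwd c q) = q.
Proof.
move=> cp; apply: filterS (near_open (@chart_open_dom _ _ _ (c)) cp) => q cq.
by rewrite fwdK.
Qed.

Lemma C1map_cont F p : C1map F p -> {for p, continuous F}.
Proof.
move=> [cF _]; have cp := chart_at_dom p.
have H : {for p, continuous ((F \o bwd (chart_at p)) \o fwd (chart_at p))}.
  by apply: continuous_comp => //; exact: fwd_continuous.
rewrite /prop_for /continuous_at -{2}(bwd_fwd_at p).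
apply: cvg_trans H; apply: near_eq_cvg.
by apply: filterS (near_fwd_bwd cp) => q /= ->.
Qed.

Lemma C1map_mdifferentiable F p : C1map F p -> mdifferentiable F p.
Proof.
move=> CF; split; first exact: C1map_cont.
by move: CF => [_ /C1at_diff]; rewrite /local_rep /= bwd_fwd_at.
Qed.

Lemma bwd_C1M (c : chart R d M) x : atlas c -> chart_cod c x -> C1M (bwd c) x.
Proof.
move=> ac cx; apply: (C1M_of_chart ac).
- exact: bwd_continuous.
- exact: bwd_dom.
- apply: (@near_eq_C1at _ _ _ id _ x); last exact: C1at_id.
  by apply: filterS (near_open (@chart_open_cod _ _ _ (c)) cx) => y cy /=; rewrite bwdK.
Qed.

Lemma dM_bwd (c : chart R d M) x v : chart_cod c x ->
  dM (bwd c) x v = coord_vec c (bwd c x) v.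
Proof. by move=> cx; rewrite dM.unlock /coord_vec bwdK. Qed.

Lemma fwd_cod_at (p : M) : chart_cod (chart_at p) (fwd (chart_at p) p).
Proof. by apply: fwd_cod; exact: chart_at_dom. Qed.

Lemma C1map_comp V (F : M -> M) (psi : V -> M) x :
  C1M psi x -> C1map F (psi x) ->
  C1M (F \o psi) x /\ forall v, dM (F \o psi) x v = mdiff F (psi x) (dM psi x v).
Proof.
move=> Cp CF; have [C1 E1] := C1M_comp (@fdim_rV R d) (C1M_C1at Cp) CF.
have E : \forall y \near x, ((F \o bwd (chart_at (psi x))) \o
    (fwd (chart_at (psi x)) \o psi)) y = (F \o psi) y.
  apply: filterS (near_dom (C1M_cont Cp) (chart_at_dom (psi x))) => y cy /=.
  by rewrite fwdK.
have [H1 H2] := near_eq_C1M E C1; split; first exact: H1.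
move=> v; rewrite H2 E1 mdiffE; congr (dM _ _ _).
by rewrite [in RHS]dM.unlock.
Qed.

Lemma C1map_chart (F : M -> M) p (c : chart R d M) : atlas c -> chart_dom c p ->
  C1M (F \o bwd c) (fwd c p) -> C1map F p.
Proof.
move=> ac cp CF; rewrite /C1map.
have [//||C1 _] := @C1M_comp _ _ (fwd c \o bwd (chart_at p)) (F \o bwd c)
   (fwd (chart_at p) p) (@fdim_rV R d).
- apply: C1at_transition => //; [exact: chart_at_atlas|exact: fwd_cod_at|].
  by rewrite bwd_fwd_at.
- by rewrite /= bwd_fwd_at.
suff E : \forall y \near fwd (chart_at p) p,
    ((F \o bwd c) \o (fwd c \o bwd (chart_at p))) y = (F \o bwd (chart_at p)) y.
  by have [] := near_eq_C1M E C1.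
have cb := bwd_continuous (fwd_cod_at p).
have cx : chart_dom c (bwd (chart_at p) (fwd (chart_at p) p)) by rewrite bwd_fwd_at.
by apply: filterS (near_dom cb cx) => y cy /=; rewrite fwdK.
Qed.

Lemma Ck_map_C1map k (U : set M) (F : M -> M) p : open U -> Ck_map k.+1 U F ->
  U p -> C1map F p.
Proof.
move=> oU CF Up; apply: (Ck_to_C1M _ (CF _ (chart_at_atlas p))).
  apply: open_preimage_within => //; first exact: chart_open_cod.
  by move=> x; exact: bwd_continuous.
by split; [exact: fwd_cod_at|rewrite /= bwd_fwd_at].
Qed.

Lemma Ck_fun_comp V W k (U : set M) (h : M -> W) (psi : V -> M) x :
  open U -> Ck_fun k.+1 U h -> U (psi x) -> C1M psi x ->
  C1at (h \o psi) x /\ forall v, 'd (h \o psi) x v =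
    'd (h \o bwd (chart_at (psi x))) (fwd (chart_at (psi x)) (psi x)) (dM psi x v).
Proof.
move=> oU Ch Up Cp.
set c := chart_at (psi x).
have oU' : open (chart_cod c `&` bwd c @^-1` U).
  apply: open_preimage_within => //; first exact: chart_open_cod.
  by move=> y; exact: bwd_continuous.
have Cc : C1at (h \o bwd c) (fwd c (psi x)).
  have H : Ck_on 1 (chart_cod c `&` bwd c @^-1` U) (h \o bwd c).
    have := Ch _ (chart_at_atlas (psi x)); elim: k {Ch} => // k IH /Ck_onS; exact: IH.
  apply: ((C1at_Ck _ oU').1 H); split; first exact: fwd_cod_at.
  by rewrite /= bwd_fwd_at.
have [cp C] := Cp.
have E : \forall y \near x, ((h \o bwd c) \o (fwd c \o psi)) y = (h \o psi) y.
  by apply: filterS (near_dom cp (chart_at_dom (psi x))) => y cy /=; rewrite fwdK.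
have C' := C1at_comp (@fdim_rV R d) C Cc.
split; first exact: near_eq_C1at E C'.
move=> v; have [_ dE] := near_eq_diff E (C1at_diff C').
apply: (etrans (congr1 (fun h => h v) dE)); rewrite dM.unlock.
exact: (congr1 (fun h => h v) (diff_comp (C1at_diff C) (C1at_diff Cc))).
Qed.

Lemma C1M_velocity (g : R -> M) : C1M g 0 -> velocity g (dM g 0 1).
Proof.
move=> [cg Cg]; split; first exact: near_dom cg (chart_at_dom _).
have dg := C1at_diff Cg.
rewrite dM.unlock -(deriveE _ dg); exact/derivableP/diff_derivable.
Qed.

Lemma coord_vecK (c : chart R d M) p v : atlas c -> chart_dom c p ->
  coord_vec c p ('d (fwd c \o bwd (chart_at p)) (fwd (chart_at p) p) v) = v.
Proof.
move=> ac cp; rewrite /coord_vec.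
have C0 : C1M (bwd (chart_at p)) (fwd (chart_at p) p).
  by apply: bwd_C1M; [exact: chart_at_atlas|exact: fwd_cod_at].
have cp' : chart_dom c (bwd (chart_at p) (fwd (chart_at p) p)) by rewrite bwd_fwd_at.
have [_] := C1M_chart ac cp' C0; rewrite /coord_vec bwd_fwd_at => <-.
rewrite dM.unlock bwd_fwd_at.
have E : \forall y \near fwd (chart_at p) p,
    id y = (fwd (chart_at p) \o bwd (chart_at p)) y.
  apply: filterS (near_open (@chart_open_cod _ _ _ (chart_at p)) (fwd_cod_at p)) => y cy /=.
  by rewrite bwdK.
have [_ dE] := near_eq_diff E (C1at_diff (C1at_id _)).
apply: (etrans (congr1 (fun h => h v) dE)).
exact: diff_idE.
Qed.

Lemma coord_vec_inj (c : chart R d M) p u : atlas c -> chart_dom c p ->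
  'd (fwd c \o bwd (chart_at p)) (fwd (chart_at p) p) (coord_vec c p u) = u.
Proof.
move=> ac cp; have cx := fwd_cod cp.
have C0 := bwd_C1M ac cx.
have cp' : chart_dom (chart_at p) (bwd c (fwd c p)) by rewrite fwdK//; exact: chart_at_dom.
have [H1 _] := C1M_chart (chart_at_atlas p) cp' C0.
have Ct : C1at (fwd c \o bwd (chart_at p)) (fwd (chart_at p) p).
  apply: C1at_transition => //; [exact: chart_at_atlas|exact: fwd_cod_at|].
  by rewrite bwd_fwd_at.
rewrite /coord_vec.
have Ct' : C1at (fwd c \o bwd (chart_at p)) ((fwd (chart_at p) \o bwd c) (fwd c p)).
  by rewrite /= fwdK.
have dC := congr1 (fun h => h u) (diff_comp (C1at_diff H1) (C1at_diff Ct')).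
have E : \forall y \near fwd c p,
    id y = ((fwd c \o bwd (chart_at p)) \o (fwd (chart_at p) \o bwd c)) y.
  apply: filterS2 (near_open (@chart_open_cod _ _ _ c) cx)
    (near_dom (bwd_continuous cx) cp') => y cy cy' /=.
  by rewrite fwdK// bwdK.
have [_ dE] := near_eq_diff E (C1at_diff (C1at_id _)).
have Eq := etrans (esym dC) (congr1 (fun h => h u) dE).
have E1 : (fwd (chart_at p) \o bwd c) (fwd c p) = fwd (chart_at p) p.
  by rewrite /= fwdK.
rewrite E1 in Eq; apply: (etrans Eq).
exact: diff_idE.
Qed.

End manifold_calculus.

(** * Exterior algebra *)

Section alternating_forms.
Context {R : realType} {V : lmodType R}.
Implicit Types (p q : nat).

Definition upd (T : Type) p (v : 'I_p -> T) (i : 'I_p) (x : T) : 'I_p -> T :=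
  fun j => if j == i then x else v j.

Definition multilinear p (w : mform R V p) := forall v i (c : R) x y,
  w (upd v i (c *: x + y)) = c * w (upd v i x) + w (upd v i y).

(** Vanishing of the contraction of [w] with [v0], in any slot. *)
Definition kills (v0 : V) p (w : mform R V p) := forall v i, v i = v0 -> w v = 0.

Definition alternating p (w : mform R V p) :=
  forall v i j, i != j -> v i = v j -> w v = 0.

Lemma kills_wedge v0 p q (a : mform R V p) (b : mform R V q) :
  kills v0 a -> kills v0 b -> kills v0 (wedge a b).
Proof.
move=> ka kb v i vi; rewrite /wedge big1 ?mulr0// => s _.
have [j ij] : exists j, s j = i by exists (s^-1%g i); rewrite permKV.
case: (split_ordP j) ij => k -> sk.
  by rewrite (ka _ k) ?mulr0 ?mul0r// sk.
by rewrite (kb _ k) ?mulr0// sk.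
Qed.

Lemma upd_lshift p q (v : 'I_(p + q) -> V) (s : 'S_(p + q)) k z :
  (fun i => upd v (s (lshift q k)) z (s (lshift q i))) =
  upd (fun i => v (s (lshift q i))) k z.
Proof.
apply/funext => i; rewrite /upd (inj_eq perm_inj) (inj_eq (@lshift_inj _ _)).
by case: eqP.
Qed.

Lemma upd_rshift p q (v : 'I_(p + q) -> V) (s : 'S_(p + q)) k z :
  (fun i => upd v (s (rshift p k)) z (s (rshift p i))) =
  upd (fun i => v (s (rshift p i))) k z.
Proof.
apply/funext => i; rewrite /upd (inj_eq perm_inj) (inj_eq (@rshift_inj _ _)).
by case: eqP.
Qed.

Lemma upd_lrshift p q (v : 'I_(p + q) -> V) (s : 'S_(p + q)) k z :
  (fun i => upd v (s (rshift p k)) z (s (lshift q i))) = (fun i => v (s (lshift q i))).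
Proof. by apply/funext => i; rewrite /upd (inj_eq perm_inj) eq_lrshift. Qed.

Lemma upd_rlshift p q (v : 'I_(p + q) -> V) (s : 'S_(p + q)) k z :
  (fun i => upd v (s (lshift q k)) z (s (rshift p i))) = (fun i => v (s (rshift p i))).
Proof. by apply/funext => i; rewrite /upd (inj_eq perm_inj) eq_rlshift. Qed.

Lemma multilinear_wedge p q (a : mform R V p) (b : mform R V q) :
  multilinear a -> multilinear b -> multilinear (wedge a b).
Proof.
move=> la lb v i c x y; rewrite /wedge mulrCA -mulrDr; congr (_ * _).
rewrite mulr_sumr -big_split/=; apply: eq_bigr => s _.
have [j <-] : exists j, s j = i by exists (s^-1%g i); rewrite permKV.
have E1 (r A B C : R) : r * (c * A + B) * C = c * (r * A * C) + r * B * C by ring.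
have E2 (r A B C : R) : r * C * (c * A + B) = c * (r * C * A) + r * C * B by ring.
case: (split_ordP j) => k ->.
  by rewrite !upd_lshift !upd_rlshift la E1.
by rewrite !upd_rshift !upd_lrshift lb E2.
Qed.

Lemma wedge_perm p q (a : mform R V p) (b : mform R V q) (t : 'S_(p + q)) v :
  wedge a b (fun i => v (t i)) = (-1) ^+ t * wedge a b v.
Proof.
rewrite /wedge mulrCA; congr (_ * _); rewrite mulr_sumr.
rewrite [RHS](reindex_inj (mulIg t))/=; apply: eq_bigr => s _.
rewrite odd_permM signr_addb !mulrA; congr (_ * _ * _).
- by rewrite [X in _ = X * _ ]mulrC -mulrA -signr_addb addbb mulr1.
- by congr a; apply/funext => i; rewrite permM.
- by congr b; apply/funext => i; rewrite permM.
Qed.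

Lemma alternating_wedge p q (a : mform R V p) (b : mform R V q) :
  alternating (wedge a b).
Proof.
move=> v i j ij vij.
have := wedge_perm a b (tperm i j) v; rewrite odd_tperm ij expr1 mulN1r.
have -> : (fun l => v (tperm i j l)) = v.
  by apply/funext => l; case: tpermP => // ->.
by move/eqP; rewrite -addr_eq0 -mulr2n mulrn_eq0/= => /eqP.
Qed.

Lemma multilinear_sum p (w : mform R V p) : multilinear w ->
  forall v i n (l : 'I_n -> R) (b : 'I_n -> V),
  (forall m, w (upd v i (b m)) = 0) -> w (upd v i (\sum_m l m *: b m)) = 0.
Proof.
move=> lw v i n l b H.
have w0 : w (upd v i 0) = 0.
  have := lw v i 0 0 0; rewrite scaler0 addr0 mul0r add0r => /esym.
  have := lw v i (-1) 0 0; rewrite scaler0 addr0 mulN1r addrC subrr.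
  by [].
elim/big_ind : _ => // [x y wx wy|m _].
  by have := lw v i 1 x y; rewrite scale1r wx wy mulr0 addr0.
by have := lw v i (l m) (b m) 0; rewrite addr0 H mulr0 w0 addr0.
Qed.

(** The arguments are expanded on the family one at a time, the induction bearing
    on the number of arguments still to be expanded. *)
Lemma multilinear_span p (w : mform R V p) n (b : 'I_n -> V) : multilinear w ->
  (forall x, exists l : 'I_n -> R, x = \sum_m l m *: b m) ->
  (forall s : 'I_p -> 'I_n, w (fun i => b (s i)) = 0) -> forall v, w v = 0.
Proof.
move=> lw sb H v.
have key m : forall v : 'I_p -> V,
    (forall i : 'I_p, (m <= i)%N -> exists j, v i = b j) -> w v = 0.
  elim: m => [|m IH] {}v Hv.
    have [s Hs] := choice (fun i => Hv i (leq0n _)).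
    by have -> : v = (fun i => b (s i)) by apply/funext => i.
  have [pm|mp] := leqP p m.
    by apply: IH => i mi; have := leq_trans (ltn_ord i) (leq_trans pm mi); rewrite ltnn.
  pose i := Ordinal mp; have [l El] := sb (v i).
  have -> : v = upd v i (\sum_m l m *: b m).
    by apply/funext => j; rewrite /upd -El; case: eqP => // ->.
  apply: multilinear_sum => // j; apply: IH => i' mi'.
  rewrite /upd; case: eqP => [_|/eqP ni]; first by exists j.
  apply: Hv; rewrite ltn_neqAle mi' andbT.
  by apply: contra ni => /eqP E; apply/eqP/val_inj.
by apply: (key p) => i; rewrite leqNgt ltn_ord.
Qed.

End alternating_forms.

Section top_degree.
Context {R : realType} {d : nat}.
Local Notation V := 'rV[R]_d.

(** Exchanging one vector of the standard basis for [v0] gives a basis.  A tuple of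
    basis vectors that contains [v0] is killed, and one that does not has a
    repetition. *)
Lemma top_form_kills (w : mform R V d) v0 : multilinear w -> alternating w ->
  kills v0 w -> v0 != 0 -> forall v, w v = 0.
Proof.
move=> lw aw kw v00.
have [k vk] : exists k, v0 ord0 k != 0.
  apply: contrapT => H; move/negP : v00; apply; apply/eqP/rowP => k; rewrite mxE.
  by apply/eqP/negPn/negP => Hk; apply: H; exists k.
pose b (i : 'I_d) : V := if i == k then v0 else delta_mx ord0 i.
apply: (multilinear_span (b := b)) => // [x|s].
  pose c := x ord0 k / v0 ord0 k.
  exists (fun i => if i == k then c else x ord0 i - c * v0 ord0 i).
  apply/rowP => j; rewrite summxE (bigD1 k)//= /b eqxx mxE.
  rewrite (eq_bigr (fun i => (x ord0 i - c * v0 ord0 i) * (j == i)%:R)); last first.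
    by move=> i /negbTE ->; rewrite !mxE.
  have [->|jk] := eqVneq j k.
    rewrite big1 ?addr0 ?divfK// => i /negbTE ik; by rewrite eq_sym ik mulr0.
  rewrite (bigD1 j)//= eqxx mulr1 big1 ?addr0; last first.
    by move=> i /andP[_ /negbTE ij]; rewrite eq_sym ij mulr0.
  by rewrite addrC subrK.
have [[i si]|ns] := pselect (exists i, s i = k).
  by apply: (kw _ i); rewrite /b si eqxx.
have [i [j [ij sij]]] : exists i j, i != j /\ s i = s j.
  apply: contrapT => H; apply: ns.
  have is_ : injective s.
    move=> i j sij; apply/eqP/negPn/negP => ij; apply: H; exists i, j.
    by split.
  by exists (invF is_ k); rewrite f_invF.
by apply: (aw _ i j) => //; rewrite sij.
Qed.

(** A tuple of basis vectors is a permutation of the basis or has a repetition. *)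
Lemma top_form_basis (w : mform R V d) (b : 'I_d -> V) : multilinear w ->
  alternating w ->
  (forall (t : 'S_d) v, w (fun i => v (t i)) = (-1) ^+ t * w v) ->
  (forall x, exists l : 'I_d -> R, x = \sum_m l m *: b m) ->
  w b = 0 -> forall v, w v = 0.
Proof.
move=> lw aw pw sb wb; apply: (multilinear_span (b := b)) => // s.
have [is_|ns] := pselect (injective s).
  have -> : (fun i => b (s i)) = (fun i => b (perm is_ i)).
    by apply/funext => i; rewrite permE.
  by rewrite pw wb mulr0.
have [i [j [ij sij]]] : exists i j, i != j /\ s i = s j.
  apply: contrapT => H; apply: ns => i j sij; apply/eqP/negPn/negP => ij.
  by apply: H; exists i, j.
by apply: (aw _ i j) => //; rewrite sij.
Qed.

End top_degree.

(** * The exterior derivative in coordinates *)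

Section sum_of_products.
Context {R : realType}.

Lemma diff_sum (V W : normedModType R) n (F : 'I_n -> V -> W) x :
  (forall i, differentiable (F i) x) ->
  differentiable (fun y => \sum_i F i y) x /\
  forall v, 'd (fun y => \sum_i F i y) x v = \sum_i 'd (F i) x v.
Proof.
elim: n F => [|n IH] F dF.
  rewrite (_ : (fun y => _) = cst 0); last by apply/funext => y; rewrite big_ord0.
  split; first exact: differentiable_cst.
  by move=> v; rewrite big_ord0 (diff_cst 0 x).
rewrite (_ : (fun y => _) =
    (fun y => \sum_(i < n) F (widen_ord (leqnSn n) i) y) \+ F ord_max); last first.
  by apply/funext => y; rewrite big_ord_recr.
have [d1 E1] := IH (fun i => F (widen_ord (leqnSn n) i)) (fun i => dF _).
split; first exact: differentiableD d1 (dF _).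
move=> v; apply: (etrans (congr1 (fun h => h v) (diffD d1 (dF _)))).
by rewrite big_ord_recr; congr (_ + _); exact: E1.
Qed.

Lemma diff_sum_prod (V : normedModType R) n (A B : 'I_n -> V -> R) x :
  (forall i, differentiable (A i) x) -> (forall i, differentiable (B i) x) ->
  differentiable (fun y => \sum_i A i y * B i y) x /\
  forall v, 'd (fun y => \sum_i A i y * B i y) x v =
    \sum_i ('d (A i) x v * B i x + A i x * 'd (B i) x v).
Proof.
move=> dA dB.
have dAB i : differentiable (A i * B i) x by exact: differentiableM.
have [d1 E1] := diff_sum dAB; split; first exact: d1.
move=> v; rewrite [LHS]E1; apply: eq_bigr => i _.
rewrite (diffM (dA i) (dB i)) !fctE /GRing.scale/= addrC; congr (_ + _).
by rewrite mulrC.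
Qed.

End sum_of_products.

Section one_forms.
Context {R : realType} {d : nat} {M : manifold R d}.
Implicit Types (a : oneform M) (c : chart R d M).

Lemma eval_linear (m : 'cV[R]_d) : linear (Defs.eval m : tangent R d -> R).
Proof. by move=> r u v; rewrite /Defs.eval mulmxDl -scalemxAl !mxE. Qed.

Lemma eval_sum (m : 'cV[R]_d) n (l : 'I_n -> R) (b : 'I_n -> tangent R d) :
  Defs.eval m (\sum_i l i *: b i) = \sum_i l i * Defs.eval m (b i).
Proof.
rewrite /Defs.eval mulmx_suml summxE; apply: eq_bigr => i _.
by rewrite -scalemxAl mxE.
Qed.

Lemma coord_vec_sum c p (u : 'rV[R]_d) :
  coord_vec c p u = \sum_i u ord0 i *: coord_vec c p (delta_mx ord0 i).
Proof.
rewrite /coord_vec {1}(matrix_sum_delta u) big_ord1 linear_sum.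
by apply: eq_bigr => i _; rewrite linearZ.
Qed.

Definition comp_in a c (i : 'I_d) : 'rV[R]_d -> R := eval_in a c (delta_mx ord0 i).

Lemma eval_inE a c u x : eval_in a c u x = \sum_i u ord0 i * comp_in a c i x.
Proof. by rewrite /eval_in coord_vec_sum eval_sum. Qed.

Lemma Ck_oneform_diff k a c i x : Ck_oneform k.+1 a -> atlas c -> chart_cod c x ->
  differentiable (comp_in a c i) x.
Proof. by move=> Ca ac cx; have [] := Ca _ ac (delta_mx ord0 i) => H _; exact: H. Qed.

Lemma Ck_oneform_C1 k a c i x : Ck_oneform k.+1 a -> atlas c -> chart_cod c x ->
  C1at (comp_in a c i) x.
Proof.
move=> Ca ac cx.
have H : Ck_on 1 (chart_cod c) (comp_in a c i).
  have := Ca _ ac (delta_mx ord0 i); rewrite -/(comp_in a c i).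
  by elim: k {Ca} => // k IH /Ck_onS; exact: IH.
exact: ((C1at_Ck _ (@chart_open_cod _ _ _ c)).1 H).
Qed.

Lemma eval_in_diff k a c u x : Ck_oneform k.+1 a -> atlas c -> chart_cod c x ->
  differentiable (eval_in a c u) x /\
  forall v, 'd (eval_in a c u) x v = \sum_i u ord0 i * 'd (comp_in a c i) x v.
Proof.
move=> Ca ac cx.
have -> : eval_in a c u = fun y => \sum_i cst (u ord0 i) y * comp_in a c i y.
  by apply/funext => y; exact: eval_inE.
have dB i : differentiable (comp_in a c i) x by exact: Ck_oneform_diff Ca ac cx.
have dA (i : 'I_d) : differentiable (cst (u ord0 i) : 'rV[R]_d -> R) x by [].
have [H1 H2] := diff_sum_prod dA dB; split=> // v.
rewrite H2; apply: eq_bigr => i _.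
by rewrite (diff_cst (u ord0 i) x) mul0r add0r.
Qed.

(** The exterior derivative in the coordinates of the chart [c]. *)
Definition ext_in a c (x u w : 'rV[R]_d) : R :=
  \sum_i (w ord0 i * 'd (comp_in a c i) x u - u ord0 i * 'd (comp_in a c i) x w).

Lemma ext_derivE k a p v w : Ck_oneform k.+1 a ->
  ext_deriv a p v w = ext_in a (chart_at p) (fwd (chart_at p) p) v w.
Proof.
move=> Ca; have ac := chart_at_atlas p; have cx := fwd_cod_at p.
have [d1 E1] := eval_in_diff v Ca ac cx; have [d2 E2] := eval_in_diff w Ca ac cx.
rewrite /ext_deriv /ext_in sumrB; congr (_ - _).
  by apply: (etrans (deriveE v d2)); exact: E2.
by apply: (etrans (deriveE w d1)); exact: E1.
Qed.

Lemma coord_vec_change c c' x u : atlas c -> atlas c' -> chart_cod c x ->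
  chart_dom c' (bwd c x) ->
  coord_vec c (bwd c x) u = coord_vec c' (bwd c x) ('d (fwd c' \o bwd c) x u).
Proof.
move=> ac ac' cx c'x.
have [_ <-] := C1M_chart ac' c'x (bwd_C1M ac cx).
by rewrite dM_bwd.
Qed.

Lemma comp_in_change a c c' x u : atlas c -> atlas c' -> chart_cod c x ->
  chart_dom c' (bwd c x) ->
  eval_in a c u x =
  \sum_j 'd (fwd c' \o bwd c) x u ord0 j * comp_in a c' j (fwd c' (bwd c x)).
Proof.
move=> ac ac' cx c'x; rewrite /eval_in (coord_vec_change u ac ac' cx c'x).
by rewrite coord_vec_sum eval_sum /comp_in /eval_in fwdK.
Qed.

(** The second derivatives of the transition map cancel by symmetry, which makes
    the exterior derivative independent of coordinates. *)
Lemma ext_in_change k a c c' x u w : Ck_oneform k.+1 a -> atlas c -> atlas c' ->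
  chart_cod c x -> chart_dom c' (bwd c x) ->
  ext_in a c x u w = ext_in a c' (fwd c' (bwd c x))
    ('d (fwd c' \o bwd c) x u) ('d (fwd c' \o bwd c) x w).
Proof.
move=> Ca ac ac' cx c'x; set th := fwd c' \o bwd c.
have [dth ddth] : Ck_on 2 [set x | chart_cod c x /\ chart_dom c' (bwd c x)] th.
  exact: (atlas_smooth ac ac' 2%N).
have Ux : [set x | chart_cod c x /\ chart_dom c' (bwd c x)] x by [].
have nU := near_open (@open_overlap _ _ _ c c') Ux.
have dth1 : \forall y \near x, differentiable th y by apply: filterS nU => y /dth.
have d2 v : differentiable (fun y => 'd th y v) x.
  by have [+ _] := ddth v; apply.
have cy : chart_cod c' (th x) by apply: fwd_cod.
have key v z : 'd (eval_in a c v) x z = \sum_j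
   ('d (fun y => 'd th y v) x z ord0 j * comp_in a c' j (th x) +
    'd th x v ord0 j * 'd (comp_in a c' j) (th x) ('d th x z)).
  have dA j : differentiable (fun y => 'd th y v ord0 j) x.
    by have [] := diff_coord j (d2 v).
  have dB0 j : differentiable (comp_in a c' j) (th x).
    exact: Ck_oneform_diff Ca ac' cy.
  have dB j : differentiable (comp_in a c' j \o th) x.
    exact: differentiable_comp (dth _ Ux) (dB0 j).
  have [d1 E1] := diff_sum_prod dA dB.
  have E : \forall y \near x, (fun y => \sum_i 'd th y v ord0 i *
      (comp_in a c' i \o th) y) y = eval_in a c v y.
    by apply: filterS nU => y [y1 y2]; rewrite (comp_in_change a v ac ac' y1 y2).
  have [_ dE] := near_eq_diff E d1.
  apply: (etrans (congr1 (fun h => h z) dE)); apply: (etrans (E1 z)).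
  apply: eq_bigr => j _; have [_ dj] := diff_coord j (d2 v).
  congr (_ * _ + _ * _); first exact: (dj z).
  exact: (congr1 (fun h => h z) (diff_comp (dth _ Ux) (dB0 j))).
have [_ Eu] := eval_in_diff u Ca ac cx; have [_ Ew] := eval_in_diff w Ca ac cx.
rewrite {1}/ext_in sumrB.
apply: (etrans (congr2 (fun s t => s - t) (etrans (esym (Ew u)) (key w u))
  (etrans (esym (Eu w)) (key u w)))).
rewrite -sumrB /ext_in; apply: eq_bigr => j _.
rewrite opprD addrACA -[RHS]add0r; congr (_ + _).
apply/eqP; rewrite subr_eq0; apply/eqP; congr (_ * _).
exact: (congr1 (fun v : 'rV[R]_d => v ord0 j) (schwarz_rV dth1 (d2 w) (d2 u))).
Qed.

Lemma ext_deriv_coord k a c x u w : Ck_oneform k.+1 a -> atlas c -> chart_cod c x ->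
  ext_deriv a (bwd c x) (coord_vec c (bwd c x) u) (coord_vec c (bwd c x) w) =
  ext_in a c x u w.
Proof.
move=> Ca ac cx; set p := bwd c x.
rewrite (ext_derivE _ _ _ Ca) (ext_in_change u w Ca ac (chart_at_atlas p) cx (chart_at_dom p)).
by rewrite /coord_vec /p bwdK.
Qed.

Lemma ext_in_linearl a c x w : linear (fun u => ext_in a c x u w : R).
Proof.
move=> r u v; rewrite /ext_in /GRing.scale/= mulr_sumr -big_split/=.
apply: eq_bigr => i _; rewrite linearP !mxE /GRing.scale/=; ring.
Qed.

Lemma ext_in_anti a c x u w : ext_in a c x u w = - ext_in a c x w u.
Proof. by rewrite /ext_in -sumrN; apply: eq_bigr => i _; rewrite opprB. Qed.

Lemma ext_in_linearr a c x u : linear (fun w => ext_in a c x u w : R).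
Proof.
move=> r v w; rewrite ext_in_anti ext_in_linearl [ext_in a c x u v]ext_in_anti.
by rewrite [ext_in a c x u w]ext_in_anti scalerN opprD.
Qed.

End one_forms.

(** * The contact volume *)

Lemma near_eq_continuous (T U : topologicalType) (f g : T -> U) (x : T) :
  (\forall y \near x, f y = g y) -> {for x, continuous f} -> {for x, continuous g}.
Proof.
move=> E cf; rewrite /prop_for /continuous_at -(nbhs_singleton E).
by apply: cvg_trans cf; apply: near_eq_cvg.
Qed.

Section contact_volume_theory.
Context {R : realType} {k : nat} {M : manifold R (k * 2).+1}.
Local Notation d := (k * 2).+1.
Implicit Types (a : oneform M).

Lemma kills_wedge_pow (V : lmodType R) (v0 : V) m (w : mform R V 2) :
  kills v0 w -> kills v0 (wedge_pow m w).
Proof.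
move=> kw; elim: m => [|m IH]; first by move=> v [].
exact: kills_wedge kw IH.
Qed.

Lemma multilinear_wedge_pow (V : lmodType R) m (w : mform R V 2) :
  multilinear w -> multilinear (wedge_pow m w).
Proof.
move=> lw; elim: m => [|m IH]; first by move=> v [].
exact: multilinear_wedge lw IH.
Qed.

Definition form1 a (p : M) : mform R 'rV[R]_d 1 := fun v => Defs.eval (a p) (v ord0).

Definition form2 a (p : M) : mform R 'rV[R]_d 2 :=
  fun v => ext_deriv a p (v ord0) (v ord_max).

Lemma contact_volumeE a p :
  contact_volume k a p = wedge (form1 a p) (wedge_pow k (form2 a p)).
Proof. by []. Qed.

Lemma multilinear_form1 a p : multilinear (form1 a p).
Proof.
move=> v i c x y; rewrite /form1 (ord1 i) /upd eqxx.
exact: eval_linear.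
Qed.

Lemma ext_deriv_linearl m a p w : Ck_oneform m.+1 a ->
  linear (fun u => ext_deriv a p u w : R).
Proof. by move=> Ca c x y; rewrite !(ext_derivE _ _ _ Ca) ext_in_linearl. Qed.

Lemma ext_deriv_anti m a p u w : Ck_oneform m.+1 a ->
  ext_deriv a p u w = - ext_deriv a p w u.
Proof. by move=> Ca; rewrite !(ext_derivE _ _ _ Ca) ext_in_anti. Qed.

Lemma ext_deriv_linearr m a p u : Ck_oneform m.+1 a ->
  linear (fun w => ext_deriv a p u w : R).
Proof. by move=> Ca c x y; rewrite !(ext_derivE _ _ _ Ca) ext_in_linearr. Qed.

Lemma multilinear_form2 m a p : Ck_oneform m.+1 a -> multilinear (form2 a p).
Proof.
move=> Ca v i c x y; rewrite /form2 /upd.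
have [->|->] : i = ord0 \/ i = ord_max.
  by case: i => -[|[|//]] Hi; [left|right]; exact/val_inj.
  by rewrite !eqxx; exact: ext_deriv_linearl Ca _ _ _.
by rewrite !eqxx; exact: ext_deriv_linearr Ca _ _ _.
Qed.

Lemma multilinear_contact_volume m a p : Ck_oneform m.+1 a ->
  multilinear (contact_volume k a p).
Proof.
move=> Ca; rewrite contact_volumeE; apply: multilinear_wedge.
  exact: multilinear_form1.
exact/multilinear_wedge_pow/(multilinear_form2 _ Ca).
Qed.

(** The kernel of alpha and that of d alpha meet in 0: a vector in both makes the
    contact volume vanish. *)
Lemma contact_kernel m a p v0 : Ck_oneform m.+1 a ->
  (exists v, contact_volume k a p v != 0) ->
  Defs.eval (a p) v0 = 0 -> (forall u, ext_deriv a p v0 u = 0) -> v0 = 0.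
Proof.
move=> Ca [v /eqP vol] e0 de0; apply/eqP/negPn/negP => v00; apply: vol.
apply: (top_form_kills (v0 := v0)) => //.
- exact: multilinear_contact_volume Ca.
- exact: (@alternating_wedge _ _ 1 (k * 2) (form1 a _) (wedge_pow k (form2 a _))).
apply: (@kills_wedge _ _ v0 1 (k * 2) (form1 a p) (wedge_pow k (form2 a p))).
  by move=> u i; rewrite (ord1 i) /form1 => ->.
apply: kills_wedge_pow => u i; rewrite /form2.
have [->|->] : i = ord0 \/ i = ord_max.
  by case: i => -[|[|//]] Hi; [left|right]; exact/val_inj.
  by move=> ->.
by move=> ->; rewrite (ext_deriv_anti _ _ _ Ca) de0 oppr0.
Qed.

Lemma coord_vec_span (c : chart R d M) p : atlas c -> chart_dom c p ->
  forall v : 'rV[R]_d, exists l : 'I_d -> R,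
    v = \sum_i l i *: coord_vec c p (delta_mx ord0 i).
Proof.
move=> ac cp v; rewrite -(coord_vecK v ac cp).
by eexists; exact: coord_vec_sum.
Qed.

Lemma volume_density_neq0 a (c : chart R d M) x : contact_form a -> atlas c ->
  chart_cod c x -> volume_density a c x != 0.
Proof.
move=> [Ca nz] ac cx; have [v /eqP nv] := nz (bwd c x).
apply/eqP => vd; apply: nv.
apply: (@top_form_basis _ _ _ (fun i => coord_vec c (bwd c x) (delta_mx ord0 i))).
- exact: multilinear_contact_volume Ca.
- exact: (@alternating_wedge _ _ 1 (k * 2) (form1 a _) (wedge_pow k (form2 a _))).
- by move=> t u; exact: wedge_perm.
- by apply: coord_vec_span => //; exact: bwd_dom.
- exact: vd.
Qed.

(** Continuity of a field of forms is tested on the vectors of a moving frame,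
    because the tangent spaces vary with the base point. *)
Let cont_on (T : topologicalType) (x : T) (b : T -> 'I_d -> 'rV[R]_d) p
    (W : T -> mform R 'rV[R]_d p) :=
  forall s : 'I_p -> 'I_d, {for x, continuous (fun y => W y (fun i => b y (s i)))}.

Let cont_wedge (T : topologicalType) (x : T) b p q (W : T -> mform R 'rV[R]_d p)
    (Z : T -> mform R 'rV[R]_d q) :
  cont_on x b W -> cont_on x b Z -> cont_on x b (fun y => wedge (W y) (Z y)).
Proof.
move=> cW cZ s; rewrite /wedge; rewrite /prop_for /continuous_at.
apply: cvgM; first exact: cvg_cst.
have H : forall l : seq 'S_(p + q),
    (fun y => \sum_(t <- l) (-1) ^+ t *
      W y (fun i => b y (s (t (lshift q i)))) *
      Z y (fun j => b y (s (t (rshift p j))))) @ x -->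
    \sum_(t <- l) (-1) ^+ t *
      W x (fun i => b x (s (t (lshift q i)))) *
      Z x (fun j => b x (s (t (rshift p j)))).
  elim=> [|t l IH].
    rewrite big_nil (_ : (fun y => _) = cst 0); first exact: cvg_cst.
    by apply/funext => y; rewrite big_nil.
  rewrite big_cons (_ : (fun y => _) = (fun y => (-1) ^+ t *
      W y (fun i => b y (s (t (lshift q i)))) *
      Z y (fun j => b y (s (t (rshift p j)))) + \sum_(t <- l) (-1) ^+ t *
      W y (fun i => b y (s (t (lshift q i)))) *
      Z y (fun j => b y (s (t (rshift p j)))))); last first.
    by apply/funext => y; rewrite big_cons.
  apply: cvgD; last exact: IH.
  apply: cvgM; last exact: (cZ (fun j => s (t (rshift p j)))).
  apply: cvgM; first exact: cvg_cst.
  exact: (cW (fun j => s (t (lshift q j)))).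
exact: H.
Qed.

Let cont_wedge_pow (T : topologicalType) (x : T) b m (W : T -> mform R 'rV[R]_d 2) :
  cont_on x b W -> cont_on x b (fun y => wedge_pow m (W y)).
Proof.
move=> cW; elim: m => [|m IH]; first by move=> s; exact: cst_continuous.
exact: cont_wedge cW IH.
Qed.

Lemma volume_density_cont m a (c : chart R d M) x : Ck_oneform m.+1 a -> atlas c ->
  chart_cod c x -> {for x, continuous (volume_density a c)}.
Proof.
move=> Ca ac cx.
pose b y i : 'rV[R]_d := coord_vec c (bwd c y) (delta_mx ord0 i).
have c1 : cont_on x b (fun y => form1 a (bwd c y)).
  by move=> s; exact/C1at_cont/(Ck_oneform_C1 _ Ca ac cx).
have c2 : cont_on x b (fun y => form2 a (bwd c y)).
  move=> s; rewrite /form2.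
  have E : \forall y \near x, ext_in a c y (delta_mx ord0 (s ord0)) (delta_mx ord0 (s ord_max))
     = ext_deriv a (bwd c y) (b y (s ord0)) (b y (s ord_max)).
    apply: filterS (near_open (@chart_open_cod _ _ _ c) cx) => y cy.
    by rewrite (ext_deriv_coord _ _ Ca ac cy).
  apply: (near_eq_continuous E); apply: continuous_sum => i.
  have cc (r : R) v : {for x, continuous (fun y => r * 'd (comp_in a c i) y v)}.
    have h := C1at_dcont (Ck_oneform_C1 i Ca ac cx) v.
    by apply: (cvgM (cvg_cst r) h).
  exact: cvgB (cc _ _) (cc _ _).
have H := @cont_wedge _ x b 1 (k * 2) _ _ c1 (@cont_wedge_pow _ x b k _ c2)
  (fun i : 'I_(1 + k * 2) => (i : 'I_d)).
rewrite (_ : volume_density a c = fun y =>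
  wedge (form1 a (bwd c y)) (wedge_pow k (form2 a (bwd c y))) (b y)) //.
Qed.

Lemma eval_scale (r : R) (m : 'cV[R]_d) v : Defs.eval (r *: m) v = r * Defs.eval m v.
Proof. by rewrite /Defs.eval -scalemxAr mxE. Qed.

Lemma eval_in_scale (r : R) a c u :
  eval_in (fun p => r *: a p) c u = fun x => r * eval_in a c u x.
Proof. by apply/funext => x; rewrite /eval_in eval_scale. Qed.

Lemma Ck_on_scale (V : normedModType R) m (U : set V) (f : V -> R) (r : R) :
  open U -> Ck_on m U f -> Ck_on m U (fun x => r * f x).
Proof.
move=> oU; elim: m f => [|m IH] f.
  move=> cf x Ux; have := cf x Ux; rewrite /prop_for /continuous_at => cfx.
  by apply: cvgM => //; exact: cvg_cst.
move=> [df Cf]; split=> [x Ux|v]; first exact: (differentiableZ r (df x Ux)).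
apply: (Ck_on_ext oU _ (IH _ (Cf v))) => x Ux.
exact: (esym (congr1 (fun h => h v) (diffZ r (df x Ux)))).
Qed.

Lemma ext_deriv_scale m (r : R) a p u w : Ck_oneform m.+1 a ->
  ext_deriv (fun p => r *: a p) p u w = r * ext_deriv a p u w.
Proof.
move=> Ca; rewrite /ext_deriv !eval_in_scale.
have ac := chart_at_atlas p; have cx := fwd_cod_at p.
have [d1 _] := eval_in_diff u Ca ac cx; have [d2 _] := eval_in_diff w Ca ac cx.
rewrite mulrBr; congr (_ - _).
  exact: (deriveZ r (diff_derivable d2)).
exact: (deriveZ r (diff_derivable d1)).
Qed.

Lemma wedge_scale (V : Type) p q (r s : R) (w : mform R V p) (z : mform R V q) v :
  wedge (fun v => r * w v) (fun v => s * z v) v = r * s * wedge w z v.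
Proof.
rewrite /wedge [RHS]mulrCA; congr (_ * _); rewrite mulr_sumr.
have E (e A B : R) : e * (r * A) * (s * B) = r * s * (e * A * B) by ring.
by apply: eq_bigr => t _; exact: E.
Qed.

Lemma wedge_pow_scale (V : Type) m (r : R) (w : mform R V 2) v :
  wedge_pow m (fun v => r * w v) v = r ^+ m * wedge_pow m w v.
Proof.
elim: m v => [|m IH] v; first by rewrite expr0 mul1r.
rewrite exprS /= -wedge_scale; congr (wedge _ _ _).
by apply/funext.
Qed.

(** The volume alpha /\ (d alpha)^k is homogeneous of degree k + 1. *)
Lemma contact_form_scale (r : R) a : r != 0 -> contact_form a ->
  contact_form (fun p => r *: a p).
Proof.
move=> r0 [Ca nz]; split.
  move=> c ac u; rewrite eval_in_scale.
  by apply: Ck_on_scale; [exact: chart_open_cod|exact: Ca].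
move=> p; have [v nv] := nz p; exists v.
have -> : contact_volume k (fun p => r *: a p) p v =
    r * r ^+ k * contact_volume k a p v.
  rewrite [in RHS]contact_volumeE -wedge_scale contact_volumeE.
  congr (wedge _ _ _).
    by apply/funext => u; rewrite /form1 eval_scale.
  apply/funext => u; rewrite -wedge_pow_scale; congr (wedge_pow _ _ _).
  by apply/funext => z; rewrite /form2 (ext_deriv_scale _ _ _ _ Ca).
by apply: mulf_neq0; [apply: mulf_neq0; [exact: r0|exact: expf_neq0]|exact: nv].
Qed.

End contact_volume_theory.

Section volume_null_sets.
Context {R : realType} {k : nat} {M : manifold R (k * 2).+1}.
Local Notation d := (k * 2).+1.
Local Notation tup n := (n.-tuple (measurableTypeR R)).

Lemma borel_open (U : set M) : open U -> measurable (U : set (borelM M)).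
Proof. by move=> oU; apply: sub_sigma_algebra. Qed.

Lemma borel_closed (A : set M) : closed A -> measurable (A : set (borelM M)).
Proof.
move=> cA; rewrite -[A]setCK.
by apply: measurableC; apply: borel_open; exact: closed_openC.
Qed.

Lemma measurable_chart (c : chart R d M) (A : set (borelM M)) : measurable A ->
  measurable (@rV_of_tuple R d @^-1` (chart_cod c `&` bwd c @^-1` A)).
Proof.
move=> mA; pose D : set (tup d) := @rV_of_tuple R d @^-1` chart_cod c.
have mD : measurable D by apply: open_measurable_tuple; exact: chart_open_cod.
have mf : measurable_fun D (bwd c \o @rV_of_tuple R d : tup d -> borelM M).
  apply: (measurability (rT := borelM M) (@open M) erefl) => _ [U oU <-].
  apply: (open_measurable_tuple (U := chart_cod c `&` bwd c @^-1` U)).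
  apply: open_preimage_within => //; first exact: chart_open_cod.
  by move=> x; exact: bwd_continuous.
exact: mf.
Qed.

Lemma measurable_density m (a : oneform M) (c : chart R d M) : Ck_oneform m.+1 a ->
  atlas c ->
  measurable_fun (@rV_of_tuple R d @^-1` chart_cod c)
    (fun t : tup d => volume_density a c (rV_of_tuple t)).
Proof.
move=> Ca ac; apply: (measurability _ (RGenOpens.measurableE R)) => _ [_ [r [s ->]] <-].
apply: (open_measurable_tuple (U := chart_cod c `&` volume_density a c @^-1` `]r, s[)).
apply: open_preimage_within; last exact: interval_open.
  exact: chart_open_cod.
by move=> x; exact: (volume_density_cont Ca ac).
Qed.

(** In a chart the volume has a continuous density without zeros. *)
Lemma volume_null (a : oneform M) (vol : {measure set (borelM M) -> \bar R})
    (c : chart R d M) (A : set (borelM M)) :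
  contact_form a -> is_volume a vol -> atlas c -> measurable A -> vol A = 0%E ->
  lebesgue_null (chart_cod c `&` bwd c @^-1` A).
Proof.
move=> Ca hvol ac mA A0.
pose A' : set (borelM M) := A `&` chart_dom c.
have mA' : measurable A' by apply: measurableI => //; apply: borel_open; exact: chart_open_dom.
have A'0 : vol A' = 0%E by apply: (subset_measure0 mA' mA) => //; exact: subIsetl.
pose D : set (tup d) := @rV_of_tuple R d @^-1` (chart_cod c `&` bwd c @^-1` A').
have mD : measurable D by exact: measurable_chart.
have := hvol c A' ac mA' (@subIsetr _ _ _); rewrite A'0 => /esym int0.
have mf : measurable_fun D (EFin \o (fun t : tup d => volume_density a c (rV_of_tuple t))).
  apply/measurable_EFinP; apply: (measurable_funS _ _ (measurable_density Ca.1 ac)).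
    by apply: open_measurable_tuple; exact: chart_open_cod.
  by move=> t [].
have [N [mN N0 HN]] : ae_eq (lebesgue_tuple R d) D
    (EFin \o (fun t : tup d => volume_density a c (rV_of_tuple t))) (cst 0%E).
  by apply/(ae_eq_integral_abs _ mD mf).
exists N; split=> // t [ct At]; apply: HN => /= H.
have cAt : A' (bwd c (rV_of_tuple t)) by split=> //; exact: bwd_dom.
have := H (conj ct cAt) => -[] /eqP; apply/negP.
exact: volume_density_neq0.
Qed.

End volume_null_sets.

(** * Local flows *)

Section local_flows.
Context {R : realType} {d : nat} {M : manifold R d}.
Context {B : set M} {D : set (R * M)} {Tl : R -> M -> M} (lf : local_flow B D Tl).
Implicit Types (V : normedModType R) (c : chart R d M).

Definition flow_in c : R * 'rV[R]_d -> M := fun z => Tl z.1 (bwd c z.2).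

Lemma lf0 w : B w -> D (0, w) /\ Tl 0 w = w.
Proof. by case: lf => _ _ [H _ _] _ _; exact: H. Qed.

Lemma lfB t w : D (t, w) -> B w /\ B (Tl t w).
Proof. by case: lf => _ _ [_ H _] _ _; exact: H. Qed.

Lemma lf_open : open D.
Proof. by case: lf. Qed.

Lemma lfN t w : D (t, w) -> D (- t, Tl t w).
Proof. by case: lf => _ _ _ [H _] _; exact: H. Qed.

Lemma lfD s t w : D (t, w) -> D (s, Tl t w) -> D (s + t, w) /\ Tl (s + t) w = Tl s (Tl t w).
Proof. by case: lf => _ _ _ [_ H] _; exact: H. Qed.

Lemma lfK t w : D (t, w) -> Tl (- t) (Tl t w) = w.
Proof.
move=> Dt; have [_] := lfD Dt (lfN Dt); rewrite addNr => <-.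
by have [] := lf0 (lfB Dt).1.
Qed.

Lemma open_flow_dom c :
  open [set z : R * 'rV[R]_d | chart_cod c z.2 /\ D (z.1, bwd c z.2)].
Proof.
apply: (open_preimage_within (f := fun z : R * 'rV[R]_d => (z.1, bwd c z.2)) (B := D)
  (A := [set z | chart_cod c z.2])).
- rewrite (_ : [set z | _] = snd @^-1` chart_cod c) //.
  apply: open_comp => [z _|]; first exact: cvg_snd.
  exact: chart_open_cod.
- move=> z cz; apply: continuous_pair; first exact: cvg_fst.
  by apply: (@continuous_comp _ _ _ snd (bwd c)); [exact: cvg_snd|exact: bwd_continuous].
- exact: lf_open.
Qed.

Lemma flow_in_C2 c : atlas c -> Ck_to 2
  [set z : R * 'rV[R]_d | chart_cod c z.2 /\ D (z.1, bwd c z.2)] (flow_in c).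
Proof. by case: lf => _ _ _ _ H; exact: H. Qed.

Lemma flow_in_C1M c t x : atlas c -> chart_cod c x -> D (t, bwd c x) ->
  C1M (flow_in c) (t, x).
Proof.
by move=> ac cx Dt; apply: (Ck_to_C1M (@open_flow_dom c) (flow_in_C2 ac)).
Qed.

Lemma fdim_RV : fdim (R * 'rV[R]_d)%type.
Proof. by apply: fdim_prod; [exact: fdim_R|exact: fdim_rV]. Qed.

(** The chain rule when the time and the initial point depend on a parameter. *)
Lemma flow_comp V (s : V -> R) (Q : V -> M) x c : atlas c -> chart_dom c (Q x) ->
  C1at s x -> C1M Q x -> D (s x, Q x) ->
  C1M (fun y => Tl (s y) (Q y)) x /\ forall v, dM (fun y => Tl (s y) (Q y)) x v =
    dM (flow_in c) (s x, fwd c (Q x)) ('d s x v, 'd (fwd c \o Q) x v).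
Proof.
move=> ac cQ Cs CQ Dx.
have [CcQ _] := C1M_chart ac cQ CQ.
have Cp : C1at (fun y => (s y, (fwd c \o Q) y)) x by exact: C1at_pair.
have CF : C1M (flow_in c) (s x, fwd c (Q x)).
  by apply: flow_in_C1M; rewrite ?fwdK //; exact: fwd_cod.
have [C1 E1] := C1M_comp fdim_RV Cp CF.
have E : \forall y \near x,
    (flow_in c \o (fun y => (s y, (fwd c \o Q) y))) y = Tl (s y) (Q y).
  apply: filterS (near_dom (C1M_cont CQ) cQ) => y cy.
  by rewrite /flow_in /= fwdK.
have [H1 H2] := near_eq_C1M E C1; split; first exact: H1.
move=> v; rewrite H2 E1; congr (dM _ _ _).
exact: (congr1 (fun h => h v) (diff_pair (C1at_diff Cs) (C1at_diff CcQ))).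
Qed.

Lemma flow_map t w : D (t, w) -> C1map (Tl t) w.
Proof.
move=> Dt.
have Dt' : D (t, bwd (chart_at w) (fwd (chart_at w) w)) by rewrite bwd_fwd_at.
have cw : chart_dom (chart_at w) (bwd (chart_at w) (fwd (chart_at w) w)).
  by rewrite bwd_fwd_at; exact: chart_at_dom.
by have [] := @flow_comp _ (cst t) (bwd (chart_at w)) (fwd (chart_at w) w)
  (chart_at w) (chart_at_atlas w) cw (C1at_cst _ _)
  (bwd_C1M (chart_at_atlas w) (fwd_cod_at w)) Dt'.
Qed.

Lemma C1M_cst V (p : M) (x : V) : C1M (cst p : V -> M) x.
Proof.
split; first exact: cst_continuous.
exact: (C1at_cst (fwd (chart_at p) p) x).
Qed.

Lemma flow_orbit t w : D (t, w) -> C1M (Tl^~ w) t.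
Proof.
move=> Dt.
by have [] := @flow_comp _ id (cst w) t (chart_at w) (chart_at_atlas w)
  (chart_at_dom w) (C1at_id _) (C1M_cst _ _) Dt.
Qed.

Lemma near_flow_dom (T : topologicalType) (s : T -> R) (Q : T -> M) x :
  {for x, continuous s} -> {for x, continuous Q} -> D (s x, Q x) ->
  \forall y \near x, D (s y, Q y).
Proof.
by move=> cs cQ Dx; exact: (near_continuous2 cs cQ (near_open lf_open Dx)).
Qed.

(** Differentiate Tl_t (Tl_s w) = Tl_(s + t) w at s = 0. *)
Lemma flow_velocity t w : D (t, w) ->
  dM (Tl^~ w) t 1 = mdiff (Tl t) w (dM (Tl^~ w) 0 1).
Proof.
move=> Dt; have [D0 T0] := lf0 (lfB Dt).1.
have C0 := flow_orbit D0.
have Ct : C1map (Tl t) (Tl 0 w) by rewrite T0; exact: flow_map.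
have [_ E] := C1map_comp C0 Ct; rewrite T0 in E; rewrite -E.
have Ds : C1at (fun s : R => s + t) 0.
  exact: (C1atD (C1at_id _) (C1at_cst _ _)).
have Dt' : C1M (Tl^~ w) (0 + t) by rewrite add0r; exact: flow_orbit.
have [C1 E1] := C1M_comp (@fdim_R R) Ds Dt'.
have dshift : 'd (fun s : R => s + t) 0 1 = 1 :> R.
  have : 'd (id \+ cst t : R -> R) 0 1 = 1.
    apply: (etrans (congr1 (fun h => h 1) (diffD (C1at_diff (C1at_id (0 : R))) (C1at_diff (C1at_cst t (0 : R)))))).
    rewrite /= (congr1 (fun h => h 1) (diff_cst t (0 : R))) addr0.
    exact: diff_idE.
  by [].
have E2 := E1 1; rewrite dshift add0r in E2; rewrite -E2.
have NE : \forall s \near (0 : R), (Tl t \o Tl^~ w) s = (Tl^~ w \o (fun s : R => s + t)) s.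
  have N2 : \forall s \near (0 : R), D (s, w).
    apply: (near_flow_dom (s := id) (Q := cst w)).
    - exact: cvg_id.
    - exact: cst_continuous.
    - exact: D0.
  have N3 : \forall s \near (0 : R), D (t, Tl s w).
    apply: (near_flow_dom (s := cst t) (Q := Tl^~ w)).
    - exact: cst_continuous.
    - exact: C1M_cont C0.
    - by rewrite T0.
  apply: filterS2 N2 N3 => s s2 s3 /=.
  have [_ <-] := lfD s2 s3.
  by rewrite addrC.
have [C2 _] := C1map_comp C0 Ct.
have [_ ->] := near_eq_C1M NE C2.
by [].
Qed.

End local_flows.

(** * Hypersurfaces *)

Section transversality.
Context {R : realType} {d : nat} {M : manifold R d}.

Lemma affine_C1at (V W : normedModType R) (w0 : W) (L : V -> W) x : linear L ->
  continuous L -> C1at (fun y => w0 + L y) x /\ 'd (fun y => w0 + L y) x = L :> (V -> W).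
Proof.
move=> lL cL; have [C E] := C1at_linear x lL cL.
have C0 : C1at (cst w0 : V -> W) x by exact: C1at_cst.
split; first exact: (C1atD C0 C).
apply: (etrans (diffD (C1at_diff C0) (C1at_diff C))).
apply/funext => v; rewrite /= E (congr1 (fun h => h v) (diff_cst w0 x)).
exact: add0r.
Qed.

Lemma C1at_coord (V : normedModType R) m (f : V -> 'rV[R]_m) x (l : 'I_m) :
  C1at f x -> C1at (fun y => f y ord0 l) x.
Proof.
move=> C.
have lc : linear (fun v : 'rV[R]_m => v ord0 l) by move=> a v w; rewrite !mxE.
have cc : continuous (fun v : 'rV[R]_m => v ord0 l) by exact: coord_continuous.
have [Cc _] := C1at_linear (f x) lc cc.
exact: (C1at_comp (@fdim_rV R m) C Cc).
Qed.

Lemma coord_vec_at (p : M) u : coord_vec (chart_at p) p u = u.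
Proof.
rewrite /coord_vec.
have E : \forall y \near fwd (chart_at p) p,
    id y = (fwd (chart_at p) \o bwd (chart_at p)) y.
  apply: filterS (near_open (@chart_open_cod _ _ _ (chart_at p)) (fwd_cod_at p)) => y cy /=.
  by rewrite bwdK.
have [_ dE] := near_eq_diff E (C1at_diff (C1at_id _)).
apply: (etrans (congr1 (fun h => h u) dE)).
exact: diff_idE.
Qed.

(** The defining function of a hypersurface, read in the chart [c]. *)
Definition lev (g : M -> 'rV[R]_1) (c : chart R d M) (y : 'rV[R]_d) : R :=
  g (bwd c y) ord0 ord0.

Lemma lev_C1at (U : set M) g (c : chart R d M) y : open U -> Ck_fun 2 U g ->
  atlas c -> chart_cod c y -> U (bwd c y) ->
  C1at (lev g c) y /\ forall u, 'd (lev g c) y u = 'd (g \o bwd c) y u ord0 ord0.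
Proof.
move=> oU Cg ac cy Uy.
have oN : open (chart_cod c `&` bwd c @^-1` U).
  apply: open_preimage_within => //; first exact: chart_open_cod.
  by move=> z; exact: bwd_continuous.
have C : C1at (g \o bwd c) y.
  by apply: ((C1at_Ck _ oN).1 (Ck_onS (Cg _ ac))); split.
have [_ E] := diff_coord ord0 (C1at_diff C); split; last exact: E.
exact: (C1at_coord ord0 C).
Qed.

(** The straight line of direction [V] in a chart is corrected along a direction
    [e] transverse to the hypersurface; the implicit function theorem gives a
    correction whose derivative vanishes at 0. *)
Lemma kernel_tangent (S U : set M) (g : M -> 'rV[R]_1) (p : M) (V : tangent R d) :
  open U -> U p -> S p -> Ck_fun 2 U g -> (forall q, U q -> (S q <-> g q = 0)) ->
  (exists e, 'd (lev g (chart_at p)) (fwd (chart_at p) p) e != 0) ->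
  'd (lev g (chart_at p)) (fwd (chart_at p) p) V = 0 -> tangent_to S p V.
Proof.
move=> oU Up Sp Cg Sg [e de] dV; set c := chart_at p in de dV *.
set x0 := fwd c p in de dV *; have cx0 : chart_cod c x0 by exact: fwd_cod_at.
have bx0 : bwd c x0 = p by exact: bwd_fwd_at.
pose L (z : R * R) : 'rV[R]_d := z.2 *: (V : 'rV[R]_d) + z.1 *: e.
have lL : linear L.
  move=> a z w; rewrite /L /= scalerDr !scalerDl !scalerA addrACA.
  by rewrite [a *: z.2]/GRing.scale/= [a *: z.1]/GRing.scale/=.
have cL : continuous L.
  move=> z; rewrite /continuous_at /L; apply: cvgD.
    by apply: cvgZr_tmp; exact: cvg_snd.
  by apply: cvgZr_tmp; exact: cvg_fst.
(* the parameters are the size of the correction along e and the time *)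
pose A z := x0 + L z.
have A0 : A (0, 0) = x0 by rewrite /A /L /= !scale0r !addr0.
have CA z : C1at A z /\ 'd A z = L :> (R * R -> 'rV[R]_d) by exact: affine_C1at.
pose N := [set y | chart_cod c y /\ U (bwd c y)].
have oN : open N.
  apply: (open_preimage_within (f := bwd c) (B := U)) => //; first exact: chart_open_cod.
  by move=> z; exact: bwd_continuous.
have Nx0 : N x0 by split=> //; rewrite bx0.
have nearN : \forall z \near (0 : R, 0 : R), N (A z).
  apply: (near_continuous (f := A) (C1at_cont (CA _).1)).
  by rewrite A0; exact: near_open.
have Ch y : N y -> C1at (lev g c) y.
  by move=> [cy Uy]; have [] := lev_C1at oU Cg (chart_at_atlas p) cy Uy.
pose G z := lev g c (A z).
have CG : \forall z \near (0 : R, 0 : R), C1at G z.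
  by apply: filterS nearN => z Nz; exact: (C1at_comp (@fdim_rV R d) (CA z).1 (Ch _ Nz)).
have dG z : N (A z) -> forall w, 'd G z w = 'd (lev g c) (A z) (L w).
  move=> Nz w.
  apply: (etrans (congr1 (fun h => h w) (diff_comp (C1at_diff (CA z).1) (C1at_diff (Ch _ Nz))))).
  by rewrite /= (CA z).2.
have NA0 : N (A (0, 0)) by rewrite A0.
have G0 : G (0, 0) = 0.
  by rewrite /G A0 /lev bx0 ((Sg p Up).1 Sp) mxE.
have dG1 : 'd G (0, 0) (1, 0) != 0.
  by rewrite (dG _ NA0) A0 /L /= scale0r add0r scale1r.
have dG2 : 'd G (0, 0) (0, 1) = 0.
  by rewrite (dG _ NA0) A0 /L /= scale0r addr0 scale1r.
have [th [th0 Hth]] := implicit_function CG G0 dG1.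
have [_ Cth dth] := nbhs_singleton Hth.
have dth1 : 'd th 0 1 = 0 by rewrite dth th0 dG2 oppr0 mul0r.
have Cp : C1at (fun t : R => (th t, t)) 0 by apply: C1at_pair => //; exact: C1at_id.
have p0 : (th 0, 0) = (0, 0) :> R * R by rewrite th0.
have CAp : C1at A (th 0, 0) by exact: (CA _).1.
have CAth := C1at_comp (fdim_prod (@fdim_R R) (@fdim_R R)) Cp CAp.
have dAth : 'd (A \o (fun t : R => (th t, t))) 0 1 = V.
  apply: (etrans (congr1 (fun h => h 1) (diff_comp (C1at_diff Cp) (C1at_diff CAp)))).
  rewrite /= (CA _).2.
  have -> : 'd (fun t : R => (th t, t)) 0 1 = (0, 1) :> R * R.
    apply: (etrans (congr1 (fun h => h 1) (diff_pair (C1at_diff Cth) (C1at_diff (C1at_id (0 : R)))))).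
    rewrite dth1; congr pair.
    exact: diff_idE.
  by rewrite /L /= scale1r scale0r addr0.
have Cb : C1M (bwd c) ((A \o (fun t : R => (th t, t))) 0).
  by apply: bwd_C1M; [exact: chart_at_atlas|rewrite /= th0 A0].
have [Cgam Egam] := C1M_comp (@fdim_rV R d) CAth Cb.
exists (bwd c \o (A \o (fun t : R => (th t, t)))).
have gam0 : (bwd c \o (A \o (fun t : R => (th t, t)))) 0 = p.
  by rewrite /= th0 A0.
split; first exact: gam0.
  have cth : {for 0, continuous (fun t : R => (th t, t))} by exact: C1at_cont Cp.
  have N1 : \forall t \near (0 : R), N (A (th t, t)).
    apply: (near_continuous (f := fun t : R => (th t, t)) (A := [set z | N (A z)]) cth).
    by rewrite p0.
  apply: filterS2 N1 Hth => t [_ Ut] [Gt _ _].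
  apply: (Sg _ Ut).2; apply/rowP => j; rewrite (ord1 j) mxE; exact: Gt.
have := C1M_velocity Cgam; rewrite Egam dAth /= th0 A0.
by rewrite dM_bwd// bx0 coord_vec_at.
Qed.

Lemma smooth_norm_ge0 (N : M -> tangent R d -> R) p v : smooth_norm N -> 0 <= N p v.
Proof.
move=> [_ tri hom _].
have N0 : N p 0 = 0 by have := hom p 0 0; rewrite scale0r normr0 mul0r.
have := tri p v (- v); rewrite subrr N0 -scaleN1r hom normrN1 mul1r.
by rewrite -mulr2n pmulrn_lge0.
Qed.

End transversality.

(** * Time translation *)

Section flow_shift.
Context {R : realType} {d : nat} {M : manifold R d}.
Context {B : set M} {D : set (R * M)} {Tl : R -> M -> M} (lf : local_flow B D Tl).

Lemma flow_shift t w : D (t, w) -> dM (Tl^~ (Tl t w)) 0 1 = dM (Tl^~ w) t 1.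
Proof.
move=> Dt.
have lL : linear (id : R -> R) by [].
have cL : continuous (id : R -> R) by move=> x; exact: cvg_id.
have [C E] := affine_C1at t (0 : R) lL cL.
have Dt' : C1M (Tl^~ w) (t + 0) by rewrite addr0; exact: (flow_orbit lf).
have [C1 E1] := C1M_comp (@fdim_R R) C Dt'.
have NE : \forall s \near (0 : R),
    (Tl^~ w \o (fun s : R => t + s)) s = (Tl ^~ (Tl t w)) s.
  have N2 : \forall s \near (0 : R), D (s, Tl t w).
    apply: (near_flow_dom lf (s := id) (Q := cst (Tl t w))).
    - exact: cvg_id.
    - exact: cst_continuous.
    - by have [] := lf0 lf (lfB lf Dt).2.
  apply: filterS N2 => s Ds /=.
  by have [_ <-] := lfD lf Dt Ds; rewrite addrC.
have [_ E2] := near_eq_C1M NE C1.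
by rewrite E2 E1 E addr0.
Qed.

End flow_shift.

(** * Neighbourhoods and charts *)

Lemma near_lt (R : realType) (S : topologicalType) (f g : S -> R) x :
  {for x, continuous f} -> {for x, continuous g} -> f x < g x ->
  \forall y \near x, f y < g y.
Proof.
move=> cf cg fg.
have C : {for x, continuous (fun y => g y - f y)}.
  by rewrite /prop_for /continuous_at; apply: cvgB; [exact: cg|exact: cf].
have p0 : 0 < g x - f x by rewrite subr_gt0.
have H : \forall y \near x, [set r : R | 0 < r] (g y - f y).
  by apply: (near_continuous C); exact: lt_nbhsr.
by apply: filterS H => y /=; rewrite subr_gt0.
Qed.

Lemma half_itv (R : realType) (a : R) : 0 < a -> 0 < a / 2 < a.
Proof. by move=> a0; rewrite divr_gt0 //= ltr_pdivrMr // ltr_pMr // ltr1n. Qed.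

Lemma near_neq (R : realType) (S : topologicalType) (f g : S -> R) x :
  {for x, continuous f} -> {for x, continuous g} -> f x != g x ->
  \forall y \near x, f y != g y.
Proof.
move=> cf cg fg.
have C : {for x, continuous (fun y => f y - g y)}.
  by rewrite /prop_for /continuous_at; apply: cvgB; [exact: cf|exact: cg].
have n0 : f x - g x != 0 by rewrite subr_eq0.
by apply: filterS (near_neq0 C n0) => y; rewrite subr_eq0.
Qed.

Lemma near_chart (R : realType) (d : nat) (M : manifold R d) (c : chart R d M) (w0 : M)
    (Q : 'rV[R]_d -> Prop) : chart_dom c w0 ->
  (\forall x \near fwd c w0, Q x) -> \forall w \near w0, chart_dom c w /\ Q (fwd c w).
Proof.
move=> cw NQ.
have N1 : \forall w \near w0, chart_dom c w.
  by apply: near_open => //; exact: chart_open_dom.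
have N2 : \forall w \near w0, Q (fwd c w).
  exact: (near_continuous (fwd_continuous cw) NQ).
by apply: filterS2 N1 N2.
Qed.

Lemma near_chart_cod (R : realType) (d : nat) (M : manifold R d) (c : chart R d M) (w0 : M)
    (Q : M -> Prop) : chart_dom c w0 ->
  (\forall w \near w0, Q w) ->
  \forall x \near fwd c w0, chart_cod c x /\ Q (bwd c x).
Proof.
move=> cw NQ; have cx := fwd_cod cw.
have N1 : \forall x \near fwd c w0, chart_cod c x.
  by apply: near_open => //; exact: chart_open_cod.
have N2 : \forall x \near fwd c w0, Q (bwd c x).
  by apply: (near_continuous (bwd_continuous cx)); rewrite fwdK.
by apply: filterS2 N1 N2.
Qed.

Lemma pair_cont (R : realType) (V : normedModType R) (t : R) (x : V) :
  {for x, continuous (fun y => (t, y))}.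
Proof. by apply: C1at_cont; apply: C1at_pair; [exact: C1at_cst|exact: C1at_id]. Qed.

Lemma coord_cont (R : realType) (S : topologicalType) (d : nat) (f : S -> 'rV[R]_d) x l :
  {for x, continuous f} -> {for x, continuous (fun y => f y ord0 l)}.
Proof.
move=> cf; apply: (@continuous_comp _ _ _ f (fun v => v ord0 l)) => //.
exact: coord_continuous.
Qed.

(** * Coordinate hyperplanes *)

Section ins_row_calculus.
Context {R : realType} {n : nat}.

Lemma ins_row_sum (i : 'I_n.+1) (y : 'rV[R]_n) :
  ins_row i 0 y = \sum_j y ord0 j *: delta_mx ord0 (lift i j).
Proof.
apply/rowP => l; rewrite summxE mxE; case: unliftP => [j ->|->].
  rewrite (bigD1 j) //= !mxE !eqxx mulr1 big1 ?addr0 // => k kj.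
  by rewrite !mxE (inj_eq lift_inj) [j == k]eq_sym (negbTE kj) andbF mulr0.
by rewrite big1 // => k _; rewrite !mxE (negbTE (neq_lift _ _)) andbF mulr0.
Qed.

Lemma ins_row_C1at (i : 'I_n.+1) a y :
  C1at (ins_row i a) y /\ 'd (ins_row i a) y = ins_row i 0 :> ('rV[R]_n -> 'rV[R]_n.+1).
Proof.
have lL : linear (ins_row i 0 : 'rV[R]_n -> 'rV[R]_n.+1).
  move=> b u v; apply/rowP => l; rewrite !mxE.
  by case: (unlift i l) => [j|]; rewrite ?mxE ?mulr0 ?addr0.
have cL : continuous (ins_row i 0 : 'rV[R]_n -> 'rV[R]_n.+1).
  move=> u; rewrite (funext (ins_row_sum i)).
  apply: continuous_sum => j.
  have H : {for u, continuous (fun z : 'rV[R]_n => z ord0 j)}.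
    exact: coord_continuous.
  apply: (@continuous_comp _ _ _ (fun z : 'rV[R]_n => z ord0 j)
    (fun r : R => r *: (delta_mx ord0 (lift i j) : 'rV[R]_n.+1))); first exact: H.
  by rewrite /prop_for /continuous_at; apply: cvgZr_tmp; exact: cvg_id.
have [C E] := affine_C1at (a *: delta_mx ord0 i) y lL cL.
have EE z : a *: delta_mx ord0 i + ins_row i 0 z = ins_row i a z.
  by rewrite [RHS]ins_row_line addrC.
have NE : \forall z \near y, a *: delta_mx ord0 i + ins_row i 0 z = ins_row i a z.
  exact: filterE.
split; first exact: near_eq_C1at NE C.
have [_ E2] := near_eq_diff NE (C1at_diff C).
by apply: (etrans E2).
Qed.

Lemma ins_row0_inj (i : 'I_n.+1) (v : 'rV[R]_n) : ins_row i 0 v = 0 -> v = 0.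
Proof.
move=> /rowP H; apply/rowP => j; have := H (lift i j).
by rewrite !mxE liftK.
Qed.

Lemma ins_row_at (i : 'I_n.+1) (a : R) (v : 'rV[R]_n) : ins_row i a v ord0 i = a.
Proof. by rewrite mxE unlift_none. Qed.

End ins_row_calculus.

(** * Cartan's formula *)

Section cartan.
Context {R : realType}.

Lemma diff_tslice (V W : normedModType R) (H : R * V -> W) (t : R) (x : V) :
  differentiable H (t, x) ->
  differentiable (fun s => H (s, x)) t /\ 'd (fun s => H (s, x)) t 1 = 'd H (t, x) (1, 0).
Proof.
move=> dH.
have Ci : C1at (fun s : R => (s, x)) t.
  by apply: C1at_pair; [exact: C1at_id|exact: C1at_cst].
have di : 'd (fun s : R => (s, x)) t 1 = (1, 0).
  apply: (etrans (congr1 (fun h => h 1) (diff_pair (C1at_diff (C1at_id t)) (C1at_diff (C1at_cst x t))))).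
  congr pair; first exact: diff_idE.
  exact: (diff_cstE x _ _).
split; first exact: (differentiable_comp (C1at_diff Ci) dH).
apply: (etrans (congr1 (fun h => h 1) (diff_comp (C1at_diff Ci) dH))).
by rewrite /= di.
Qed.

Lemma diff_near_cst (V W : normedModType R) (f : V -> W) (x v : V) (a : W) :
  (\forall y \near x, f y = a) -> 'd f x v = 0.
Proof.
move=> H; have NE : \forall y \near x, cst a y = f y by apply: filterS H => y ->.
have [_ E] := near_eq_diff NE (C1at_diff (C1at_cst a x)).
by rewrite (congr1 (fun h => h v) E) (congr1 (fun h => h v) (diff_cst a x)).
Qed.

(** Cartan's formula L_E a = i_E (d a) + d (a (E)) read in a chart.  The Lie
    derivative is obtained by differentiating the invariance of the form in time,
    and d (a (E)) by differentiating the constant pairing in space; the second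
    derivatives of the flow cancel by Schwarz. *)
Lemma cartan_formula (m : nat) (phi : R * 'rV[R]_m -> 'rV[R]_m)
    (a : 'I_m -> 'rV[R]_m -> R) (x0 : 'rV[R]_m) (C : R) :
  (\forall z \near (0, x0), differentiable phi z) ->
  (forall v, differentiable (fun z => 'd phi z v) (0, x0)) ->
  (\forall x \near x0, phi (0, x) = x) ->
  (forall l, differentiable (a l) x0) ->
  (forall u : 'rV[R]_m, \forall t \near (0 : R),
     \sum_l a l (phi (t, x0)) * 'd phi (t, x0) (0, u) ord0 l = \sum_l a l x0 * u ord0 l) ->
  (\forall x \near x0, \sum_l a l x * 'd phi (0, x) (1, 0) ord0 l = C) ->
  forall u : 'rV[R]_m, \sum_l (u ord0 l * 'd (a l) x0 ('d phi (0, x0) (1, 0)) -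
    'd phi (0, x0) (1, 0) ord0 l * 'd (a l) x0 u) = 0.
Proof.
move=> Nphi d2 phi0 da inv cst u.
set E := 'd phi (0, x0) (1, 0).
have dphi := nbhs_singleton Nphi.
have p0 := nbhs_singleton phi0.
have du : 'd phi (0, x0) (0, u) = u.
  have [_ E1] := diff_slice dphi.
  have NE : \forall x \near x0, id x = phi (0, x) by apply: filterS phi0 => x ->.
  have [_ E2] := near_eq_diff NE (C1at_diff (C1at_id x0)).
  have := congr1 (fun h => h u) E1; rewrite /= => <-.
  apply: (etrans (congr1 (fun h => h u) E2)).
  exact: diff_idE.
pose A l (z : R * 'rV[R]_m) := a l (phi z).
have da' l : differentiable (a l) (phi (0, x0)) by rewrite p0.
have dA l : differentiable (A l) (0, x0) by exact: (differentiable_comp dphi (da' l)).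
have EA l v : 'd (A l) (0, x0) v = 'd (a l) x0 ('d phi (0, x0) v).
  apply: (etrans (congr1 (fun h => h v) (diff_comp dphi (da' l)))).
  by rewrite /= p0.
pose B v l (z : R * 'rV[R]_m) := 'd phi z v ord0 l.
have dB v l : differentiable (B v l) (0, x0) by have [] := diff_coord l (d2 v).
have EB v l w : 'd (B v l) (0, x0) w = 'd (fun z => 'd phi z v) (0, x0) w ord0 l.
  by have [_ ->] := diff_coord l (d2 v).
have [D1 E1] := diff_sum_prod dA (dB (0, u)).
have [D2 E2] := diff_sum_prod dA (dB (1, 0)).
have Z1 : 'd (fun z => \sum_l A l z * B (0, u) l z) (0, x0) (1, 0) = 0.
  have [_ <-] := diff_tslice D1.
  exact: (@diff_near_cst _ _ _ _ _ (\sum_l a l x0 * u ord0 l) (inv u)).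
have Z2 : 'd (fun z => \sum_l A l z * B (1, 0) l z) (0, x0) (0, u) = 0.
  have [_ S] := diff_slice D2.
  have := congr1 (fun h => h u) S; rewrite /= => <-.
  apply: (@diff_near_cst _ _ _ _ _ C).
  apply: filterS2 phi0 cst => x px <-; apply: eq_bigr => l _.
  by rewrite /A /B px.
have SW := schwarz_rV Nphi (d2 (0, u)) (d2 (1, 0)).
rewrite E1 in Z1; rewrite E2 in Z2.
have Z3 : \sum_l (u ord0 l * 'd (a l) x0 E - E ord0 l * 'd (a l) x0 u) =
    \sum_l ('d (A l) (0, x0) (1, 0) * B (0, u) l (0, x0) +
              A l (0, x0) * 'd (B (0, u) l) (0, x0) (1, 0)) -
    \sum_l ('d (A l) (0, x0) (0, u) * B (1, 0) l (0, x0) +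
              A l (0, x0) * 'd (B (1, 0) l) (0, x0) (0, u)).
  rewrite -sumrB; apply: eq_bigr => l _.
  have e1 : 'd (A l) (0, x0) (1, 0) = 'd (a l) x0 E by exact: EA.
  have e2 : B (0, u) l (0, x0) = u ord0 l.
    exact: (congr1 (fun v : 'rV[R]_m => v ord0 l) du).
  have e3 : 'd (A l) (0, x0) (0, u) = 'd (a l) x0 u.
    exact: (etrans (EA l (0, u)) (congr1 _ du)).
  have e4 : B (1, 0) l (0, x0) = E ord0 l by [].
  have e5 : 'd (B (0, u) l) (0, x0) (1, 0) = 'd (B (1, 0) l) (0, x0) (0, u).
    apply: (etrans (EB _ _ _)); apply: (etrans _ (esym (EB _ _ _))).
    exact: (congr1 (fun v : 'rV[R]_m => v ord0 l) SW).
  have H (p q r s t X Y Z W T1 T2 : R) : X = q -> Y = p -> Z = s -> W = r ->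
      T1 = T2 -> p * q - r * s = X * Y + t * T1 - (Z * W + t * T2).
    by move=> -> -> -> -> ->; ring.
  exact: (H _ _ _ _ _ _ _ _ _ _ _ e1 e2 e3 e4 e5).
by rewrite Z3 Z1 Z2 subrr.
Qed.

End cartan.

(** * Flow boxes *)

Section piecewise_flow.
Context {R : realType} {n : nat} {M : manifold R n.+1}.
Context {X0 : set M} {T : R -> M -> M} {F : flow_boxes M} {alpha : oneform M}.
Local Notation I := (fb_I F).
Local Notation J := (fb_J (f := F)).
Local Notation O := (fb_O (f := F)).
Local Notation Oij := (fb_Oij (f := F)).
Local Notation Ot := (fb_Ot (f := F)).
Local Notation tau := (fb_tau (f := F)).
Local Notation Bt := (fb_Bt (f := F)).
Local Notation D := (fb_D (f := F)).
Local Notation Tij := (fb_T (f := F)).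
Local Notation N := (fb_N (f := F)).
Local Notation P := (fb_P (f := F)).
Context (mf : measurable_flow X0 T) (st : sections_transversal F)
  (sd : sections_decomposition F) (rt : return_times X0 T F)
  (le : local_extensions T F).
Implicit Types (i j : I) (c : chart R n.+1 M).

Lemma flow_X0 t w : X0 w -> X0 (T t w).
Proof. by case: mf => H _ _ _; exact: H. Qed.

Lemma flow_0 w : X0 w -> T 0 w = w.
Proof. by case: mf => _ H _ _; exact: H. Qed.

Lemma flow_add s t w : X0 w -> T s (T t w) = T (s + t) w.
Proof. by case: mf => _ _ H _ Xw; rewrite H. Qed.

Lemma section_X0 i j z : j \in J i -> Oij i j z -> X0 z.
Proof. by move=> ji Oz; have [_ _ _ _ [_ H]] := rt ji; have [] := H _ Oz. Qed.

Lemma section_Ot i j z : j \in J i -> Oij i j z -> Ot i j z.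
Proof. by move=> ji Oz; have [_ H _ _ _] := rt ji; apply: H; exact: subset_closure. Qed.

Lemma tau_gt0 i j z : j \in J i -> Oij i j z -> 0 < tau i j z.
Proof.
by move=> ji Oz; have [_ _ _ _ [H _]] := rt ji; apply: H; exact: section_Ot.
Qed.

Lemma box_flow i j : j \in J i -> local_flow (Bt i j) (D i j) (Tij i j).
Proof. by move=> ji; have [] := le ji. Qed.

Lemma section_box i j z : j \in J i -> Oij i j z -> box T i j z.
Proof.
move=> ji Oz; exists z, 0; split=> //; first by rewrite lexx tau_gt0.
by rewrite flow_0//; exact: section_X0 Oz.
Qed.

Lemma section_Bt i j z : j \in J i -> Oij i j z -> Bt i j z.
Proof.
move=> ji Oz; have [H _ _ _ _] := le ji; apply: H; apply: subset_closure.
exact: section_box.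
Qed.

(** The orbit segment between the two times stays in the box, so that the local
    flow governs it backward as well as forward. *)
Lemma flow_in_box i j z t s : j \in J i -> Oij i j z -> 0 <= t < tau i j z ->
  0 <= s + t < tau i j z ->
  D i j (s, T t z) /\ T s (T t z) = Tij i j s (T t z).
Proof.
move=> ji Oz /andP[t0 tt] /andP[s0 ss]; have Xz := section_X0 ji Oz.
have [_ _ H _ _] := le ji; apply: H; last first.
  by exists z, t; rewrite t0 tt.
move=> r /andP[r0 r1]; rewrite flow_add //.
exists z, (r * s + t); split=> //.
have H0 (a b c e : R) : 0 <= a -> a <= 1 -> 0 <= b -> 0 <= c + b -> b < e ->
    c + b < e -> 0 <= a * c + b /\ a * c + b < e.
  by move=> h1 h2 h3 h4 h5 h6; case: (lerP 0 c) => hc; split; nra.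
by have [-> ->] := H0 r t s (tau i j z) r0 r1 t0 s0 tt ss.
Qed.

Lemma flow_from_section i j z t : j \in J i -> Oij i j z -> 0 <= t < tau i j z ->
  D i j (t, z) /\ T t z = Tij i j t z.
Proof.
move=> ji Oz ht.
have h0 : 0 <= (0 : R) < tau i j z by rewrite lexx tau_gt0.
have ht' : 0 <= t + 0 < tau i j z by rewrite addr0.
by have := flow_in_box ji Oz h0 ht'; rewrite flow_0//; exact: section_X0 Oz.
Qed.

Lemma section_O i j z : j \in J i -> Oij i j z -> O i z.
Proof. by move=> ji; have [/(_ _ _ ji)[W _ ->] _ _ _] := sd; case. Qed.

(** Transversality of the section says that its defining function has nonzero
    derivative along the flow: otherwise the flow direction would be tangent to
    the section, at distance zero from itself. *)
Lemma transversal_section i j z : j \in J i -> Oij i j z ->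
  exists (U : set M) (g : M -> 'rV[R]_1), [/\ open U, U z, Ck_fun 2 U g,
    (forall q, U q -> (O i q <-> g q = 0)) &
    'd (lev g (chart_at z)) (fwd (chart_at z) z) (dM (Tij i j ^~ z) 0 1) != 0].
Proof.
move=> ji Oz; have Oz' := section_O ji Oz.
have [subO [nrm [e [sn e0 H]]]] := st.
have [U [g [oU Uz Cg gO gs]]] := subO i z Oz'.
exists U, g; split=> //; apply/eqP => dV.
have lf := box_flow ji; have [D0 _] := lf0 lf (section_Bt ji Oz).
have T0 : Tij i j 0 z = z by have [] := lf0 lf (section_Bt ji Oz).
have vel := C1M_velocity (flow_orbit lf D0).
have [V0 HV] := H i j z _ ji Oz vel.
have Vt : tangent_to (O i) z (dM (Tij i j ^~ z) 0 1).
  apply: (kernel_tangent oU Uz Oz' Cg gO) => //.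
  have [u du] := gs z Uz Oz' (const_mx 1); exists u.
  have cz : chart_cod (chart_at z) (fwd (chart_at z) z) by exact: fwd_cod_at.
  have Uz' : U (bwd (chart_at z) (fwd (chart_at z) z)) by rewrite bwd_fwd_at.
  have [_ ->] := lev_C1at oU Cg (chart_at_atlas z) cz Uz'.
  by rewrite du mxE oner_neq0.
have := HV _ Vt; rewrite subrr.
have [s0 _ sh _] := sn.
have -> : nrm z 0 = 0 by have := sh z 0 0; rewrite scale0r normr0 mul0r.
have := smooth_norm_ge0 z (dM (Tij i j ^~ z) 0 1) sn.
rewrite le_eqVlt => /orP[/eqP/esym/s0 V00|pos]; first by rewrite V00 eqxx in V0.
by rewrite leNgt mulr_gt0.
Qed.

(** Flow coordinates: the point with coordinates [x] in the chart [c] is reached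
    from the foot point [ze x] of the section after the time [th x]. *)
Definition box_coord i j c (th : 'rV[R]_n.+1 -> R) (ze : 'rV[R]_n.+1 -> M) x :=
  [/\ chart_cod c x, C1at th x, C1M ze x, C1at (tau i j \o ze) x &
  [/\ Oij i j (ze x), 0 < th x < tau i j (ze x) & bwd c x = T (th x) (ze x)]].

(** The flow time and the foot point on the section are C^1 functions of a point
    of the open box, by the implicit function theorem applied to the defining
    function of the section along the backward flow. *)
Lemma box_coordP i j z0 t0 c : j \in J i -> Oij i j z0 -> 0 < t0 < tau i j z0 ->
  atlas c -> chart_dom c (T t0 z0) ->
  exists th ze, [/\ th (fwd c (T t0 z0)) = t0, ze (fwd c (T t0 z0)) = z0 &
    \forall x \near fwd c (T t0 z0), box_coord i j c th ze x].
Proof.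
move=> ji Oz /andP[t00 t0t] ac cw; set x0 := fwd c (T t0 z0).
have lf := box_flow ji.
have [U [g [oU Uz Cg gO dV]]] := transversal_section ji Oz.
have t01 : 0 <= t0 < tau i j z0 by rewrite ltW.
have [Dt0 Tt0] := flow_from_section ji Oz t01.
have cx0 : chart_cod c x0 by exact: fwd_cod.
have bx0 : bwd c x0 = T t0 z0 by exact: fwdK.
have Dn : D i j (- t0, T t0 z0) by rewrite Tt0; exact: (lfN lf).
have Kn : Tij i j (- t0) (T t0 z0) = z0 by rewrite Tt0; exact: (lfK lf).
pose psi (p : R * 'rV[R]_n.+1) := Tij i j (- p.1) (bwd c p.2).
have Dp0 : D i j (- (t0, x0).1, bwd c (t0, x0).2) by rewrite /= bx0.
have psi0 : psi (t0, x0) = z0 by rewrite /psi /= bx0.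
have Cpsi p : chart_cod c p.2 -> D i j (- p.1, bwd c p.2) -> C1M psi p.
  move=> cp Dp.
  have Cb : C1M (fun q : R * 'rV[R]_n.+1 => bwd c q.2) p.
    have Cb : C1M (bwd c) p.2 by exact: bwd_C1M.
    by have [] := C1M_comp (@fdim_rV R n.+1) (C1at_snd p) Cb.
  have cb : chart_dom c (bwd c p.2) by exact: bwd_dom.
  by have [] := @flow_comp _ _ _ _ _ _ lf _ (fun q : R * 'rV[R]_n.+1 => - q.1)
    (fun q => bwd c q.2) p c ac cb (C1atN (C1at_fst p)) Cb Dp.
have csnd (p : R * 'rV[R]_n.+1) : {for p, continuous snd} by exact: cvg_snd.
have cnfst (p : R * 'rV[R]_n.+1) : {for p, continuous (fun q => - q.1)}.
  by have := C1at_cont (C1atN (C1at_fst p)).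
have nearD (p : R * 'rV[R]_n.+1) : chart_cod c p.2 -> D i j (- p.1, bwd c p.2) ->
    \forall q \near p, chart_cod c q.2 /\ D i j (- q.1, bwd c q.2).
  move=> cp Dp.
  have N1 : \forall q \near p, chart_cod c q.2.
    apply: (near_continuous (csnd p)).
    by apply: near_open => //; exact: chart_open_cod.
  have N2 : \forall q \near p, D i j (- q.1, bwd c q.2).
    apply: (near_flow_dom lf (s := fun q => - q.1) (Q := fun q => bwd c q.2)) => //.
    by apply: (continuous_comp (csnd p)); exact: bwd_continuous.
  by apply: filterS2 N1 N2.
pose G p := g (psi p) ord0 ord0.
have CG p : chart_cod c p.2 -> D i j (- p.1, bwd c p.2) -> U (psi p) ->
    C1at G p /\ forall v, 'd G p v =
      'd (g \o bwd (chart_at (psi p))) (fwd (chart_at (psi p)) (psi p)) (dM psi p v) ord0 ord0.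
  move=> cp Dp Up.
  have [C dE] := Ck_fun_comp oU Cg Up (Cpsi p cp Dp).
  split; first exact: (C1at_coord ord0 C).
  move=> v; have [_ E] := diff_coord ord0 (C1at_diff C).
  by apply: (etrans (E v)); rewrite dE.
have Up0 : U (psi (t0, x0)) by rewrite psi0.
have C0 : C1M psi (t0, x0) by exact: Cpsi.
have NG : \forall p \near (t0, x0), C1at G p.
  have N1 := nearD (t0, x0) cx0 Dp0.
  have N2 : \forall p \near (t0, x0), U (psi p).
    by apply: (near_continuous (C1M_cont C0)); exact: near_open.
  by apply: filterS2 N1 N2 => p [cp Dp] Up; have [] := CG p cp Dp Up.
have G0 : G (t0, x0) = 0.
  rewrite /G psi0 ((gO _ Uz).1 (section_O ji Oz)); exact: mxE.
have dpsi : dM psi (t0, x0) (1, 0) = - dM (Tij i j ^~ z0) 0 1.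
  have Ci : C1at (fun t : R => (t, x0)) t0.
    by apply: C1at_pair; [exact: C1at_id|exact: C1at_cst].
  have di : 'd (fun t : R => (t, x0)) t0 1 = (1, 0).
    apply: (etrans (congr1 (fun h => h 1) (diff_pair (C1at_diff (C1at_id t0)) (C1at_diff (C1at_cst x0 t0))))).
    congr pair; first exact: diff_idE.
    exact: (diff_cstE x0 _ _).
  have [C1 E1] := C1M_comp (@fdim_RV R n.+1) Ci C0.
  have Cs : C1at (fun t : R => t0 - t) t0.
    exact: (C1atD (C1at_cst t0 t0) (C1atN (C1at_id t0))).
  have ds : 'd (fun t : R => t0 - t) t0 1 = -1.
    have := affine_C1at (V := R) (W := R) t0 (L := -%R) t0.
    case; first by move=> a u v; rewrite opprD scalerN.
      by move=> u; exact: opp_continuous.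
    by move=> _ E; rewrite E.
  have Co : C1M (Tij i j ^~ z0) (t0 - t0).
    by rewrite subrr; apply: (flow_orbit lf); have [] := lf0 lf (section_Bt ji Oz).
  have [C2 E2] := C1M_comp (@fdim_R R) Cs Co.
  have NE : \forall t \near t0, (Tij i j ^~ z0 \o (fun t : R => t0 - t)) t = (psi \o (fun t => (t, x0))) t.
    have N1 : \forall t \near t0, D i j (- t, T t0 z0).
      apply: (near_flow_dom lf (s := fun t => - t) (Q := cst (T t0 z0))); last exact: Dn.
      - by have := C1at_cont (C1atN (C1at_id t0)).
      - exact: cst_continuous.
    apply: filterS N1 => t Dt; rewrite /psi /= bx0.
    rewrite Tt0 in Dt *; have [_ <-] := lfD lf Dt0 Dt.
    by rewrite addrC.
  have [_ E3] := near_eq_C1M NE C2.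
  have := E1 1; rewrite di => <-; rewrite E3 E2 ds subrr dM.unlock.
  exact: linearN.
have dG : 'd G (t0, x0) (1, 0) != 0.
  have [_ ->] := CG (t0, x0) cx0 Dp0 Up0.
  have Uz' : U (bwd (chart_at z0) (fwd (chart_at z0) z0)) by rewrite bwd_fwd_at.
  have [_ E] := lev_C1at oU Cg (chart_at_atlas z0) (fwd_cod_at z0) Uz'.
  by rewrite psi0 -E dpsi linearN oppr_eq0.
have [th [th0 Hth]] := implicit_function NG G0 dG.
pose ze x := Tij i j (- th x) (bwd c x).
have ze0 : ze x0 = z0 by rewrite /ze th0 bx0.
exists th, ze; split=> //.
have [_ Cth0 _] := nbhs_singleton Hth.
have Cze x : C1at th x -> chart_cod c x -> D i j (- th x, bwd c x) -> C1M ze x.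
  move=> Cx cx Dx.
  have cb : chart_dom c (bwd c x) by exact: bwd_dom.
  by have [] := flow_comp lf ac cb (C1atN Cx) (bwd_C1M ac cx) Dx.
have Dx0 : D i j (- th x0, bwd c x0) by rewrite th0 bx0.
have Cze0 : C1M ze x0 by exact: Cze.
have [/(_ _ _ ji)[W oW OW] _ _ _] := sd.
have [_ _ _ /(_ z0 (section_Ot ji Oz))[U' [g' [oU' U'z Cg' tg']]] _] := rt ji.
have Cg'ze x : C1M ze x -> U' (ze x) -> C1at (g' \o ze) x.
  by move=> Cx Ux; have [] := Ck_fun_comp oU' Cg' Ux Cx.
have U'ze0 : U' (ze x0) by rewrite ze0.
have N1 : \forall x \near x0, chart_cod c x.
  by apply: near_open => //; exact: chart_open_cod.
have N2 : \forall x \near x0, D i j (- th x, bwd c x).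
  apply: (near_flow_dom lf (s := fun q => - th q) (Q := bwd c)); last exact: Dx0.
    by have := C1at_cont (C1atN Cth0).
  exact: bwd_continuous.
have N3 : \forall x \near x0, (U `&` W `&` U') (ze x).
  apply: (near_continuous (C1M_cont Cze0)); apply: near_open.
    by do 2?apply: openI.
  by rewrite ze0; split=> //; split=> //; move: Oz; rewrite OW; case.
have N4 : \forall x \near x0, 0 < th x < g' (ze x).
  have CC := C1at_cont (Cg'ze _ Cze0 U'ze0).
  have lt1 : th x0 < (g' \o ze) x0.
    by rewrite /= th0 ze0 -tg' //; exact: section_Ot.
  have lt0 : 0 < th x0 by rewrite th0.
  apply: filterS2 (near_lt (@cst_continuous _ _ 0 x0) (C1at_cont Cth0) lt0)
    (near_lt (C1at_cont Cth0) CC lt1) => x h1 h2.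
  by rewrite h1; exact: h2.
have N5 : \forall x \near x0, [/\ chart_cod c x, C1at th x, C1M ze x, U' (ze x) &
    [/\ Oij i j (ze x), D i j (- th x, bwd c x), 0 < th x & th x < g' (ze x)]].
  have H5 : \forall x \near x0, [/\ G (th x, x) = 0 & C1at th x].
    by apply: filterS Hth => x [].
  have N12 : \forall x \near x0, chart_cod c x /\ D i j (- th x, bwd c x).
    by apply: filterS2 N1 N2.
  have N34 : \forall x \near x0, (U `&` W `&` U') (ze x) /\ 0 < th x < g' (ze x).
    by apply: filterS2 N3 N4.
  apply: filterS3 H5 N12 N34 => x [Gx Cx] [cx Dx] [[[Ux Wx] U'x] /andP[h1 h2]].
  split; [exact: cx|exact: Cx|exact: Cze|exact: U'x|split].
  - rewrite OW; split=> //; apply/(gO _ Ux); apply/rowP => l; rewrite (ord1 l) mxE.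
    exact: Gx.
  - exact: Dx.
  - exact: h1.
  - exact: h2.
have tz x : U' (ze x) -> Oij i j (ze x) -> g' (ze x) = tau i j (ze x).
  by move=> Ux Ox; rewrite tg' //; exact: section_Ot.
have N6 := near_join N5.
apply: filterS2 N5 N6 => x [cx Cx Czx Ux [Ox Dx h1 h2]] H6.
have h3 : 0 < th x < tau i j (ze x) by rewrite -tz // h1 h2.
split; [exact: cx|exact: Cx|exact: Czx| |split].
- apply: (near_eq_C1at (f := g' \o ze)); last exact: Cg'ze.
  by apply: filterS H6 => y [_ _ _ Uy [Oy _ _ _]] /=; exact: tz.
- exact: Ox.
- exact: h3.
- have h4 : 0 <= th x < tau i j (ze x) by case/andP: h3 => /ltW -> ->.
  have [_ ->] := flow_from_section ji Ox h4.
  by have := lfK lf Dx; rewrite opprK => ->.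
Qed.

(** * The pairing of the form with the velocity *)

(** Unlike the box, which contains a piece of its section, this set is open. *)
Definition obox i j : set M :=
  [set w | exists z t, [/\ Oij i j z, 0 < t < tau i j z & w = T t z]].

Definition regular : set M := [set w | exists i j, j \in J i /\ obox i j w].

Definition vel (w : M) : tangent R n.+1 := dM (T ^~ w) 0 1.

Definition pairing (w : M) : R := Defs.eval (alpha w) (vel w).

Lemma obox_X0 i j w : j \in J i -> obox i j w -> X0 w.
Proof.
by move=> ji [z [t [Oz _ ->]]]; apply: flow_X0; exact: (section_X0 ji Oz).
Qed.

Lemma regular_X0 w : regular w -> X0 w.
Proof. by move=> [i [j [ji]]]; exact: obox_X0. Qed.

Lemma near_obox i j w : j \in J i -> obox i j w -> \forall q \near w, obox i j q.
Proof.
move=> ji [z [t [Oz ht ->]]].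
have [th [ze [_ _ H]]] := box_coordP ji Oz ht
  (chart_at_atlas (T t z)) (chart_at_dom (T t z)).
apply: filterS (near_chart (chart_at_dom (T t z)) H) => q [cq [_ _ _ _ [Oq hq Eq]]].
by exists (ze (fwd (chart_at (T t z)) q)), (th (fwd (chart_at (T t z)) q)); rewrite -Eq fwdK.
Qed.

Lemma near_regular w : regular w -> \forall q \near w, regular q.
Proof.
move=> [i [j [ji Bw]]].
by apply: filterS (near_obox ji Bw) => q Bq; exists i, j.
Qed.

Lemma regular_interior w : regular w -> interior X0 w.
Proof.
move=> gw; rewrite /interior.
by apply: filterS (near_regular gw) => q; exact: regular_X0.
Qed.

(** The times needed to leave the box are positive in both directions. *)
Lemma obox_flow i j w : j \in J i -> obox i j w ->
  D i j (0, w) /\ \forall s \near (0 : R), D i j (s, w) /\ T s w = Tij i j s w.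
Proof.
move=> ji [z [t [Oz /andP[t0 tt] ->]]].
have ht : 0 <= t < tau i j z by rewrite (ltW t0).
have H s : 0 < s + t -> s + t < tau i j z ->
    D i j (s, T t z) /\ T s (T t z) = Tij i j s (T t z).
  by move=> s0 ss; apply: (flow_in_box ji Oz ht); rewrite (ltW s0).
split; first by have [] := H 0; rewrite ?add0r.
have C : {for 0, continuous (fun s : R => s + t)}.
  by apply: C1at_cont; exact: (C1atD (C1at_id _) (C1at_cst _ _)).
have N1 : \forall s \near (0 : R), 0 < s + t.
  by apply: (near_lt (@cst_continuous _ _ 0 (0 : R)) C); rewrite add0r.
have N2 : \forall s \near (0 : R), s + t < tau i j z.
  by apply: (near_lt C (@cst_continuous _ _ (tau i j z) (0 : R))); rewrite add0r.
by apply: filterS2 N1 N2.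
Qed.

Definition phi i j c : R * 'rV[R]_n.+1 -> 'rV[R]_n.+1 :=
  fwd c \o flow_in (Tl := Tij i j) c.

Lemma phi_C1at i j c t x : j \in J i -> atlas c -> chart_cod c x ->
  D i j (t, bwd c x) -> chart_dom c (Tij i j t (bwd c x)) -> C1at (phi i j c) (t, x).
Proof.
move=> ji ac cx Dx cT.
by have [] := C1M_chart (psi := flow_in c) ac cT (flow_in_C1M (box_flow ji) ac cx Dx).
Qed.

Lemma orbit_velocity i j w c : j \in J i -> obox i j w -> atlas c -> chart_dom c w ->
  C1M (T ^~ w) 0 /\
  vel w = coord_vec c w ('d (phi i j c) (0, fwd c w) (1, 0)).
Proof.
move=> ji Bw ac cw; have lf := box_flow ji.
have [D0 H] := obox_flow ji Bw.
have T0 : Tij i j 0 w = w by have [] := lf0 lf (lfB lf D0).1.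
have [C E] := @flow_comp _ _ _ _ _ _ lf _ id (cst w) 0 c ac cw (C1at_id _) (C1M_cst _ _) D0.
have NE : \forall s \near (0 : R), Tij i j (id s) (cst w s) = (T ^~ w) s.
  by apply: filterS H => s [_ ->].
have [C' E'] := near_eq_C1M NE C; split; first exact: C'.
rewrite /vel E' E.
have cx := fwd_cod cw.
have D0x : D i j (0, bwd c (fwd c w)) by rewrite fwdK.
have cT : chart_dom c (flow_in (Tl := Tij i j) c (0, fwd c w)) by rewrite /flow_in /= fwdK // T0.
have [_ E2] := C1M_chart (psi := flow_in c) ac cT (flow_in_C1M lf ac cx D0x).
apply: (etrans (E2 _)).
have e1 : flow_in (Tl := Tij i j) c (0, fwd c w) = w by rewrite /flow_in /= fwdK.
rewrite e1; congr (coord_vec _ _ ('d _ _ _)); congr pair.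
  exact: diff_idE.
exact: (diff_cstE (fwd c w) _ _).
Qed.

Lemma pairing_in i j w c : j \in J i -> obox i j w -> atlas c -> chart_dom c w ->
  pairing w = \sum_l 'd (phi i j c) (0, fwd c w) (1, 0) ord0 l * comp_in alpha c l (fwd c w).
Proof.
move=> ji Bw ac cw; rewrite /pairing; have [_ ->] := orbit_velocity ji Bw ac cw.
by rewrite -eval_inE /eval_in fwdK.
Qed.

Lemma pairing_cont w : Ck_oneform 2 alpha -> regular w -> {for w, continuous pairing}.
Proof.
move=> Ca [i [j [ji Bw]]]; set c := chart_at w.
have ac : atlas c by exact: chart_at_atlas.
have cw : chart_dom c w by exact: chart_at_dom.
have lf := box_flow ji.
have [D0 _] := obox_flow ji Bw.
have T0 : Tij i j 0 w = w by have [] := lf0 lf (lfB lf D0).1.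
pose h x := \sum_l 'd (phi i j c) (0, x) (1, 0) ord0 l * comp_in alpha c l x.
have Ch : {for fwd c w, continuous h}.
  apply: continuous_sum => l.
  have C : C1at (phi i j c) (0, fwd c w).
    by apply: phi_C1at; rewrite ?fwdK ?T0 //; exact: fwd_cod.
  have C1 : {for fwd c w, continuous (fun x => 'd (phi i j c) (0, x) (1, 0))}.
    have Cp := @pair_cont R _ 0 (fwd c w).
    exact: (continuous_comp Cp (C1at_dcont C (1, 0))).
  have C2 := C1at_cont (Ck_oneform_C1 l Ca ac (fwd_cod cw)).
  have C3 : {for fwd c w, continuous (fun x => 'd (phi i j c) (0, x) (1, 0) ord0 l)}.
    exact: (coord_cont C1).
  exact: (continuousM C3 C2).
have NE : \forall q \near w, (h \o fwd c) q = pairing q.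
  have N1 : \forall q \near w, chart_dom c q.
    by apply: near_open => //; exact: chart_open_dom.
  by apply: filterS2 N1 (near_obox ji Bw) => q cq Bq; rewrite (pairing_in ji Bq ac cq).
exact: (near_eq_continuous NE (continuous_comp (fwd_continuous cw) Ch)).
Qed.

Lemma vel_transport s w : regular w -> C1map (T s) w ->
  vel (T s w) = mdiff (T s) w (vel w).
Proof.
move=> [i [j [ji Bw]]] Cs; have Xw := obox_X0 ji Bw.
have [C0 _] := orbit_velocity ji Bw (chart_at_atlas w) (chart_at_dom w).
have T0 : T 0 w = w by exact: flow_0.
have Cs0 : C1map (T s) (T 0 w) by rewrite T0.
have [C E] := C1map_comp C0 Cs0; rewrite T0 in E; rewrite -E.
have NE : \forall t \near (0 : R), (T s \o T ^~ w) t = (T ^~ (T s w)) t.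
  have H t : (T s \o T ^~ w) t = (T ^~ (T s w)) t.
    by rewrite /= !flow_add // addrC.
  by exists 1 => //= t _; exact: H.
by have [_ <-] := near_eq_C1M NE C.
Qed.

(** Preserving the form almost everywhere forces its pairing with the velocity
    to be preserved everywhere the flow is smooth: both sides are continuous
    and an open set is not null. *)
Lemma pairing_invariant s w : Ck_oneform 2 alpha -> contact_flow X0 T alpha ->
  (\forall q \near w, C1map (T s) q) -> regular w -> regular (T s w) ->
  pairing (T s w) = pairing w.
Proof.
move=> Ca cf Cs rw rs; apply/eqP/negP => /negP ne.
have c1 : {for w, continuous (fun q => pairing (T s q) - pairing q)}.
  have Cw := C1map_cont (nbhs_singleton Cs).
  rewrite /prop_for /continuous_at; apply: cvgB; last exact: pairing_cont.
  by apply: (continuous_comp Cw); exact: pairing_cont.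
have nz : pairing (T s w) - pairing w != 0 by rewrite subr_eq0.
have H := near_neq0 c1 nz.
have N : \forall q \near w, [/\ interior X0 q, mdifferentiable (T s) q &
    ~ (forall v, Defs.eval (alpha (T s q)) (mdiff (T s) q v) = Defs.eval (alpha q) v)].
  apply: filterS3 H Cs (near_regular rw) => q nq Cq rq.
  split; [exact: regular_interior|exact: C1map_mdifferentiable|move=> E].
  by move: nq; rewrite /pairing (vel_transport rq Cq) E subrr eqxx.
have := cf s (chart_at w) (chart_at_atlas w).
exact: (open_not_null (near_chart_cod (chart_at_dom w) N)).
Qed.

(** From every point near [w] the orbit reaches at the time [s] a point with flow
    coordinates [r] and [Q] of class C^1, which makes T_s smooth near [w]. *)
Lemma pairing_transport s c w i j (r : 'rV[R]_n.+1 -> R) (Q : 'rV[R]_n.+1 -> M) :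
  Ck_oneform 2 alpha -> contact_flow X0 T alpha -> j \in J i -> atlas c ->
  chart_dom c w -> regular w ->
  (\forall x \near fwd c w, [/\ C1at r x, C1M Q x, Oij i j (Q x),
     0 < r x < tau i j (Q x) & T s (bwd c x) = T (r x) (Q x)]) ->
  pairing (T s w) = pairing w.
Proof.
move=> Ca cf ji ac cw rw H; have lf := box_flow ji.
apply: pairing_invariant => //; last first.
  have [_ _ Ox hx] := nbhs_singleton H; rewrite fwdK // => ->.
  by exists i, j; split=> //; exists (Q (fwd c w)), (r (fwd c w)).
have H2 : \forall x \near fwd c w, C1M (T s \o bwd c) x.
  have HH := near_join H.
  apply: filterS2 H HH => x [Cr CQ Ox /andP[r0 rt'] _] Hx.
  have hr : 0 <= r x < tau i j (Q x) by rewrite (ltW r0).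
  have [Dx _] := flow_from_section ji Ox hr.
  have [C _] := flow_comp lf (chart_at_atlas (Q x)) (chart_at_dom (Q x)) Cr CQ Dx.
  have NE : \forall y \near x, Tij i j (r y) (Q y) = (T s \o bwd c) y.
    apply: filterS Hx => y [_ _ Oy /andP[/ltW hy hy'] /= ->].
    have hr' : 0 <= r y < tau i j (Q y) by rewrite hy.
    by have [_ ->] := flow_from_section ji Oy hr'.
  by have [] := near_eq_C1M NE C.
apply: filterS (near_chart cw H2) => q [cq Cq].
exact: (C1map_chart ac cq).
Qed.

Lemma tau_comp (V : normedModType R) i j (psi : V -> M) x : j \in J i ->
  (\forall y \near x, Oij i j (psi y)) -> C1M psi x -> C1at (tau i j \o psi) x.
Proof.
move=> ji NO C; have Ox := nbhs_singleton NO.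
have [_ _ _ /(_ _ (section_Ot ji Ox))[U [g [oU Ux Cg tg]]] _] := rt ji.
have [Cgx _] := Ck_fun_comp oU Cg Ux C.
apply: (near_eq_C1at (f := g \o psi)); last exact: Cgx.
have N1 : \forall y \near x, U (psi y).
  by apply: (near_continuous (C1M_cont C)); exact: near_open.
by apply: filterS2 NO N1 => y Oy Uy /=; rewrite tg //; exact: (section_Ot ji Oy).
Qed.

Lemma pairing_box i j z t t' : Ck_oneform 2 alpha -> contact_flow X0 T alpha ->
  j \in J i -> Oij i j z -> 0 < t < tau i j z -> 0 < t' < tau i j z ->
  pairing (T t' z) = pairing (T t z).
Proof.
move=> Ca cf ji Oz ht /andP[h1 h2]; set c := chart_at (T t z).
have ac : atlas c by exact: chart_at_atlas.
have cw : chart_dom c (T t z) by exact: chart_at_dom.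
have Xz := section_X0 ji Oz.
have [th [ze [th0 ze0 H]]] := box_coordP ji Oz ht ac cw.
have -> : T t' z = T (t' - t) (T t z) by rewrite flow_add // subrK.
have rw : regular (T t z) by exists i, j; split=> //; exists z, t.
pose r x := (t' - t) + th x.
apply: (pairing_transport (r := r) (Q := ze) Ca cf ji ac cw rw).
have [_ Cth _ Ctau _] := nbhs_singleton H.
have Cr : {for fwd c (T t z), continuous r}.
  by apply: C1at_cont; exact: (C1atD (C1at_cst (t' - t) _) Cth).
have N1 : \forall x \near fwd c (T t z), 0 < r x.
  apply: (near_lt (@cst_continuous _ _ 0 (fwd c (T t z))) Cr).
  by rewrite /r th0 subrK.
have N2 : \forall x \near fwd c (T t z), r x < (tau i j \o ze) x.
  apply: (near_lt Cr (C1at_cont Ctau)).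
  by rewrite /r th0 subrK /= ze0.
apply: filterS3 H N1 N2 => x [cx Cx Czx _ [Ox _ Ex]] r1 r2; split.
- exact: (C1atD (C1at_cst (t' - t) _) Cx).
- exact: Czx.
- exact: Ox.
- by rewrite r1; exact: r2.
- by rewrite Ex flow_add //; exact: (section_X0 ji Ox).
Qed.

Lemma hit_C1M (V : normedModType R) i j (psi : V -> M) x : j \in J i ->
  Oij i j (psi x) -> C1M psi x -> C1M (P i j \o psi) x.
Proof.
move=> ji Ox C; have [_ _ _ [cN [oN [_ [CP _]]]] _] := le ji.
have Nx : N i j (psi x) by apply: cN; apply: subset_closure; exact: (section_Ot ji Ox).
by have [] := C1map_comp C (Ck_map_C1map oN CP Nx).
Qed.

Lemma hit_section i j z : j \in J i -> Oij i j z ->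
  O j (P i j z) /\ P i j z = T (tau i j z) z.
Proof.
move=> ji Oz; have [_ _ _ _ /(_ _ Oz) E] := le ji.
by have [_ _ _ _ [_ /(_ _ Oz) [_ _ H]]] := rt ji; rewrite {1}E.
Qed.

(** Near a point of the first box, T_s is the backward motion to the section,
    followed by the hitting map and by the forward motion in the second box. *)
Lemma pairing_crossing i j l z t t' : Ck_oneform 2 alpha -> contact_flow X0 T alpha ->
  j \in J i -> l \in J j -> Oij i j z -> Oij j l (P i j z) ->
  0 < t < tau i j z -> 0 < t' < tau j l (P i j z) ->
  pairing (T t' (P i j z)) = pairing (T t z).
Proof.
move=> Ca cf ji lj Oz OPz ht /andP[h1 h2]; set c := chart_at (T t z).
have ac : atlas c by exact: chart_at_atlas.
have cw : chart_dom c (T t z) by exact: chart_at_dom.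
have Xz := section_X0 ji Oz.
have [th [ze [th0 ze0 H]]] := box_coordP ji Oz ht ac cw.
pose s := t' + tau i j z - t.
have -> : T t' (P i j z) = T s (T t z).
  by rewrite (hit_section ji Oz).2 !flow_add // subrK.
have rw : regular (T t z) by exists i, j; split=> //; exists z, t.
pose r x := s + (th x - (tau i j \o ze) x).
apply: (pairing_transport (r := r) (Q := P i j \o ze) Ca cf lj ac cw rw).
have [_ Cth Cze Ctau [Oze _ _]] := nbhs_singleton H.
have Cr x : C1at th x -> C1at (tau i j \o ze) x -> C1at r x.
  by move=> C1 C2; exact: (C1atD (C1at_cst s _) (C1atD C1 (C1atN C2))).
have r0 : r (fwd c (T t z)) = t'.
  by rewrite /r /s th0 /= ze0; lra.
have [/(_ _ _ lj)[W oW OW] _ _ _] := sd.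
have Pz0 : (P i j \o ze) (fwd c (T t z)) = P i j z by rewrite /= ze0.
have CP : C1M (P i j \o ze) (fwd c (T t z)) by exact: hit_C1M.
have NO : \forall x \near fwd c (T t z), Oij j l ((P i j \o ze) x).
  have NW : \forall x \near fwd c (T t z), W ((P i j \o ze) x).
    apply: (near_continuous (C1M_cont CP)); apply: near_open => //.
    by move: OPz; rewrite Pz0 OW; case.
  apply: filterS2 NW H => x Wx [_ _ _ _ [Ox _ _]].
  by rewrite OW; split=> //; have [] := hit_section ji Ox.
have Ct' := C1at_cont (tau_comp lj NO CP).
have N1 : \forall x \near fwd c (T t z), 0 < r x.
  by apply: (near_lt (@cst_continuous _ _ 0 (fwd c (T t z))) (C1at_cont (Cr _ Cth Ctau))); rewrite r0.
have N2 : \forall x \near fwd c (T t z), r x < (tau j l \o (P i j \o ze)) x.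
  by apply: (near_lt (C1at_cont (Cr _ Cth Ctau)) Ct'); rewrite r0 /= ze0.
have N12 : \forall x \near fwd c (T t z), 0 < r x < (tau j l \o (P i j \o ze)) x.
  by apply: filterS2 N1 N2 => x -> ->.
apply: filterS3 H NO N12 => x [cx Cx Czx Ctx [Ox _ Ex]] OPx hx; split.
- exact: Cr.
- exact: hit_C1M.
- exact: OPx.
- exact: hx.
- have Xx := section_X0 ji Ox.
  rewrite Ex /= (hit_section ji Ox).2 !flow_add //; congr (T _ _).
  by rewrite /r /=; lra.
Qed.

(** * Interrupted itineraries *)

(** The foot points whose itinerary through the pieces of the sections is
    interrupted after [p].  Recording the itinerary leaves countably many sets,
    each to be shown null. *)
Fixpoint bad (p : seq I) i j : set M :=
  match p with
  | [::] => [set z | Oij i j z /\ forall l, l \in J j -> ~ Oij j l (P i j z)]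
  | l :: p' => [set z | [/\ Oij i j z, l \in J j & bad p' j l (P i j z)]]
  end.

Lemma section_open i j : j \in J i -> exists2 W, open W & Oij i j = O i `&` W.
Proof. by move=> ji; have [/(_ _ _ ji)[W oW E] _ _ _] := sd; exists W. Qed.

(** The hitting map has an inverse of class C^2. *)
Lemma hit_immersion (V : normedModType R) i j (psi : V -> M) x v : j \in J i ->
  Oij i j (psi x) -> C1M psi x -> dM (P i j \o psi) x v = 0 -> dM psi x v = 0.
Proof.
move=> ji Ox C dv; have [_ _ _ [cN [oN [oPN [CP [Q [CQ QP]]]]]] _] := le ji.
have Nx : N i j (psi x) by apply: cN; apply: subset_closure; exact: (section_Ot ji Ox).
have C1 := hit_C1M ji Ox C.
have PNx : (P i j @` N i j) (P i j (psi x)) by exists (psi x).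
have [C2 E2] := C1map_comp (F := Q) C1 (Ck_map_C1map oPN CQ PNx).
have NE : \forall y \near x, (Q \o (P i j \o psi)) y = psi y.
  have N1 : \forall y \near x, N i j (psi y).
    by apply: (near_continuous (C1M_cont C)); exact: near_open.
  by apply: filterS N1 => y Ny /=; exact: QP.
have [_ ->] := near_eq_C1M NE C2.
by rewrite E2 dv /mdiff linear0.
Qed.

(** The pieces are open in the sections, so that a difference of open sets, hence a
    measurable set, is obtained. *)
Lemma bad_open (S : topologicalType) p i j (N0 : set S) (ze : S -> M) : j \in J i ->
  open N0 -> (forall x, N0 x -> {for x, continuous ze}) ->
  (forall x, N0 x -> Oij i j (ze x)) ->
  exists N1 N2, [/\ open N1, open N2 & N0 `&` ze @^-1` bad p i j = N1 `\` N2].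
Proof.
have cont k l (x : S) (z : S -> M) : l \in J k -> {for x, continuous z} ->
    Oij k l (z x) -> {for x, continuous (P k l \o z)}.
  move=> lk cz Ox; have [_ _ _ [cN [oN [_ [CP _]]]] _] := le lk.
  have Nx : N k l (z x) by apply: cN; apply: subset_closure; exact: (section_Ot lk Ox).
  exact: (continuous_comp cz (C1map_cont (Ck_map_C1map oN CP Nx))).
elim: p i j N0 ze => [|l p IH] i j N0 ze ji oN cz Oz.
  pose H l := N0 `&` [set x | l \in J j /\ Oij j l (P i j (ze x))].
  have oH l : open (H l).
    have [lj|nlj] := boolP (l \in J j); last first.
      rewrite (_ : H l = set0); first exact: open0.
      by apply/seteqP; split=> // x [_ [lj]]; rewrite lj in nlj.
    have [W oW EW] := section_open lj.
    rewrite (_ : H l = N0 `&` (P i j \o ze) @^-1` W).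
      by apply: open_preimage_within => // x Nx; apply: cont => //; [exact: cz|exact: Oz].
    apply/seteqP; split=> x [Nx].
      by move=> [_]; rewrite EW => -[_ Wx].
    move=> Wx; split=> //; split=> //; rewrite EW; split=> //.
    by have [] := hit_section ji (Oz _ Nx).
  exists N0, (\bigcup_l H l); split=> //; first by apply: bigcup_open => l _; exact: oH.
  apply/seteqP; split=> x.
    move=> [Nx [_ B]]; split=> // -[l _ [_ [lj Ol]]]; exact: B lj Ol.
  move=> [Nx B]; split=> //; split; first exact: Oz.
  by move=> l lj Ol; apply: B; exists l.
have [lj|nlj] := boolP (l \in J j); last first.
  exists set0, set0; split; [exact: open0|exact: open0|].
  apply/seteqP; split=> [x [_ [_ lj _]]|x []//].
  by rewrite lj in nlj.
have [W oW EW] := section_open lj.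
pose N' := N0 `&` (P i j \o ze) @^-1` W.
have oN' : open N'.
  by apply: open_preimage_within => // x Nx; apply: cont => //; [exact: cz|exact: Oz].
have O' x : N' x -> Oij j l ((P i j \o ze) x).
  move=> [Nx Wx]; rewrite EW; split=> //.
  by have [] := hit_section ji (Oz _ Nx).
have [N1 [N2 [ow1 ow2 E]]] := IH j l N' (P i j \o ze) lj oN'
  (fun x Nx => cont i j x ze ji (cz x Nx.1) (Oz x Nx.1)) O'.
exists N1, N2; split=> //; rewrite -E; apply/seteqP; split=> x.
  move=> [Nx [_ _ Bx]]; split=> //; split=> //=.
  by case: {E IH} p Bx => [|a p] /= []; rewrite EW; case.
by move=> [[Nx Wx] Bx]; split=> //; split=> //; exact: Oz.
Qed.

Lemma dME (V : normedModType R) (psi : V -> M) x :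
  dM psi x = 'd (fwd (chart_at (psi x)) \o psi) x :> (V -> tangent R n.+1).
Proof. by rewrite dM.unlock. Qed.

(** Through an immersed piece of a section only a null set of parameters is
    bad: the hitting maps carry it, as an immersion, to the section where the
    itinerary is interrupted, and that section is covered by its pieces up to a
    null set. *)
Lemma bad_null_section p i j (U : set 'rV[R]_n) (psi : 'rV[R]_n -> M) : j \in J i ->
  open U -> (forall x, U x -> C1M psi x) -> (forall x, U x -> Oij i j (psi x)) ->
  (forall x v, U x -> dM psi x v = 0 -> v = 0) ->
  lebesgue_null (U `&` psi @^-1` bad p i j).
Proof.
elim: p i j U psi => [|l p IH] i j U psi ji oU CU OU iU.
  have [_ _ /(_ j) H _] := sd.
  have C x : U x -> C1M (P i j \o psi) x.
    by move=> Ux; apply: (hit_C1M ji); [exact: OU|exact: CU].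
  have H1 : lebesgue_null (U `&` (P i j \o psi) @^-1`
      (O j `\` \bigcup_(l in [set` J j]) Oij j l)).
    apply: (H U (P i j \o psi) oU).
    - exact: C1M_Ck_to.
    - by move=> x Ux; have [] := hit_section ji (OU x Ux).
    - move=> x Ux v w; have E := dME (P i j \o psi) x.
      rewrite -E => vw; apply/eqP; rewrite -subr_eq0; apply/eqP.
      apply: (iU x _ Ux); apply: (hit_immersion ji (OU x Ux) (CU x Ux)).
      by move: vw; rewrite E linearB => ->; rewrite subrr.
  apply: lebesgue_null_sub H1 => x [Ux [_ Bx]]; split=> //; split.
    by have [] := hit_section ji (OU x Ux).
  by move=> [l lj Ol]; exact: Bx lj Ol.
have [lj|nlj] := boolP (l \in J j); last first.
  rewrite (_ : _ `&` _ = set0); last first.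
    apply/seteqP; split=> [x [_ [_ lj _]]|x []//].
    by rewrite lj in nlj.
  rewrite /lebesgue_null preimage_set0; exact: negligible_set0.
have [W oW EW] := section_open lj.
pose U' := U `&` (P i j \o psi) @^-1` W.
have C x : U x -> C1M (P i j \o psi) x.
  by move=> Ux; apply: (hit_C1M ji); [exact: OU|exact: CU].
have oU' : open U'.
  by apply: open_preimage_within => // x Ux; exact: (C1M_cont (C x Ux)).
have O' x : U' x -> Oij j l ((P i j \o psi) x).
  move=> [Ux Wx]; rewrite EW; split=> //.
  by have [] := hit_section ji (OU _ Ux).
have C' x : U' x -> C1M (P i j \o psi) x by case=> Ux _; exact: C.
have i' x v : U' x -> dM (P i j \o psi) x v = 0 -> v = 0.
  move=> [Ux _] dv; apply: (iU x _ Ux).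
  exact: (hit_immersion ji (OU x Ux) (CU x Ux) dv).
apply: lebesgue_null_sub (IH j l U' (P i j \o psi) lj oU' C' O' i') => x.
move=> [Ux [_ _ Bx]]; split=> //; split=> //=.
by case: {IH} p Bx => [|a p] /= []; rewrite EW; case.
Qed.

(** The point is recovered from its foot point and its flow time, so a direction
    in which the foot point does not move is parallel to the flow. *)
Lemma foot_kernel i j c th ze x u : j \in J i -> atlas c ->
  (\forall y \near x, box_coord i j c th ze y) -> dM ze x u = 0 ->
  u = 'd th x u *: 'd (phi i j c) (0, x) (1, 0).
Proof.
move=> ji ac H du; have lf := box_flow ji.
have [cx Cth Cze _ [Ox hx Ex]] := nbhs_singleton H.
have cb : chart_dom c (bwd c x) by exact: bwd_dom.
have hx' : 0 <= th x < tau i j (ze x) by case/andP: hx => /ltW -> ->.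
have [Dx Tx] := flow_from_section ji Ox hx'.
set z := ze x; set c' := chart_at z.
have ac' : atlas c' by exact: chart_at_atlas.
have cz : chart_dom c' z by exact: chart_at_dom.
have [C1 E1] := flow_comp lf ac' cz Cth Cze Dx.
have NE : \forall y \near x, Tij i j (th y) (ze y) = bwd c y.
  apply: filterS H => y [_ _ _ _ [Oy /andP[/ltW h1 h2] ->]].
  have hy : 0 <= th y < tau i j (ze y) by rewrite h1.
  by have [_ ->] := flow_from_section ji Oy hy.
have [_ E2] := near_eq_C1M NE C1.
have dz : 'd (fwd c' \o ze) x u = 0 by move: du; rewrite dM.unlock.
set L := dM (flow_in (Tl := Tij i j) c') (th x, fwd c' z).
have EL (a : R) : L (a, 0) = a *: L (1, 0).
  rewrite /L dM.unlock -linearZ /=; congr ('d _ _ _); congr pair.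
    by rewrite [RHS]/GRing.scale /= mulr1.
  by rewrite scaler0.
have e1 : coord_vec c (bwd c x) u = 'd th x u *: L (1, 0).
  rewrite -(dM_bwd _ cx) E2; apply: (etrans (E1 u)).
  by rewrite -EL; congr (dM _ _ _); congr pair.
have [_ E3] := @flow_comp _ _ _ _ _ _ lf _ id (cst z) (th x) c' ac' cz (C1at_id _) (C1M_cst _ _) Dx.
have e2 : L (1, 0) = dM (Tij i j ^~ z) (th x) 1.
  symmetry; apply: (etrans (E3 1)); congr (dM _ _ _); congr pair.
    exact: diff_idE.
  exact: (diff_cstE (fwd c' z) _ _).
have Bw : obox i j (bwd c x) by exists z, (th x).
have [_ Ev] := orbit_velocity ji Bw ac cb.
rewrite bwdK // in Ev.
have e3 : L (1, 0) = coord_vec c (bwd c x) ('d (phi i j c) (0, x) (1, 0)).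
  rewrite e2 -(flow_shift lf Dx) -Tx -Ex -Ev /vel.
  have [D0 H0] := obox_flow ji Bw.
  have NE0 : \forall s \near (0 : R), (Tij i j ^~ (bwd c x)) s = (T ^~ (bwd c x)) s.
    by apply: filterS H0 => s [_ ->].
  by have [_ ->] := near_eq_C1M NE0 (flow_orbit lf D0).
have inj v := coord_vec_inj v ac cb.
rewrite e3 in e1.
have := congr1 ('d (fwd c \o bwd (chart_at (bwd c x))) (fwd (chart_at (bwd c x)) (bwd c x))) e1.
by rewrite linearZ !inj.
Qed.

(** The flow leaves the section transversally and its maps transport its velocity. *)
Lemma velocity_neq0 i j z t c : j \in J i -> Oij i j z -> 0 < t < tau i j z ->
  atlas c -> chart_dom c (T t z) -> 'd (phi i j c) (0, fwd c (T t z)) (1, 0) != 0.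
Proof.
move=> ji Oz ht ac cw; have lf := box_flow ji; apply/eqP => E0.
have Bw : obox i j (T t z) by exists z, t.
have [_ Ev] := orbit_velocity ji Bw ac cw.
have ht' : 0 <= t < tau i j z by case/andP: ht => /ltW -> ->.
have [Dt Tt] := flow_from_section ji Oz ht'.
have [D0 H0] := obox_flow ji Bw.
have NE0 : \forall s \near (0 : R), (Tij i j ^~ (T t z)) s = (T ^~ (T t z)) s.
  by apply: filterS H0 => s [_ ->].
have v0 : dM (Tij i j ^~ (T t z)) 0 1 = 0.
  have [_ <-] := near_eq_C1M NE0 (flow_orbit lf D0).
  by apply: (etrans Ev); rewrite E0 /coord_vec linear0.
rewrite Tt in v0; have Dn := lfN lf Dt.
have Kn : Tij i j (- t) (Tij i j t z) = z by exact: (lfK lf).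
have := flow_shift lf Dn; rewrite Kn (flow_velocity lf Dn) v0 /mdiff linear0 => V0.
have [U [g [_ _ _ _]]] := transversal_section ji Oz.
by rewrite V0 linear0 eqxx.
Qed.

(** The points of the open boxes whose orbit crosses the sections for ever. *)
Definition nice : set M := [set w | exists i j z t,
  [/\ j \in J i, Oij i j z, 0 < t < tau i j z, w = T t z & forall p, ~ bad p i j z]].

(** Fubini along a coordinate in which the velocity does not vanish: by
    [foot_kernel] the foot map immerses the slices in the section, where
    [bad_null_section] applies. *)
Lemma nice_ae w c : regular w -> atlas c -> chart_dom c w ->
  exists2 U, nbhs (fwd c w) U & lebesgue_null (U `\` [set x | nice (bwd c x)]).
Proof.
move=> [i [j [ji [z [t [Oz ht ->]]]]]] ac cw; have lf := box_flow ji.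
have [th [ze [th0 ze0 H]]] := box_coordP ji Oz ht ac cw.
set x0 := fwd c (T t z).
pose E x := 'd (phi i j c) (0, x) (1, 0) : 'rV[R]_n.+1.
have E0 : E x0 != 0 by exact: velocity_neq0.
(* the coordinate along which the neighbourhood is sliced *)
have [l El] : exists l, E x0 ord0 l != 0.
  apply: contrapT => A; move/eqP: E0; apply; apply/rowP => l; rewrite mxE.
  by apply/eqP/negPn/negP => B; apply: A; exists l.
have Bw : obox i j (T t z) by exists z, t.
have [D0 _] := obox_flow ji Bw.
have T0 : Tij i j 0 (T t z) = T t z by have [] := lf0 lf (lfB lf D0).1.
have CE : {for x0, continuous E}.
  have C : C1at (phi i j c) (0, x0).
    by apply: phi_C1at; rewrite /x0 ?fwdK ?T0 //; exact: fwd_cod.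
  have Cp := @pair_cont R _ 0 x0.
  exact: (continuous_comp Cp (C1at_dcont C (1, 0))).
have NEl := near_neq0 (coord_cont (l := l) CE) El.
have NU : \forall x \near x0, box_coord i j c th ze x /\ E x ord0 l != 0.
  by apply: filterS2 H NEl.
pose U0 := interior [set x | box_coord i j c th ze x /\ E x ord0 l != 0].
have oU0 : open U0 by exact: open_interior.
have U0x : nbhs x0 U0 by apply: near_open => //.
exists U0 => //.
have bc x : U0 x -> box_coord i j c th ze x /\ E x ord0 l != 0.
  by move=> /interior_subset.
have bcn x : U0 x -> \forall y \near x, box_coord i j c th ze y.
  by move=> Ux; apply: filterS Ux => y [].
have Oze x : U0 x -> Oij i j (ze x) by move=> /bc[[_ _ _ _ [Ox _ _]] _].
have Cze x : U0 x -> C1M ze x by move=> /bc[[_ _ C _ _] _].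
apply: (@lebesgue_null_sub _ _ _ (\bigcup_(p : seq I) (U0 `&` ze @^-1` bad p i j))).
  move=> x [Ux nx]; apply: contrapT => A; apply: nx.
  have [[_ _ _ _ [Ox hx Ex]] _] := bc x Ux.
  exists i, j, (ze x), (th x); split=> // p Bp; apply: A.
  by exists p.
apply: lebesgue_null_bigcup => p.
have [N1 [N2 [ow1 ow2 EN]]] := bad_open p ji oU0 (fun x Ux => C1M_cont (Cze x Ux)) Oze.
apply: (null_slices (i := l)).
  by rewrite EN; exact: measurable_tuple_openD.
move=> a.
pose U := [set y : 'rV[R]_n | U0 (ins_row l a y)].
pose psi := ze \o ins_row l a.
have oU : open U.
  by apply: open_comp oU0 => y _; apply: C1at_cont; have [] := ins_row_C1at l a y.
have CU y : U y -> C1M psi y /\ forall v, dM psi y v = dM ze (ins_row l a y) (ins_row l 0 v).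
  move=> Uy; have [Ci Ei] := ins_row_C1at l a y.
  have [C1 E1] := C1M_comp (@fdim_rV R n.+1) Ci (Cze _ Uy).
  by split=> // v; rewrite E1 Ei.
have := @bad_null_section p i j U psi ji oU (fun y Uy => (CU y Uy).1)
  (fun y Uy => Oze _ Uy).
apply=> y v Uy; rewrite (CU y Uy).2 => dv.
have K := foot_kernel ji ac (bcn _ Uy) dv.
have Kl := congr1 (fun m : 'rV[R]_n.+1 => m ord0 l) K.
have [_ El'] := bc _ Uy.
move/eqP: Kl; rewrite ins_row_at mxE eq_sym mulf_eq0 (negbTE El') orbF => /eqP d0.
by apply: (@ins_row0_inj _ _ l); rewrite K d0 scale0r.
Qed.

(** * The pairing along an orbit *)

(** The return times are bounded away from zero: they extend continuously and
    positively to the closures of the sections, which are compact. *)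
Lemma tau_lower_bound : compact [set: M] ->
  exists2 sigma : R, 0 < sigma &
    forall i j z, j \in J i -> Oij i j z -> sigma <= tau i j z.
Proof.
move=> /compact_near_coveringP cM.
pose Pr (e : R) (z : M) := forall i j, j \in J i -> Oij i j z -> e <= tau i j z.
have key (p : M) i j : j \in J i -> exists2 e : R, 0 < e &
    \forall z \near p, Oij i j z -> e <= tau i j z.
  move=> ji; have [clp|nclp] := pselect (closure (Oij i j) p); last first.
    exists 1 => //.
    have : open (~` closure (Oij i j)) by apply: closed_openC; exact: closed_closure.
    move=> /near_open /(_ nclp); apply: filterS => z nz Oz.
    by case: nz; exact: subset_closure.
  have [_ /(_ _ clp) Otp _ Ct [tau0 _]] := rt ji.
  have [U [g [oU Up Cg tg]]] := Ct p Otp.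
  have g0 : 0 < g p by rewrite -tg //; exact: tau0.
  have Cb : C1M (bwd (chart_at p)) (fwd (chart_at p) p).
    by apply: bwd_C1M; [exact: chart_at_atlas|exact: fwd_cod_at].
  have Ub : U (bwd (chart_at p) (fwd (chart_at p) p)) by rewrite bwd_fwd_at.
  have [Cgb _] := Ck_fun_comp oU Cg Ub Cb.
  have lt2 : cst (g p / 2) (fwd (chart_at p) p) < (g \o bwd (chart_at p)) (fwd (chart_at p) p).
    by rewrite /= bwd_fwd_at ltr_pdivrMr // ltr_pMr // ltr1n.
  have H := near_lt (@cst_continuous _ _ (g p / 2) _) (C1at_cont Cgb) lt2.
  have H2 := near_chart (chart_at_dom p) H.
  exists (g p / 2); first by rewrite divr_gt0.
  apply: filterS2 H2 (near_open oU Up) => z [cz /=]; rewrite fwdK // => /ltW gz Uz Oz.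
  by rewrite tg //; exact: (section_Ot ji Oz).
have key2 (p : M) i j : exists e : R, 0 < e /\
    \forall z \near p, j \in J i -> Oij i j z -> e <= tau i j z.
  have [ji|nji] := boolP (j \in J i).
    have [e e0 H] := key p i j ji; exists e; split=> //.
    by apply: filterS H => z Hz _.
  by exists 1; split=> //; apply: filterE.
have local (p : M) : exists2 e : R, 0 < e & \forall z \near p, Pr e z.
  have [e He] := choice (fun ij : I * I => key2 p ij.1 ij.2).
  exists (\big[Num.min/1]_ij e ij).
    elim/big_ind: _ => // [x y x0 y0|ij _]; first by rewrite lt_min x0.
    by have [] := He ij.
  have : \forall z \near p, forall ij : I * I, ij.2 \in J ij.1 ->
      Oij ij.1 ij.2 z -> e ij <= tau ij.1 ij.2 z.
    by apply: filter_forall => ij; have [] := He ij.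
  apply: filterS => z Hz i j ji Oz.
  apply: Order.POrderTheory.le_trans (Hz (i, j) ji Oz).
  by rewrite (bigminD1 (i, j)) // ge_min lexx.
have NC : \forall e \near (0 : R)^'+, [set: M] `<=` Pr e.
  apply: cM => p _; have [e0 e00 He0] := local p.
  exists ([set z | Pr e0 z], [set e : R | e < e0]) => /=.
    by split; [exact: He0|exact: nbhs_right_lt].
  move=> [z e] /= [Hz /ltW ee0] i j ji Oz.
  exact: Order.POrderTheory.le_trans ee0 (Hz i j ji Oz).
have Npos : \forall e \near (0 : R)^'+, 0 < e by exact: nbhs_right_gt.
have [e [e0 He]] : exists e : R, 0 < e /\ [set: M] `<=` Pr e.
  by apply: (@filter_ex _ (0 : R)^'+); apply: filterI.
by exists e => // i j z; exact: He.
Qed.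

Lemma never_bad_next i j z : Oij i j z -> (forall p, ~ bad p i j z) ->
  exists l, [/\ l \in J j, Oij j l (P i j z) & forall p, ~ bad p j l (P i j z)].
Proof.
move=> Oz nb.
have [l [lj Ol]] : exists l, l \in J j /\ Oij j l (P i j z).
  apply: contrapT => H; apply: (nb [::]); split=> // l lj Ol; apply: H; by exists l.
by exists l; split=> // p Bp; apply: (nb (l :: p)).
Qed.

(** A point of a section may be interior to another box.  The constancy of the
    pairing along the orbit in that box relates it to the box ahead. *)
Lemma pairing_local i j z : Ck_oneform 2 alpha -> contact_flow X0 T alpha ->
  j \in J i -> Oij i j z -> regular z ->
  forall s, 0 < s < tau i j z -> pairing z = pairing (T s z).
Proof.
move=> Ca cf ji Oz [k [l [lk [y [r [Oy /andP[r0 r1] Ez]]]]]] s hs.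
have Xy := section_X0 lk Oy.
have tz := tau_gt0 ji Oz.
pose e := Num.min (tau i j z) (tau k l y - r) / 2.
have m0 : 0 < Num.min (tau i j z) (tau k l y - r) by rewrite lt_min tz subr_gt0.
have e0 : 0 < e by rewrite divr_gt0.
have em : e < Num.min (tau i j z) (tau k l y - r).
  by rewrite ltr_pdivrMr // ltr_pMr // ltr1n.
have [e1 e2] : e < tau i j z /\ e < tau k l y - r by apply/andP; rewrite -lt_min.
have h1 : 0 < e < tau i j z by rewrite e0.
rewrite (pairing_box Ca cf ji Oz h1 hs) Ez flow_add //.
apply: (pairing_box Ca cf lk Oy); first last.
  by rewrite r0.
by apply/andP; split; [exact: addr_gt0|rewrite -ltrBrDr].
Qed.

(** Along the forward orbit of a foot point with an uninterrupted itinerary the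
    pairing keeps its value, from one crossing to the next.  Since each return
    takes a time at least [sigma], the induction on [m] exhausts all times. *)
Lemma pairing_orbit (sigma : R) (m : nat) : 0 < sigma ->
  (forall i j z, j \in J i -> Oij i j z -> sigma <= tau i j z) ->
  Ck_oneform 2 alpha -> contact_flow X0 T alpha ->
  forall i j z, j \in J i -> Oij i j z -> (forall p, ~ bad p i j z) ->
  forall t s, 0 <= t -> t < m%:R * sigma -> 0 < s < tau i j z -> regular (T t z) ->
  pairing (T t z) = pairing (T s z).
Proof.
move=> s0 Hs Ca cf; elim: m => [|m IH] i j z ji Oz nb t s t0 tm hs rg.
  by move: tm; rewrite mul0r ltNge t0.
have Xz := section_X0 ji Oz.
have [ttau|ttau] := ltP t (tau i j z).
  move: t0; rewrite le_eqVlt => /orP[/eqP t00|t0].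
    rewrite -t00 flow_0 // in rg *.
    exact: (pairing_local Ca cf ji Oz rg hs).
  by apply: (pairing_box Ca cf ji Oz hs); rewrite t0.
have [l [lj Ol nb']] := never_bad_next Oz nb.
have E : T t z = T (t - tau i j z) (P i j z).
  by rewrite (hit_section ji Oz).2 flow_add // subrK.
have tl := tau_gt0 lj Ol.
have h2 : 0 < tau j l (P i j z) / 2 < tau j l (P i j z).
  exact: half_itv.
rewrite E (IH j l (P i j z) lj Ol nb' _ (tau j l (P i j z) / 2)) //.
- exact: (pairing_crossing Ca cf ji lj Oz Ol hs h2).
- by rewrite subr_ge0.
- have Htau := Hs i j z ji Oz.
  have H (a b c e : R) : a < (c + 1) * b -> b <= e -> a - e < c * b by move=> *; lra.
  by apply: H Htau; rewrite -natr1 in tm.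
- by rewrite -E.
Qed.

Lemma orbit_visits (sigma : R) (m : nat) :
  (forall i j z, j \in J i -> Oij i j z -> sigma <= tau i j z) ->
  forall i j z, j \in J i -> Oij i j z -> (forall p, ~ bad p i j z) ->
  exists t, m%:R * sigma <= t /\ regular (T t z).
Proof.
move=> Hs; elim: m => [|m IH] i j z ji Oz nb.
  have tz := tau_gt0 ji Oz.
  exists (tau i j z / 2); split; first by rewrite mul0r ltW // divr_gt0.
  exists i, j; split=> //; exists z, (tau i j z / 2); split=> //.
  exact: half_itv.
have [l [lj Ol nb']] := never_bad_next Oz nb.
have [t [tm rg]] := IH j l (P i j z) lj Ol nb'.
have Xz := section_X0 ji Oz.
exists (t + tau i j z); split.
  have Htau := Hs i j z ji Oz.
  have H (a b c e : R) : c * b <= a -> b <= e -> (c + 1) * b <= a + e by move=> *; lra.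
  by rewrite -natr1; exact: H.
by move: rg; rewrite (hit_section ji Oz).2 flow_add.
Qed.

Lemma nice_orbit w : compact [set: M] -> Ck_oneform 2 alpha ->
  contact_flow X0 T alpha -> nice w ->
  (forall t, 0 <= t -> regular (T t w) -> pairing (T t w) = pairing w) /\
  (forall K : R, exists t, K < t /\ regular (T t w)).
Proof.
move=> cM Ca cf [i [j [z [t0 [ji Oz ht -> nb]]]]].
have [sigma s0 Hs] := tau_lower_bound cM.
have Xz := section_X0 ji Oz.
have /andP[t00 _] := ht.
split=> [t t1|K].
  rewrite flow_add // => rg.
  apply: (pairing_orbit (m := (Num.truncn ((t + t0) / sigma)).+1) s0 Hs Ca cf ji Oz nb _ _ ht rg).
    by rewrite addr_ge0 // ltW.
  rewrite -ltr_pdivrMr //; apply: truncnS_gt.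
have [t [tm rg]] := orbit_visits (Num.truncn ((`|K| + t0) / sigma)).+1 Hs ji Oz nb.
exists (t - t0); split; last by rewrite flow_add // subrK.
have H : (`|K| + t0) / sigma < ((Num.truncn ((`|K| + t0) / sigma)).+1)%:R by exact: truncnS_gt.
rewrite ltr_pdivrMr // in H.
have KK := ler_norm K.
by rewrite ltrBrDr; apply: Order.POrderTheory.le_lt_trans (Order.POrderTheory.lt_le_trans H tm); rewrite lerD2r.
Qed.

Lemma orbit_near w t (U : set M) : X0 w -> open U -> U `<=` regular -> U (T t w) ->
  \forall s \near t, U (T s w).
Proof.
move=> Xw oU Ur Ut; have [i [j [ji Bw]]] := Ur _ Ut.
have [C _] := orbit_velocity ji Bw (chart_at_atlas _) (chart_at_dom _).
have Cs : {for t, continuous (fun s : R => s - t)}.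
  by apply: C1at_cont; exact: (C1atD (C1at_id _) (C1at_cst (- t) _)).
have Ct : {for t - t, continuous (T ^~ (T t w))} by rewrite subrr; exact: (C1M_cont C).
have Ut' : U (T (t - t) (T t w)) by rewrite subrr flow_0 //; exact: flow_X0.
have H : \forall s \near t, U (T (s - t) (T t w)).
  exact: (near_continuous (continuous_comp Cs Ct) (near_open oU Ut')).
by apply: filterS H => s; rewrite flow_add // subrK.
Qed.

(** * The Reeb direction *)

Lemma flow_near_box i j p c : j \in J i -> obox i j p -> atlas c -> chart_dom c p ->
  \forall z \near (0 : R, fwd c p), [/\ chart_cod c z.2, obox i j (bwd c z.2),
    D i j (z.1, bwd c z.2), chart_dom c (Tij i j z.1 (bwd c z.2)) &
    T z.1 (bwd c z.2) = Tij i j z.1 (bwd c z.2)].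
Proof.
move=> ji Bp ac cp; have [z [t [Oz ht Ep]]] := Bp; rewrite Ep in cp Bp *.
have lf := box_flow ji.
set x0 := fwd c (T t z).
have [th [ze [th0 ze0 H]]] := box_coordP ji Oz ht ac cp.
have Hf : {for (0 : R, x0), continuous (fst : R * 'rV[R]_n.+1 -> R)} by exact: cvg_fst.
have Hs : {for (0 : R, x0), continuous (snd : R * 'rV[R]_n.+1 -> 'rV[R]_n.+1)} by exact: cvg_snd.
have N0 := near_continuous Hs H.
have [cx0 Cth _ Ctau _] := nbhs_singleton H.
have C1 : {for (0 : R, x0), continuous (fun y : R * 'rV[R]_n.+1 => th y.2)}.
  exact: (continuous_comp Hs (C1at_cont Cth)).
have C2 : {for (0 : R, x0), continuous (fun y : R * 'rV[R]_n.+1 => y.1 + th y.2)}.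
  by rewrite /prop_for /continuous_at; apply: cvgD; [exact: Hf|exact: C1].
have C3 : {for (0 : R, x0), continuous (fun y : R * 'rV[R]_n.+1 => (tau i j \o ze) y.2)}.
  exact: (continuous_comp Hs (C1at_cont Ctau)).
have /andP[t0 tt] := ht.
have l1 : 0 < 0 + th x0 by rewrite add0r th0.
have l2 : 0 + th x0 < (tau i j \o ze) x0 by rewrite add0r th0 /= ze0.
have N1 := near_lt (@cst_continuous _ _ 0 (0 : R, x0)) C2 l1.
have N2 := near_lt C2 C3 l2.
have [D0 _] := obox_flow ji Bp.
have T0 : Tij i j 0 (T t z) = T t z by have [] := lf0 lf (lfB lf D0).1.
have N3 : \forall y \near (0 : R, x0), chart_dom c (Tij i j y.1 (bwd c y.2)).
  have D0' : D i j (0, bwd c x0) by rewrite fwdK.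
  have cont := C1M_cont (flow_in_C1M lf ac (fwd_cod cp) D0').
  apply: (near_dom cont); by rewrite /flow_in /= fwdK // T0.
have N12 : \forall y \near (0 : R, x0), 0 < y.1 + th y.2 /\ y.1 + th y.2 < (tau i j \o ze) y.2.
  by apply: filterS2 N1 N2.
apply: filterS3 N0 N12 N3 => -[s x] [cx _ _ _ [Ox hx Ex]] /= [h1 h2] h3.
have hx' : 0 <= th x < tau i j (ze x) by case/andP: hx => /ltW -> ->.
have hs : 0 <= s + th x < tau i j (ze x) by rewrite (ltW h1).
have [Ds Ts] := flow_in_box ji Ox hx' hs.
rewrite -Ex in Ds Ts; split=> //.
by exists (ze x), (th x).
Qed.

(** Invariance almost everywhere extends by continuity to the points of the open
    boxes, for small times. *)
Lemma form_invariant i j p c u : Ck_oneform 2 alpha -> contact_flow X0 T alpha ->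
  j \in J i -> obox i j p -> atlas c -> chart_dom c p ->
  \forall t \near (0 : R),
    \sum_l comp_in alpha c l (phi i j c (t, fwd c p)) * 'd (phi i j c) (t, fwd c p) (0, u) ord0 l
    = \sum_l comp_in alpha c l (fwd c p) * u ord0 l.
Proof.
move=> Ca cf ji Bp ac cp; have lf := box_flow ji.
set x0 := fwd c p; have cx0 : chart_cod c x0 by exact: fwd_cod.
have [e e0 He] := prod_ballP (flow_near_box ji Bp ac cp).
exists e => // t /= te.
have {}te : `|t - 0| < e by rewrite distrC.
have Ht x (hx : `|x - x0| < e) := He t x te hx.
have Nx : \forall x \near x0, `|x - x0| < e by exact: ball_near.
have x00 : `|x0 - x0| < e by rewrite subrr normr0.
have Cphi x : `|x - x0| < e -> C1at (phi i j c) (t, x).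
  by move=> /Ht[/= cx Bx Dx cT _]; exact: phi_C1at.
pose A x := \sum_l comp_in alpha c l (phi i j c (t, x)) * 'd (phi i j c) (t, x) (0, u) ord0 l.
pose B x := \sum_l comp_in alpha c l x * u ord0 l.
rewrite -/(A x0) -/(B x0); apply/eqP/negPn/negP => ne.
have Cp := @pair_cont R _ t x0.
have C0 := Cphi x0 x00.
have CA : {for x0, continuous A}.
  apply: continuous_sum => l.
  have [/= cx Bx Dx cT _] := Ht x0 x00.
  have C1 : {for x0, continuous (fun x => 'd (phi i j c) (t, x) (0, u))}.
    exact: (continuous_comp Cp (C1at_dcont C0 (0, u))).
  have C2 : {for x0, continuous (fun x => phi i j c (t, x))}.
    exact: (continuous_comp Cp (C1at_cont C0)).
  have cphi : chart_cod c (phi i j c (t, x0)) by exact: fwd_cod.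
  have C3 := C1at_cont (Ck_oneform_C1 l Ca ac cphi).
  exact: (continuousM (continuous_comp C2 C3) (coord_cont (l := l) C1)).
have CB : {for x0, continuous B}.
  apply: continuous_sum => l.
  exact: (continuousM (C1at_cont (Ck_oneform_C1 l Ca ac cx0)) (@cst_continuous _ _ (u ord0 l) x0)).
have NE := near_neq CA CB ne.
have := cf t c ac; apply: (@open_not_null _ _ _ x0).
have Nx2 := near_join Nx.
apply: filterS3 Nx Nx2 NE => x hx hx2 nx.
have [/= cx Bx Dx cT ET] := Ht x hx.
have cb : chart_dom c (bwd c x) by exact: bwd_dom.
have NT : \forall y \near x, (Tij i j t \o bwd c) y = (T t \o bwd c) y.
  by apply: filterS hx2 => y /Ht[_ _ _ _ /= ->].
have Cslice : C1M (Tij i j t \o bwd c) x.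
  by have [] := @flow_comp _ _ _ _ _ _ lf _ (cst t) (bwd c) x c ac cb (C1at_cst t x) (bwd_C1M ac cx) Dx.
have [CT ET'] := near_eq_C1M NT Cslice.
have Cmap : C1map (T t) (bwd c x).
  by apply: (C1map_chart ac cb); rewrite bwdK.
split=> //=; split.
- by apply: regular_interior; exists i, j.
- exact: C1map_mdifferentiable.
- move=> Hc; move/eqP: nx; apply.
  have := Hc (coord_vec c (bwd c x) u).
  have [_ E1] := C1map_comp (bwd_C1M ac cx) Cmap.
  have cTc : chart_dom c ((T t \o bwd c) x) by rewrite /= ET.
  have [_ E2] := C1M_chart ac cTc CT.
  have dslice : 'd (fwd c \o (T t \o bwd c)) x u = 'd (phi i j c) (t, x) (0, u).
    have [_ E3] := diff_slice (C1at_diff (Cphi x hx)).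
    have NT2 : \forall y \near x, phi i j c (t, y) = (fwd c \o (T t \o bwd c)) y.
      by apply: filterS hx2 => y /Ht[_ _ _ _ /= ->].
    have [_ E4] := near_eq_diff NT2 (diff_slice (C1at_diff (Cphi x hx))).1.
    by apply: (etrans (congr1 (fun h => h u) E4)); exact: (congr1 (fun h => h u) E3).
  have -> : mdiff (T t) (bwd c x) (coord_vec c (bwd c x) u) =
      coord_vec c (T t (bwd c x)) ('d (phi i j c) (t, x) (0, u)).
    by rewrite -dM_bwd // -E1; apply: (etrans (E2 u)); rewrite dslice.
  have cphi : bwd c (phi i j c (t, x)) = T t (bwd c x).
    by rewrite /phi /flow_in /= fwdK // -ET.
  rewrite -{1 2}cphi => Hq.
  have Hq' : eval_in alpha c ('d (phi i j c) (t, x) (0, u)) (phi i j c (t, x)) = eval_in alpha c u x.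
    exact: Hq.
  move: Hq'; rewrite !eval_inE => Hq'.
  rewrite /A /B; under eq_bigr do rewrite mulrC.
  by rewrite Hq'; apply: eq_bigr => l _; rewrite mulrC.
Qed.

Lemma vel_in_kernel p (C : R) : Ck_oneform 2 alpha -> contact_flow X0 T alpha ->
  regular p -> (forall w, regular w -> pairing w = C) ->
  forall u, ext_deriv alpha p (vel p) u = 0.
Proof.
move=> Ca cf [i [j [ji Bp]]] HC u; have lf := box_flow ji.
set c := chart_at p.
have ac : atlas c by exact: chart_at_atlas.
have cp : chart_dom c p by exact: chart_at_dom.
have [_ Ev] := orbit_velocity ji Bp ac cp.
rewrite Ev coord_vec_at (ext_derivE _ _ _ Ca) /ext_in -/c.
set x0 := fwd c p; have cx0 : chart_cod c x0 by exact: fwd_cod.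
have H := flow_near_box ji Bp ac cp.
apply: (cartan_formula (phi := phi i j c) (a := comp_in alpha c) (C := C)).
- by apply: filterS H => -[s x] [/= cx _ Dx cT _]; exact: C1at_diff (phi_C1at ji ac cx Dx cT).
- move=> v; have [_ /(_ c ac) [_ /(_ v) [+ _]]] := flow_in_C2 lf ac; apply.
  by have [/= cx _ Dx cT _] := nbhs_singleton H.
- have Cp := @pair_cont R _ 0 x0.
  apply: filterS (near_continuous Cp H) => x [/= cx Bx Dx cT _].
  have [_ T0] := lf0 lf (lfB lf Dx).1.
  by rewrite /phi /flow_in /= T0 bwdK.
- by move=> l; exact: (Ck_oneform_diff l Ca ac cx0).
- by move=> v; exact: form_invariant.
- have Cp := @pair_cont R _ 0 x0.
  apply: filterS (near_continuous Cp H) => x [/= cx Bx Dx cT _].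
  have rx : regular (bwd c x) by exists i, j.
  rewrite -(HC _ rx) (pairing_in ji Bx ac (bwd_dom cx)) bwdK //.
  by apply: eq_bigr => l _; rewrite mulrC.
Qed.

(** A section is locally the zero set of a function without critical points. *)
Lemma section_null c i : atlas c -> lebesgue_null (chart_cod c `&` bwd c @^-1` O i).
Proof.
move=> ac; apply: lebesgue_null_local => x [cx Ox].
have [subO _] := st.
have [U [g [oU Uq Cg gO gs]]] := subO i _ Ox.
set q := bwd c x in Ox Uq; have cq : chart_dom c q by exact: bwd_dom.
have [v dv] := gs q Uq Ox (const_mx 1).
pose u := 'd (fwd c \o bwd (chart_at q)) (fwd (chart_at q) q) v.
have [CL EL] := lev_C1at oU Cg ac cx Uq.
have du : 'd (lev g c) x u != 0.
  rewrite EL; have [_ E] := Ck_fun_comp oU Cg Uq (bwd_C1M ac cx).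
  by rewrite E dM_bwd // coord_vecK // dv mxE oner_neq0.
have [U' nU' null'] := null_level CL du.
have NU : \forall y \near x, U (bwd c y).
  by apply: (near_continuous (bwd_continuous cx)); exact: near_open.
exists (U' `&` [set y | U (bwd c y)]); first exact: filterI.
apply: lebesgue_null_sub null' => y [[cy Oy] [U'y Uy]]; split=> //=.
by rewrite /lev ((gO _ Uy).1 Oy) mxE.
Qed.

(** A point of a box is in the open box or on the section at its entrance. *)
Lemma regular_ae c : boxes_decomposition X0 T F -> atlas c ->
  lebesgue_null (chart_cod c `&` bwd c @^-1` (X0 `\` regular)).
Proof.
move=> [_ nb _ _] ac.
apply: (@lebesgue_null_sub _ _ _ ((chart_cod c `&` bwd c @^-1`
    (X0 `\` [set w | exists i j, j \in J i /\ box T i j w])) `|`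
    \bigcup_(i : I) (chart_cod c `&` bwd c @^-1` O i))); last first.
  apply: lebesgue_nullU; first exact: nb.
  by apply: lebesgue_null_bigcup => i; exact: section_null.
move=> x [cx [Xx nr]].
have [[i [j [ji [z [t [Oz /andP[t0 tt] Ez]]]]]]|nbx] :=
  pselect (exists i j, j \in J i /\ box T i j (bwd c x)); last by left.
right; exists i => //; split=> //=; rewrite Ez.
move: t0; rewrite le_eqVlt => /orP[/eqP <-|t0].
  by rewrite flow_0; [exact: (section_O ji Oz)|exact: (section_X0 ji Oz)].
by case: nr; exists i, j; split=> //; exists z, t; rewrite t0.
Qed.

Lemma vel_neq0 p : regular p -> vel p != 0.
Proof.
move=> [i [j [ji [z [t [Oz ht ->]]]]]].
have Bp : obox i j (T t z) by exists z, t.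
have ac := chart_at_atlas (T t z); have cp := chart_at_dom (T t z).
have [_ Ev] := orbit_velocity ji Bp ac cp.
rewrite Ev coord_vec_at.
exact: (velocity_neq0 ji Oz ht ac cp).
Qed.

End piecewise_flow.

(** * Ergodicity *)

Section ergodicity.
Context {R : realType} {k : nat} {M : manifold R (k * 2).+1}.
Context {X0 : set M} {T : R -> M -> M} {F : flow_boxes M} {alpha : oneform M}.
Local Notation regular := (regular (F := F) (T := T)).
Local Notation nice := (nice (F := F) (T := T)).
Local Notation pairing := (pairing (T := T) (alpha := alpha)).
Context (mf : measurable_flow X0 T) (st : sections_transversal F)
  (sd : sections_decomposition F) (rt : return_times X0 T F)
  (le : local_extensions T F).

Definition escaping (V : set M) : set M :=
  [set w | X0 w /\ exists m : nat, forall t : R, m%:R < t -> ~ V (T t w)].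

(** The condition bears on the tail of the orbit. *)
Lemma escaping_invariant (V : set M) s : X0 `&` T s @^-1` escaping V = escaping V.
Proof.
apply/seteqP; split=> w.
  move=> [Xw [_ [m H]]]; split=> //.
  exists (Num.truncn (`|s| + m%:R)).+1 => t tm.
  rewrite (_ : t = (t - s) + s); last by rewrite subrK.
  rewrite -(flow_add mf) //; apply: H.
  have H1 := truncnS_gt (`|s| + m%:R).
  have H2 := ler_norm s.
  have H (a b c e r : R) : a + b < c -> c < e -> r <= a -> b < e - r by move=> *; lra.
  exact: H H1 tm H2.
move=> [Xw [m H]]; split=> //; split; first exact: (flow_X0 mf).
exists (Num.truncn (`|s| + m%:R)).+1 => t tm.
rewrite (flow_add mf) //; apply: H.
have H1 := truncnS_gt (`|s| + m%:R).
have H2 := ler_normr (- s) s.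
have H3 : - s <= `|s| by rewrite -normrN ler_norm.
have H (a b c e r : R) : a + b < c -> c < e -> - r <= a -> b < e + r by move=> *; lra.
exact: H H1 tm H3.
Qed.

(** The times at which an orbit is in the open set [V] form an open set, so that
    rational times decide. *)
Lemma escaping_measurable (V : set M) : closed X0 -> open V -> V `<=` regular ->
  measurable (escaping V : set (borelM M)).
Proof.
move=> cX oV Vr.
have mX := borel_closed cX.
have mV : measurable (V : set (borelM M)) by exact: borel_open.
have mT (t : R) : measurable (X0 `&` T t @^-1` V : set (borelM M)).
  have [_ _ _ mm] := mf.
  have mD : measurable ([set: measurableTypeR R] `*` (X0 : set (borelM M))).
    exact: measurableX.
  have := mm mD V mV.
  set A := _ `&` _ => mA.
  have := @measurable_xsection _ _ (measurableTypeR R) (borelM M) A t mA.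
  rewrite (_ : xsection A t = X0 `&` T t @^-1` V) //.
  by apply/seteqP; split=> w; rewrite xsectionE /A /= => -[]; [case=> _|split].
have -> : escaping V = \bigcup_(m : nat) \bigcap_(q : rat)
    (if m%:R < ratr q :> R then X0 `\` (X0 `&` T (ratr q) @^-1` V) else X0).
  apply/seteqP; split=> w.
    move=> [Xw [m H]]; exists m => // q _; case: ifPn => // mq; split=> // -[_].
    exact: H.
  move=> [m _ H].
  have Xw : X0 w by have := H 0 I; case: ifPn => // _ [].
  split=> //; exists m => t mt Vt.
  have N1 := orbit_near mf rt le Xw oV Vr Vt.
  have N2 : \forall s \near t, m%:R < s by apply: lt_nbhsr.
  have [e /= e0 He] : nbhs t [set s | V (T s w) /\ m%:R < s] by apply: filterI.
  have [q] : exists q : rat, ratr q \in `]t, t + e[ by apply: rat_in_itvoo; rewrite ltrDl.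
  rewrite in_itv /= => /andP[q1 q2].
  have [Vq mq] : V (T (ratr q) w) /\ m%:R < ratr q :> R.
    by apply: He; rewrite /ball /= ltr_distlC; apply/andP; split; lra.
  by have := H q Logic.I; rewrite mq => -[_]; apply.
apply: bigcup_measurable => m _.
rewrite -[X in measurable X]setCK; apply: measurableC; rewrite setC_bigcap.
apply: bigcupT_measurable_rat => q; apply: measurableC.
by case: ifPn => _ //; apply: measurableD.
Qed.

(** If the pairing took two values, the points whose orbit eventually avoids a
    superlevel set would form an invariant set, neither null nor conull: almost
    every orbit keeps the pairing of its starting point and visits the open boxes
    at arbitrarily large times. *)
Lemma pairing_constant (vol : {measure set (borelM M) -> \bar R}) w1 w2 :
  compact [set: M] -> contact_form alpha -> is_volume alpha vol -> closed X0 ->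
  contact_flow X0 T alpha -> ergodic vol X0 T ->
  regular w1 -> regular w2 -> ~ (pairing w1 < pairing w2).
Proof.
move=> cM ca hv cX cf erg r1 r2 lt12; have Ca := ca.1.
(* the level that separates the two values *)
pose b := (pairing w1 + pairing w2) / 2.
have b1 : pairing w1 < b by rewrite /b; lra.
have b2 : b < pairing w2 by rewrite /b; lra.
pose V := interior [set w | regular w /\ b < pairing w].
have VE w : regular w -> b < pairing w -> V w.
  move=> rw bw; rewrite /V /interior.
  have N1 := near_regular mf st sd rt le rw.
  have N2 := near_lt (@cst_continuous _ _ b w) (pairing_cont mf st sd rt le Ca rw) bw.
  by apply: filterS2 N1 N2.
have oV : open V by exact: open_interior.
have VV w : V w -> regular w /\ b < pairing w by move=> /interior_subset.
have Vr : V `<=` regular by move=> w /VV[].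
have mA := escaping_measurable cX oV Vr.
have AX : escaping V `<=` X0 by move=> w [].
have inv t : let TA := X0 `&` T t @^-1` escaping V in
    vol ((TA `\` escaping V) `|` (escaping V `\` TA)) = 0%E.
  by rewrite /= escaping_invariant setDv setU0 measure0.
have N1 : \forall w \near w1, regular w /\ pairing w < b.
  have N1 := near_regular mf st sd rt le r1.
  have N2 := near_lt (pairing_cont mf st sd rt le Ca r1) (@cst_continuous _ _ b w1) b1.
  by apply: filterS2 N1 N2.
have N2 : \forall w \near w2, regular w /\ b < pairing w.
  by apply: filterS (near_open oV (VE _ r2 b2)) => w /VV.
have in1 w : nice w -> regular w -> pairing w < b -> escaping V w.
  move=> nw rw wb; have [H _] := nice_orbit mf st sd rt le cM Ca cf nw.
  split; first exact: (regular_X0 mf rt rw).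
  exists 0%N => t t0 /VV[rt' bt]; move: bt.
  by rewrite (H t (ltW t0) rt') ltNge ltW.
have in2 w : nice w -> regular w -> b < pairing w -> ~ escaping V w.
  move=> nw rw wb [Xw [m H]]; have [H1 H2] := nice_orbit mf st sd rt le cM Ca cf nw.
  have [t [mt rt']] := H2 m%:R; apply: (H t mt); apply: VE => //.
  by rewrite H1 //; apply: ltW; apply: Order.POrderTheory.le_lt_trans mt.
have final w (Z : set M) : regular w -> lebesgue_null (chart_cod (chart_at w) `&` bwd (chart_at w) @^-1` Z) ->
    (\forall q \near w, nice q -> Z q) -> False.
  move=> rw nZ NZ.
  have [U nU nullU] := nice_ae mf st sd rt le rw (chart_at_atlas w) (chart_at_dom w).
  have NZ' := near_chart_cod (chart_at_dom w) NZ.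
  apply: (open_not_null (filterI nU NZ')).
  apply: lebesgue_null_sub (lebesgue_nullU nullU nZ) => x [Ux [cx Hx]].
  have [nx|nx] := pselect (nice (bwd (chart_at w) x)); first by right; split=> //; exact: Hx.
  by left.
case: (erg _ mA AX inv) => v0.
  apply: (final w1 (escaping V) r1).
    exact: (volume_null ca hv (chart_at_atlas w1) mA v0).
  by apply: filterS N1 => w [rw wb] nw; exact: in1.
have mX := borel_closed cX.
apply: (final w2 (X0 `\` escaping V) r2).
  by apply: (volume_null ca hv (chart_at_atlas w2) _ v0); exact: measurableD.
apply: filterS N2 => w [rw wb] nw; split; last exact: in2.
exact: (regular_X0 mf rt rw).
Qed.

End ergodicity.

(** * Contact flows are Reeb flows *)

Theorem lemmaA1 (R : realType) (k du ds : nat) (M : manifold R (k * 2).+1)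
    (alpha : oneform M) (X0 : set M) (T : R -> M -> M)
    (vol : {measure set (borelM M) -> \bar R})
    (hM : compact [set: M])
    (hdu : (1 <= du)%N) (hds : (1 <= ds)%N)
    (hd : (k * 2).+1 = (du + ds + 1)%N)
    (halpha : contact_form alpha)
    (hvol : is_volume alpha vol)
    (hX0 : closed X0)
    (hT : piecewise_cone_hyperbolic du ds X0 T)
    (hcontact : contact_flow X0 T alpha)
    (hergodic : ergodic vol X0 T) :
  exists beta : oneform M, contact_form beta /\ reeb_flow X0 T beta.
Proof.
have [mf [F [st sd rt bd [le _ _]]]] := hT.
have Ca := halpha.1.
have [C C0 HC] : exists2 C : R, C != 0 & forall w, regular (F := F) (T := T) w ->
    pairing (T := T) (alpha := alpha) w = C.
  have [[p rp]|nr] := pselect (exists p, regular (F := F) (T := T) p); last first.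
    (* the boxes are then null and every constant will do *)
    by exists 1; [exact: oner_neq0|move=> w rw; case: nr; exists w].
  have HC w : regular (F := F) (T := T) w ->
      pairing (T := T) (alpha := alpha) w = pairing (T := T) (alpha := alpha) p.
    move=> rw; have cst u v ru rv :=
      @pairing_constant _ _ _ _ _ F alpha mf st sd rt le vol u v hM halpha hvol hX0 hcontact hergodic ru rv.
    apply/eqP; rewrite eq_le !leNgt; apply/andP; split; apply/negP.
      exact: cst.
    exact: cst.
  exists (pairing (T := T) (alpha := alpha) p) => //.
  apply/eqP => p0.
  have := vel_neq0 mf st sd rt le rp.
  rewrite (contact_kernel Ca (halpha.2 p) p0 (vel_in_kernel mf st sd rt le Ca hcontact rp HC)).
  by rewrite eqxx.
exists (fun p => C^-1 *: alpha p); split.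
  by apply: contact_form_scale => //; rewrite invr_eq0.
move=> c ac; apply: lebesgue_null_sub (regular_ae mf st sd rt bd ac) => x [cx [Xx nV]].
split=> //; split=> // rx; apply: nV.
exists (vel (T := T) (bwd c x)); split.
- have [i [j [ji Bx]]] := rx.
  have [Cx _] := orbit_velocity mf rt le ji Bx (chart_at_atlas _) (chart_at_dom _).
  exact: C1M_velocity.
- move=> u; rewrite (ext_deriv_scale _ _ _ _ Ca).
  by rewrite (vel_in_kernel mf st sd rt le Ca hcontact rx HC) mulr0.
- by rewrite eval_scale -/(pairing (bwd c x)) HC // mulVf.
Qed.
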